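(* Let $\alpha>-1$ and let $\psi$ be an Orlicz function. (1) For every holomorphic $\phi:\mathbb{D}\to\mathbb{D}$, the composition operator $C_\phi$ is bounded from $A_\alpha^\psi(\mathbb{D})$ into itself. (2) When $N>1$, if $\psi$ satisfies the $\Delta^2$-Condition, then for every holomorphic $\phi:\mathbb{B}_N\to\mathbb{B}_N$ the composition operator $C_\phi$ is bounded from $A_\alpha^\psi(\mathbb{B}_N)$ into itself.
   Context: $\mathbb{B}_N$ is the open unit ball of $\mathbb{C}^N$ and $\mathbb{D}=\mathbb{B}_1$. An Orlicz function is a strictly convex function $\psi:\mathbb{R}_+\to\mathbb{R}_+$ vanishing at $0$, continuous at $0$, with $\psi(x)/x\to+\infty$ as $x\to\infty$. For $\alpha>-1$, $dv_\alpha(z)=c_\alpha(1-|z|^2)^\alpha dv(z)$, where $dv$ is normalized Lebesgue volume measure on $\mathbb{B}_N$ and $c_\alpha$ is such that $v_\alpha(\mathbb{B}_N)=1$. The weighted Bergman-Orlicz space $A_\alpha^\psi(\mathbb{B}_N)$ is the space of holomorphic $f$ on $\mathbb{B}_N$ such that $\int_{\mathbb{B}_N}\psi(|f|/C)\,dv_\alpha<\infty$ for some $C>0$, with the Luxemburg norm $\|f\|=\inf\{C>0:\int_{\mathbb{B}_N}\psi(|f|/C)\,dv_\alpha\le 1\}$. The composition operator is $C_\phi(f)=f\circ\phi$. $\Delta^2$-Condition for $\psi$: there exist $x_0>0$ and $C>0$ such that $\psi(x)^2\le\psi(Cx)$ for every $x\ge x_0$. *)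

(* Defs.v *)
From HB Require Import structures.
From mathcomp Require Import all_boot all_order all_algebra.
From mathcomp Require Import complex.
From mathcomp Require Import all_classical all_reals all_analysis.

Set Implicit Arguments.
Unset Strict Implicit.
Unset Printing Implicit Defensive.

Import Order.TTheory GRing.Theory Num.Theory.
Import numFieldNormedType.Exports.

Local Open Scope classical_set_scope.
Local Open Scope ring_scope.
Local Open Scope complex_scope.

(* numFieldNormedType only covers abstract number fields; these instances
   give the concrete field R[i] the topology and norm of its own modulus. *)
#[non_forgetful_inheritance]
HB.instance Definition _ (R : realType) :=
  PseudoPointedMetric.copy R[i] (R[i] : numClosedFieldType)^o.
#[non_forgetful_inheritance]
HB.instance Definition _ (R : realType) :=
  GRing.ComAlgebra.copy R[i] (R[i] : numClosedFieldType)^o.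
#[non_forgetful_inheritance]
HB.instance Definition _ (R : realType) :=
  Vector.copy R[i] (R[i] : numClosedFieldType)^o.
#[non_forgetful_inheritance]
HB.instance Definition _ (R : realType) :=
  NormedModule.copy R[i] (R[i] : numClosedFieldType)^o.

Section UnitBall.
Context {R : realType}.

Definition modulus (w : R[i]) : R := ComplexField.Normc.normc w.

(* |z|^2 for the Hermitian norm of C^N; the library's norm on ['rV_N] is the
   sup norm, which has the same topology but another unit ball. *)
Definition sqnorm {N : nat} (z : 'rV[R[i]]_N) : R :=
  \sum_(j < N) modulus (z 0 j) ^+ 2.

Definition unit_ball {N : nat} : set 'rV[R[i]]_N := [set z | sqnorm z < 1].

(* [differentiable] is taken over the field R[i], i.e. this is complex
   Frechet differentiability at every point of the ball; values outside the
   ball are irrelevant. *)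
Definition holomorphic_on_ball {N : nat} {W : normedModType R[i]}
    (f : 'rV[R[i]]_N -> W) : Prop :=
  forall z : 'rV[R[i]]_N, unit_ball z -> differentiable f z.

End UnitBall.

(* Product measures on tuples, from the library's binary products. *)
Section TupleMeasure.
Context {R : realType} {d : measure_display} {T : measurableType d}.
Context (mu : {sigma_finite_measure set T -> \bar R}).
Local Open Scope ereal_scope.

Definition tcons (n : nat) (p : n.-tuple T * T) : n.+1.-tuple T :=
  [tuple of p.2 :: p.1].

Section Step.
Context (n : nat) (m : {measure set (n.-tuple T) -> \bar R}).

Lemma measurable_tcons : measurable_fun setT (@tcons n).
Proof. exact: measurable_cons. Qed.

Definition tcons_measure : set (n.+1.-tuple T) -> \bar R :=
  pushforward (m \x mu) (@tcons n).

Let tcons_measure0 : tcons_measure set0 = 0.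
Proof. by rewrite /tcons_measure /pushforward preimage_set0 measure0. Qed.

Let tcons_measure_ge0 A : 0 <= tcons_measure A.
Proof. exact: (measure_ge0 (m \x mu)). Qed.

Let tcons_measure_sigma_additive : semi_sigma_additive tcons_measure.
Proof.
move=> F mF tF mUF; rewrite /tcons_measure /pushforward preimage_bigcup.
apply: measure_semi_sigma_additive.
- by move=> k; rewrite -[X in measurable X]setTI; exact: measurable_tcons.
- apply/trivIsetP => /= i j _ _ ij; rewrite -preimage_setI.
  by move/trivIsetP : tF => /(_ _ _ _ _ ij) ->//; rewrite preimage_set0.
- rewrite -preimage_bigcup -[X in measurable X]setTI.
  exact: measurable_tcons.
Qed.

HB.instance Definition _ := isMeasure.Build _ _ _ tcons_measure
  tcons_measure0 tcons_measure_ge0 tcons_measure_sigma_additive.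

End Step.

Fixpoint tuple_measure (n : nat) : {measure set (n.-tuple T) -> \bar R} :=
  match n with
  | 0 => \d_([tuple] : 0.-tuple T)
  | n'.+1 => tcons_measure (tuple_measure n')
  end.

End TupleMeasure.

Definition lebesgue_Rn (R : realType) (n : nat) :
    {measure set (n.-tuple (measurableTypeR R)) -> \bar R} :=
  tuple_measure (@lebesgue_measure R) n.

Section WeightedMeasure.
Context {R : realType} {N : nat}.
Local Notation CN := 'rV[R[i]]_N.
Local Notation R2N := ((N + N).-tuple (measurableTypeR R)).

(* The coordinates are (x_1, ..., x_N, y_1, ..., y_N) with z = x + i y. *)
Definition point_of_coords (t : R2N) : CN :=
  \row_(j < N) (tnth t (lshift N j) +i* tnth t (rshift N j)).

Definition coord_ball : set R2N := point_of_coords @^-1` unit_ball.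

(* Integral over the ball for the normalized volume measure dv. *)
Definition int_v (g : CN -> \bar R) : \bar R :=
  ((fine (lebesgue_Rn R (N + N) coord_ball))^-1%:E *
   \int[lebesgue_Rn R (N + N)]_(t in coord_ball) g (point_of_coords t))%E.

Definition c_alpha (alpha : R) : R :=
  (fine (int_v (fun z => ((1 - sqnorm z) `^ alpha)%:E)))^-1.

(* Integral over the ball for dv_alpha = c_alpha (1 - |z|^2)^alpha dv. *)
Definition int_v_alpha (alpha : R) (g : CN -> \bar R) : \bar R :=
  int_v (fun z => (c_alpha alpha * (1 - sqnorm z) `^ alpha)%:E * g z)%E.

End WeightedMeasure.
Arguments c_alpha {R} N alpha.

(* Conditions on the values at nonnegative reals only; the values of [psi]
   at negative reals play no role. *)
Record orlicz_function {R : realType} (psi : R -> R) : Prop := OrliczFunction {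
  orlicz_ge0 : forall x, 0 <= x -> 0 <= psi x;
  orlicz_strictly_convex : forall x y t, 0 <= x -> 0 <= y -> x != y ->
    0 < t < 1 -> psi (t * x + (1 - t) * y) < t * psi x + (1 - t) * psi y;
  orlicz0 : psi 0 = 0;
  orlicz_continuous0 : psi x @[x --> 0^'+] --> psi 0;
  orlicz_superlinear : psi x / x @[x --> +oo] --> +oo }.

Definition Delta2_condition {R : realType} (psi : R -> R) : Prop :=
  exists x0 C : R, [/\ 0 < x0, 0 < C &
    forall x, x0 <= x -> psi x ^+ 2 <= psi (C * x)].

Section BergmanOrlicz.
Context {R : realType} {N : nat}.
Context (alpha : R) (psi : R -> R).
Local Notation CN := 'rV[R[i]]_N.

Definition orlicz_modular (C : R) (f : CN -> R[i]) : \bar R :=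
  int_v_alpha alpha (fun z => (psi (modulus (f z) / C))%:E).

Definition bergman_orlicz : set (CN -> R[i]) :=
  [set f | holomorphic_on_ball f /\
    exists C : R, 0 < C /\ (orlicz_modular C f < +oo)%E].

Definition luxemburg_norm (f : CN -> R[i]) : R :=
  inf [set C : R | 0 < C /\ (orlicz_modular C f <= 1)%E].

Definition bounded_on_bergman_orlicz
    (T : (CN -> R[i]) -> (CN -> R[i])) : Prop :=
  (forall f, bergman_orlicz f -> bergman_orlicz (T f)) /\
  exists M : R, forall f, bergman_orlicz f ->
    luxemburg_norm (T f) <= M * luxemburg_norm f.

End BergmanOrlicz.

Definition composition_operator {R : realType} {N : nat}
    (phi : 'rV[R[i]]_N -> 'rV[R[i]]_N) (f : 'rV[R[i]]_N -> R[i]) :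
    'rV[R[i]]_N -> R[i] :=
  f \o phi.

Definition holomorphic_self_map {R : realType} {N : nat}
    (phi : 'rV[R[i]]_N -> 'rV[R[i]]_N) : Prop :=
  holomorphic_on_ball phi /\ set_fun unit_ball unit_ball phi.

(* Main.v *)
Require Import Defs.
From HB Require Import structures.
From mathcomp Require Import all_boot all_order all_algebra.
From mathcomp Require Import complex.
From mathcomp Require Import all_classical all_reals all_analysis.
From mathcomp Require Import measurable_realfun.
From mathcomp Require Import ring lra.

(* Both parts rest on Schwarz-Pick at the origin,
   (1 - |z|^2)(1 - |phi(0)|^2) <= 8 (1 - |phi(z)|^2), and on the sub-mean value
   inequality of psi(|f| / C) over balls of radius comparable to the distance
   to the sphere; the mean value property comes from Goursat's theorem on
   squares and is averaged over rotations preserving Lebesgue measure.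

   Part (2). The sub-mean value inequality bounds psi(|f(p)| / C) by
   K (1 - |p|^2)^(-E) when the modular of f at C is at most 1. Iterating the
   Delta^2-condition l times turns this, along phi, into
   psi(|f(phi(z))| / (C0^l C)) <= psi(x0) + K2 (1 - |z|^2)^(-E / 2^l), which is
   v_alpha-integrable once E / 2^l < 1 + alpha.

   Part (1). Apply the sub-mean value inequality at phi(s), integrate in s and
   exchange the integrals: it remains to bound, for each w in the disc, the
   v_alpha-measure of the set of s with phi(s) within (1 - |w|^2)/5 of w by a
   multiple of (1 - |w|^2)^(2 + alpha). On that set the positive harmonic
   function Re ((1 + conj(w) phi)/(1 - conj(w) phi)) is at least
   1/(4 (1 - |w|^2)), the set lies in the shell 1 - |s|^2 <= c (1 - |w|^2) by
   Schwarz-Pick, and the integral of the harmonic function over that shell is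
   its bounded value at 0 times the mass of the shell, which is of order
   (1 - |w|^2)^(1 + alpha). *)

Set Implicit Arguments.
Unset Strict Implicit.
Unset Printing Implicit Defensive.

Import Order.TTheory GRing.Theory Num.Theory.
Import numFieldNormedType.Exports.

Local Open Scope classical_set_scope.
Local Open Scope ring_scope.

(** * Lebesgue measure on R^n *)

Section LebesgueLine.
Context {R : realType}.
Local Notation T := (measurableTypeR R).
Local Notation leb := (@lebesgue_measure R).

(** Circle averages are finite throughout: they run over the 2^j-th roots of unity. Over the ball
    such an average is a mean of finitely many rotations, each preserving Lebesgue measure, so it is
    integrated without polar coordinates, and the limit in j is taken last, by Fatou's lemma.
    Goursat's theorem is set up for the same sums, on the unit square mapped to an annulus by the
    exponential; there bisection is an exact identity between Riemann sums.

    The dimension enters part (1) through an exponent. With d = 1 - |w|^2, a ball of radius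
    comparable to d has v_alpha-mass of order d^(2 N + alpha), whereas the harmonic function gains
    one factor d on a shell of mass d^(1 + alpha). The exponents 2 N + alpha and 2 + alpha agree for
    N = 1 only; for N > 1 the Delta^2-condition absorbs whatever power of d is lost.

    Norms are never estimated directly: since psi(x / A) <= psi(x) / A for A >= 1, a constant A in
    front of a modular becomes a factor A on the Luxemburg norm. *)

Lemma lebesgue_translation (c : R) (A : set T) : measurable A ->
  leb ((fun x => x + c) @^-1` A) = leb A.
Proof.
move=> mA.
have mf : measurable_fun setT (fun x : T => x + c : T) by exact: measurable_funD.
pose mu' := pushforward leb (fun x : T => x + c : T).
apply/esym; rewrite -[RHS]/(mu' A); apply: lebesgue_measure_unique => //= _ [[a b]] _ <-.
rewrite /mu' /pushforward.
have -> : (fun x : T => x + c : T) @^-1` `]a, b]%classic = `](a - c), (b - c)]%classic.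
  by apply/seteqP; split => x /=; rewrite !in_itv/= ltrBlDr lerBrDr.
rewrite /= !lebesgue_measure_itv/= !lte_fin ltrD2r.
by case: ifPn => // _; rewrite -!EFinB; congr EFin; ring.
Qed.

Lemma lebesgue_scaling (k : R) (A : set T) : 0 < k -> measurable A ->
  leb ((fun x => k * x) @^-1` A) = (k^-1%:E * leb A)%E.
Proof.
move=> k0 mA.
have mf : measurable_fun setT (fun x : T => k * x : T) by exact: measurable_funM.
pose mu' := pushforward leb (fun x : T => k * x : T).
pose mu'' := mscale (NngNum (ltW k0)) mu'.
have -> : leb A = mu'' mf A.
  apply: lebesgue_measure_unique => //= _ [[a b]] _ <-.
  rewrite /mu'' /mscale/= /mu' /pushforward.
  have -> : (fun x : T => k * x : T) @^-1` `]a, b]%classic = `](a / k), (b / k)]%classic.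
    apply/seteqP; split => x /=; rewrite !in_itv/= ltr_pdivrMr// ler_pdivlMr//.
    - by rewrite mulrC.
    - by rewrite mulrC.
  rewrite /= !lebesgue_measure_itv/= !lte_fin ltr_pM2r ?invr_gt0//.
  case: ifPn => // _; last by rewrite mule0.
  by rewrite -!EFinB -EFinM; congr EFin; field; rewrite gt_eqF.
by rewrite /mu'' /mscale/= muleA -EFinM mulVf ?gt_eqF// mul1e.
Qed.

End LebesgueLine.

(** * Slicing of Lebesgue measure, and its invariance under shears, rotations and translations *)

Section LebesgueRn.
Context {R : realType}.
Local Notation T := (measurableTypeR R).
Local Notation leb := (@lebesgue_measure R).
Implicit Type n : nat.

Lemma lebesgue_RnS n (A : set (n.+1.-tuple T)) :
  lebesgue_Rn R n.+1 A = (lebesgue_Rn R n \x leb)%E (@tcons _ _ n @^-1` A).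
Proof. by []. Qed.

Lemma measurable_tcons_preimage n (A : set (n.+1.-tuple T)) :
  measurable A -> measurable (@tcons _ T n @^-1` A).
Proof. by move=> mA; rewrite -[X in measurable X]setTI; exact: measurable_tcons. Qed.

Lemma tnth_tcons0 n (s : n.-tuple T) (x : T) : tnth (tcons (s, x)) ord0 = x.
Proof. by []. Qed.

Lemma tnth_tconsS n (s : n.-tuple T) (x : T) (i : 'I_n) :
  tnth (tcons (s, x)) (lift ord0 i) = tnth s i.
Proof. by rewrite /tcons/= tnthS. Qed.

Definition cube n (r : R) : set (n.-tuple T) :=
  [set t | forall i, `|tnth t i| < r].

Lemma measurable_cube n (r : R) : measurable (@cube n r).
Proof.
have -> : @cube n r = \bigcap_(i in [set: 'I_n]) ((@tnth n T ^~ i) @^-1` `](- r), r[%classic).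
  apply/seteqP; split => t /= h i; last by have := h i Logic.I; rewrite /= in_itv/= ltr_norml.
  by move=> _; have := h i; rewrite ltr_norml /= in_itv/=.
apply: fin_bigcap_measurable => // i _.
by rewrite -[X in measurable X]setTI; exact: measurable_tnth.
Qed.

Lemma lebesgue_cube n (r : R) : 0 <= r -> lebesgue_Rn R n (@cube n r) = ((2 * r) ^+ n)%:E.
Proof.
move=> r0; elim: n => [|n IH].
  rewrite /lebesgue_Rn /= diracE mem_set// /cube/=; by case.
rewrite lebesgue_RnS.
have -> : @tcons _ T n @^-1` @cube n.+1 r = @cube n r `*` `](- r), r[%classic.
  apply/seteqP; split => -[s x] /=.
    move=> h; split => /= [i|]; first by have := h (lift ord0 i); rewrite tnth_tconsS.
    by have := h ord0; rewrite tnth_tcons0 in_itv/= ltr_norml.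
  rewrite in_itv/= -ltr_norml => -[/= h1 h2] i.
  by case: (unliftP ord0 i) => [j ->|->]; rewrite ?tnth_tconsS ?tnth_tcons0.
rewrite product_measure1E//; last exact: measurable_cube.
rewrite [X in (X * _)%E]IH [X in (_ * X)%E]lebesgue_measure_itv/= lte_fin.
case: ltP => [_|h].
  by rewrite -EFinB -EFinM; congr EFin; rewrite exprS; ring.
have -> : r = 0 by apply/eqP; rewrite eq_le r0 andbT; lra.
by rewrite mule0 mulr0 expr0n.
Qed.

Lemma lebesgue_Rn_sigma_finite n : sigma_finite setT (lebesgue_Rn R n).
Proof.
exists (fun k => @cube n k%:R) => [|k].
  apply/esym/seteqP; split => // t _.
  pose M := \sum_i `|tnth t i|.
  have [k Mk] : exists k, M < k%:R by exists (Num.trunc M).+1; exact: truncnS_gt.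
  exists k => // i; apply: le_lt_trans Mk.
  by rewrite /M (bigD1 i)//= lerDl sumr_ge0.
split; first exact: measurable_cube.
by rewrite lebesgue_cube// ltry.
Qed.

(** A constant that can carry the sigma-finite structure, which Tonelli's theorem and the uniqueness
    of product measures require. *)
Definition lebesgue_Rn_fun n : set (n.-tuple T) -> \bar R := lebesgue_Rn R n.
HB.instance Definition _ n := Measure.copy (@lebesgue_Rn_fun n) (lebesgue_Rn R n).
HB.instance Definition _ n :=
  Measure_isSigmaFinite.Build _ _ _ (@lebesgue_Rn_fun n) (lebesgue_Rn_sigma_finite n).
Definition lebesgue_Rn_sf n : {sigma_finite_measure set (n.-tuple T) -> \bar R} :=
  @lebesgue_Rn_fun n.

(** Slices the other way round: the defining product measures lines in the direction of the new
    coordinate, this one fixes that coordinate and measures the rest, as the induction on shears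
    demands. *)
Lemma lebesgue_RnS2 n (A : set (n.+1.-tuple T)) : measurable A ->
  lebesgue_Rn R n.+1 A = (lebesgue_Rn R n \x^ leb)%E (@tcons _ _ n @^-1` A).
Proof.
move=> mA; rewrite lebesgue_RnS.
apply: (@product_measure_unique _ _ _ _ _ (lebesgue_Rn_sf n) leb
  (product_measure2 (lebesgue_Rn_sf n) leb)).
  by move=> B C mB mC; rewrite /= product_measure2E.
exact: measurable_tcons_preimage.
Qed.

Definition lpres n (F : n.-tuple T -> n.-tuple T) : Prop :=
  measurable_fun setT F /\ forall A, measurable A ->
    lebesgue_Rn R n (F @^-1` A) = lebesgue_Rn R n A.

Lemma lpres_comp n (F G : n.-tuple T -> n.-tuple T) :
  lpres F -> lpres G -> lpres (F \o G).
Proof.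
move=> [mF eF] [mG eG]; split; first exact: measurableT_comp.
move=> A mA; rewrite comp_preimage eG ?eF//.
by rewrite -[X in measurable X]setTI; exact: mF.
Qed.

Lemma lpres_integral n (F : n.-tuple T -> n.-tuple T) D (f : n.-tuple T -> \bar R) :
  lpres F -> measurable D -> measurable_fun D f -> (forall t, D t -> (0 <= f t)%E) ->
  (\int[lebesgue_Rn R n]_(t in F @^-1` D) f (F t) =
   \int[lebesgue_Rn R n]_(t in D) f t)%E.
Proof.
move=> [mF eF] mD mf f0.
rewrite -[LHS](@ge0_integral_pushforward _ _ _ _ _ _ mF (lebesgue_Rn R n) D f)//.
  by apply: eq_measure_integral => A mA _; exact: eF.
by move=> t; rewrite inE; exact: f0.
Qed.

Definition upd n (t : n.-tuple T) (i : 'I_n) (a : T) : n.-tuple T :=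
  [tuple if j == i then a else tnth t j | j < n].

Lemma measurable_upd n (i : 'I_n) (c : n.-tuple T -> T) : measurable_fun setT c ->
  measurable_fun setT (fun t => upd t i (c t)).
Proof.
move=> mc; apply/measurable_fun_tnthP => j.
have [ji|ji] := eqVneq j i.
  rewrite (_ : _ \o _ = c)//; apply/funext => t /=.
  by rewrite tnth_mktuple ji eqxx.
rewrite (_ : _ \o _ = @tnth n T ^~ j); first exact: measurable_tnth.
by apply/funext => t /=; rewrite tnth_mktuple (negbTE ji).
Qed.

(** On each line in direction i the function [c] is constant, so the map is a translation there, and
    Tonelli assembles the lines. The induction splits off coordinate 0: if i is another coordinate
    the slices are shears of lower dimension, and if i = 0 translation invariance on the line
    applies. *)
Lemma lpres_shear n (i : 'I_n) (c : n.-tuple T -> R) :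
  measurable_fun setT (c : _ -> T) -> (forall t a, c (upd t i a) = c t) ->
  lpres (fun t => upd t i (tnth t i + c t)).
Proof.
move=> mc ci; split.
  by apply: measurable_upd; apply: measurable_funD => //; exact: measurable_tnth.
elim: n i c mc ci => [[]//|n IH] i c mc ci A mA.
have mB := measurable_tcons_preimage mA.
have mtc : measurable_fun setT (@tcons _ T n) by exact: measurable_tcons.
have mupd : measurable_fun setT (fun t => upd t i (tnth t i + c t)).
  by apply: measurable_upd; apply: measurable_funD => //; exact: measurable_tnth.
have mA' : measurable ((fun t => upd t i (tnth t i + c t)) @^-1` A).
  by rewrite -[X in measurable X]setTI; exact: mupd.
case: (unliftP ord0 i) => [j ij|i0].
  rewrite !lebesgue_RnS2//; apply: eq_integral => x _ /=.
  pose cx (s : n.-tuple T) := c (tcons (s, x)).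
  have updE s a : upd (tcons (s, x)) i a = tcons (upd s j a, x).
    apply: eq_from_tnth => k; rewrite tnth_mktuple ij.
    case: (unliftP ord0 k) => [l ->|->].
      by rewrite (inj_eq lift_inj) !tnth_tconsS tnth_mktuple.
    by rewrite !tnth_tcons0.
  rewrite -[RHS](IH j cx).
  - congr (lebesgue_Rn R n _); rewrite !ysectionE; apply/funext => s /=.
    by rewrite updE /cx [in tnth (tcons _) i]ij tnth_tconsS.
  - apply: measurableT_comp => //; apply: measurableT_comp => //.
  - by move=> s a; rewrite /cx -updE ci.
  - exact: measurable_ysection.
rewrite !lebesgue_RnS; apply: eq_integral => s _ /=.
have updE x a : upd (tcons (s, x)) i a = tcons (s, a).
  apply: eq_from_tnth => k; rewrite tnth_mktuple i0.
  case: (unliftP ord0 k) => [l ->|->]; last by rewrite eqxx !tnth_tcons0.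
  by rewrite !tnth_tconsS.
rewrite -[RHS](@lebesgue_translation _ (c (tcons (s, 0)))); last exact: measurable_xsection.
congr (leb _); rewrite !xsectionE; apply/funext => x /=.
have -> : c (tcons (s, x)) = c (tcons (s, 0)) by rewrite -(ci _ 0) updE.
by rewrite updE {1}i0 tnth_tcons0.
Qed.

Definition tscale n (k : R) (t : n.-tuple T) : n.-tuple T :=
  [tuple k * tnth t i | i < n].

Lemma measurable_tscale n (k : R) : measurable_fun setT (@tscale n k).
Proof.
apply/measurable_fun_tnthP => j.
rewrite (_ : _ \o _ = fun t => k * tnth t j : T).
  by apply: measurable_funM => //; exact: measurable_tnth.
by apply/funext => t /=; rewrite tnth_mktuple.
Qed.

Lemma lebesgue_Rn_scaling n (k : R) (A : set (n.-tuple T)) : 0 < k ->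
  measurable A -> lebesgue_Rn R n (tscale k @^-1` A) =
  ((k ^- n)%:E * lebesgue_Rn R n A)%E.
Proof.
move=> k0; have kn0 := ltW k0; elim: n A => [|n IH] A mA.
  rewrite expr0 invr1 mul1e; congr (lebesgue_Rn R 0 _).
  by apply/funext => t /=; rewrite (tuple0 (tscale _ _)) (tuple0 t).
rewrite !lebesgue_RnS.
have mB := measurable_tcons_preimage mA.
have tE s x : tscale k (tcons (s, x)) = tcons (tscale k s, k * x).
  apply: eq_from_tnth => l; rewrite tnth_mktuple.
  case: (unliftP ord0 l) => [m ->|->]; last by rewrite !tnth_tcons0.
  by rewrite !tnth_tconsS tnth_mktuple.
pose h s := leb (xsection (@tcons _ T n @^-1` A) s).
have mh : measurable_fun setT h by exact: measurable_fun_xsection.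
transitivity (\int[lebesgue_Rn R n]_s (k^-1%:E * h (tscale k s)))%E.
  apply: eq_integral => s _ /=.
  rewrite -lebesgue_scaling//; last exact: measurable_xsection.
  by congr (leb _); rewrite !xsectionE; apply/funext => x /=; rewrite tE.
have mhk : measurable_fun setT (h \o @tscale n k).
  by apply: measurableT_comp => //; exact: measurable_tscale.
rewrite ge0_integralZl//; last by rewrite lee_fin invr_ge0.
rewrite -[X in (_ * X)%E](@ge0_integral_pushforward _ _ _ _ _ _ (@measurable_tscale n k) (lebesgue_Rn R n) setT h)//.
have kn : 0 <= k ^- n by rewrite invr_ge0 exprn_ge0.
rewrite (@eq_measure_integral _ _ _ _ (mscale (NngNum kn) (lebesgue_Rn R n))).
  by rewrite ge0_integral_mscale//= muleA -EFinM exprS invfM.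
  exact: measurable_tscale.
by move=> ? B mB' _; exact: (IH B mB').
Qed.


Definition rot2 n (c s : R) (i j : 'I_n) (t : n.-tuple T) : n.-tuple T :=
  upd (upd t i (c * tnth t i - s * tnth t j)) j (s * tnth t i + c * tnth t j).

Lemma tnth_rot2 n (c s : R) (i j k : 'I_n) (t : n.-tuple T) :
  tnth (rot2 c s i j t) k = if k == j then s * tnth t i + c * tnth t j
    else if k == i then c * tnth t i - s * tnth t j else tnth t k.
Proof. by rewrite !tnth_mktuple. Qed.

Lemma lpres_lin_shear n (i j : 'I_n) (a : R) : i != j ->
  lpres (fun t : n.-tuple T => upd t i (tnth t i + a * tnth t j)).
Proof.
move=> ij; apply: lpres_shear; first by apply: measurable_funM => //; exact: measurable_tnth.
by move=> t b; rewrite tnth_mktuple eq_sym (negbTE ij).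
Qed.

(* A rotation by an angle other than pi is a product of three shears. *)
Lemma lpres_rot2 n (c s : R) (i j : 'I_n) : i != j -> c ^+ 2 + s ^+ 2 = 1 ->
  c != - 1 -> lpres (rot2 c s i j).
Proof.
move=> ij cs c1; have c10 : 1 + c != 0 by rewrite addrC addr_eq0.
have ji : j != i by rewrite eq_sym.
(* The tangent of half the angle: the outer shears have coefficient - tan(theta / 2), the middle one
   sin(theta). *)
pose tau := s / (1 + c).
have := lpres_comp (lpres_lin_shear (- tau) ij)
  (lpres_comp (lpres_lin_shear s ji) (lpres_lin_shear (- tau) ij)).
set F := _ \o _; suff -> : F = rot2 c s i j by [].
have s2 : s ^+ 2 = (1 - c) * (1 + c) by rewrite -[s ^+ 2](addKr (c ^+ 2)) cs; ring.
have st : s * tau = 1 - c by rewrite /tau mulrA -expr2 s2 mulfK.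
have tc : tau * (1 + c) = s by rewrite /tau mulfVK.
apply/funext => t; apply: eq_from_tnth => k.
rewrite tnth_rot2 /F /= !tnth_mktuple !eqxx (negbTE ij) (negbTE ji).
have [->|ki] := eqVneq k i.
  rewrite (negbTE ij).
  rewrite -[in RHS]tc (_ : c = 1 - s * tau); last by rewrite st; ring.
  ring.
case: eqVneq => // _.
by rewrite (_ : c = 1 - s * tau); [ring|rewrite st; ring].
Qed.

(** Multiplication by c + i s of those complex coordinates that satisfy [P]. The predicate lets an
    induction rotate one coordinate at a time; only [predT] is used afterwards. *)
Definition rot N (P : pred 'I_N) (c s : R) (t : (N + N).-tuple T) : (N + N).-tuple T :=
  [tuple match fintype.split k with
         | inl j => if P j then c * tnth t (lshift N j) - s * tnth t (rshift N j)
                    else tnth t (lshift N j)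
         | inr j => if P j then s * tnth t (lshift N j) + c * tnth t (rshift N j)
                    else tnth t (rshift N j)
         end | k < N + N].

Lemma tnth_rotl N (P : pred 'I_N) c s t j : tnth (rot P c s t) (lshift N j) =
  if P j then c * tnth t (lshift N j) - s * tnth t (rshift N j) else tnth t (lshift N j).
Proof. by rewrite tnth_mktuple -[lshift N j]/(unsplit (inl j)) unsplitK. Qed.

Lemma tnth_rotr N (P : pred 'I_N) c s t j : tnth (rot P c s t) (rshift N j) =
  if P j then s * tnth t (lshift N j) + c * tnth t (rshift N j) else tnth t (rshift N j).
Proof. by rewrite tnth_mktuple -[rshift N j]/(unsplit (inr j)) unsplitK. Qed.

Lemma eq_tuple_lr N (t u : (N + N).-tuple T) :
  (forall j, tnth t (lshift N j) = tnth u (lshift N j)) ->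
  (forall j, tnth t (rshift N j) = tnth u (rshift N j)) -> t = u.
Proof.
move=> hl hr; apply: eq_from_tnth => k; rewrite -(splitK k).
by case: (fintype.split k) => j /=.
Qed.

Lemma lpres_rot N (c s : R) : c ^+ 2 + s ^+ 2 = 1 -> lpres (@rot N predT c s).
Proof.
have gen c' s' : c' ^+ 2 + s' ^+ 2 = 1 -> c' != -1 -> lpres (@rot N predT c' s').
  move=> cs c1.
  suff h (l : seq 'I_N) : uniq l -> lpres (@rot N (mem l) c' s').
    have := h _ (enum_uniq 'I_N); congr (lpres _); apply/funext => t.
    by apply: eq_tuple_lr => j; rewrite ?tnth_rotl ?tnth_rotr /= mem_enum.
  elim: l => [_|j l IH /= /andP[jl ul]].
    rewrite (_ : @rot N _ c' s' = id); first by split => // A _.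
    by apply/funext => t; apply: eq_tuple_lr => j; rewrite ?tnth_rotl ?tnth_rotr.
  have ne : lshift N j != rshift N j by rewrite eq_lrshift.
  have := lpres_comp (lpres_rot2 ne cs c1) (IH ul).
  congr (lpres _); apply/funext => t; apply: eq_tuple_lr => k /=.
    rewrite tnth_rot2 eq_lrshift (inj_eq (@lshift_inj _ _)).
    rewrite !tnth_rotl !tnth_rotr /= inE.
    by have [->|kj] := eqVneq k j => /=; rewrite ?(negbTE jl).
  rewrite tnth_rot2 (inj_eq (@rshift_inj _ _)) eq_rlshift.
  by rewrite !tnth_rotl !tnth_rotr /= inE; have [->|kj] := eqVneq k j => /=; rewrite ?(negbTE jl).
move=> cs; have [c1|] := eqVneq c (-1); last exact: gen.
have s0 : s = 0 by move: cs; rewrite c1 sqrrN expr1n -[RHS]addr0 => /addrI/eqP; rewrite sqrf_eq0 => /eqP.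
(* The excluded angle pi is reached by two quarter turns. *)
have h : lpres (@rot N predT 0 1) by apply: gen; [rewrite expr0n add0r expr1n|rewrite eq_sym oppr_eq0 oner_eq0].
have := lpres_comp h h; congr (lpres _); apply/funext => t.
by apply: eq_tuple_lr => j /=; rewrite ?(tnth_rotl, tnth_rotr) /= ?(tnth_rotl, tnth_rotr) /= c1 s0; ring.
Qed.

Definition tadd n (t u : n.-tuple T) : n.-tuple T := [tuple tnth t i + tnth u i | i < n].

Lemma lpres_translation n (u : n.-tuple T) : lpres (tadd u).
Proof.
pose tr (l : seq 'I_n) (t : n.-tuple T) : n.-tuple T :=
  [tuple if i \in l then tnth u i + tnth t i else tnth t i | i < n].
suff h (l : seq 'I_n) : uniq l -> lpres (tr l).
  have := h _ (enum_uniq 'I_n); congr (lpres _); apply/funext => t.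
  by apply: eq_from_tnth => i; rewrite !tnth_mktuple mem_enum.
elim: l => [_|j l IH /= /andP[jl ul]].
  rewrite (_ : tr _ = id); first by split => // A _.
  by apply/funext => t; apply: eq_from_tnth => i; rewrite !tnth_mktuple.
have sh : lpres (fun t : n.-tuple T => upd t j (tnth t j + tnth u j)).
  by apply: (@lpres_shear n j (fun=> tnth u j)).
have := lpres_comp sh (IH ul); congr (lpres _); apply/funext => t.
apply: eq_from_tnth => i; rewrite /= !tnth_mktuple inE.
by have [->|ij] := eqVneq i j => //=; rewrite (negbTE jl) addrC.
Qed.

End LebesgueRn.

(** * Goursat's theorem *)

Section Modulus.
Local Open Scope complex_scope.
Context {R : realType}.
Implicit Types x y : R[i].

Lemma modulus_ge0 x : 0 <= modulus x.
Proof. by case: x => a b; rewrite /modulus /= sqrtr_ge0. Qed.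

Lemma modulusM x y : modulus (x * y) = modulus x * modulus y.
Proof. exact: ComplexField.Normc.normcM. Qed.

Lemma modulusV x : modulus x^-1 = (modulus x)^-1.
Proof. exact: ComplexField.Normc.normcV. Qed.

Lemma modulusD x y : modulus (x + y) <= modulus x + modulus y.
Proof. exact: le_normcD. Qed.

Lemma modulusN x : modulus (- x) = modulus x.
Proof. exact: normcN. Qed.

Lemma modulusBC x y : modulus (x - y) = modulus (y - x).
Proof. by rewrite -modulusN opprB. Qed.

Lemma modulusB x y : modulus (x - y) <= modulus x + modulus y.
Proof. by rewrite -(modulusN y) modulusD. Qed.

Lemma modulus0 : modulus (0 : R[i]) = 0.
Proof. exact: ComplexField.Normc.normc0. Qed.

Lemma modulus1 : modulus (1 : R[i]) = 1.
Proof. exact: ComplexField.Normc.normc1. Qed.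

Lemma modulus_eq0 x : (modulus x == 0) = (x == 0).
Proof.
apply/eqP/eqP => [/ComplexField.Normc.eq0_normc//|->]; exact: modulus0.
Qed.

Lemma modulus_gt0 x : (0 < modulus x) = (x != 0).
Proof. by rewrite lt_neqAle modulus_ge0 andbT eq_sym modulus_eq0. Qed.

Lemma modulus_normE x : `|x| = (modulus x)%:C.
Proof. by case: x. Qed.

Lemma modulus_sqr x : modulus x ^+ 2 = complex.Re x ^+ 2 + complex.Im x ^+ 2.
Proof.
by case: x => a b; rewrite /modulus /= sqr_sqrtr// addr_ge0// sqr_ge0.
Qed.

Lemma modulusR (a : R) : modulus a%:C = `|a|.
Proof. by rewrite /modulus /= expr0n addr0 sqrtr_sqr. Qed.

Lemma modulus_conj x : modulus (conjc x) = modulus x.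
Proof. by case: x => a b; rewrite /modulus /= sqrrN. Qed.

Lemma modulusX x n : modulus (x ^+ n) = modulus x ^+ n.
Proof.
by elim: n => [|n IH]; rewrite ?expr0 ?modulus1// !exprS modulusM IH.
Qed.

Lemma le_Re_modulus x : `|complex.Re x| <= modulus x.
Proof.
rewrite -(@ler_pXn2r _ 2) ?nnegrE ?modulus_ge0//.
by rewrite modulus_sqr -normrX ger0_norm ?sqr_ge0// lerDl sqr_ge0.
Qed.

Lemma le_Im_modulus x : `|complex.Im x| <= modulus x.
Proof.
rewrite -(@ler_pXn2r _ 2) ?nnegrE ?modulus_ge0//.
by rewrite modulus_sqr -normrX ger0_norm ?sqr_ge0// lerDr sqr_ge0.
Qed.

Lemma modulus_le_ReIm x : modulus x <= `|complex.Re x| + `|complex.Im x|.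
Proof.
rewrite -(@ler_pXn2r _ 2) ?nnegrE ?modulus_ge0 ?addr_ge0//.
rewrite modulus_sqr sqrrD !real_normK ?num_real//.
by rewrite lerD2r lerDl mulrn_wge0// mulr_ge0.
Qed.

Lemma modulus_sum I (r : seq I) (P : pred I) (F : I -> R[i]) :
  modulus (\sum_(i <- r | P i) F i) <= \sum_(i <- r | P i) modulus (F i).
Proof.
elim/big_ind2 : _ => [|x a y b xa yb|//]; first by rewrite modulus0.
by rewrite (le_trans (modulusD _ _))// lerD.
Qed.

End Modulus.

(** * Boundary Riemann sums over squares and their bisection *)

Section Goursat.
Local Open Scope complex_scope.
Context {R : realType}.
Variables (A B : R[i]) (G : R -> R -> R[i]).

(* Left Riemann sum, on [2 ^ n] nodes per side, of the boundary integral of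
   G(zeta) d zeta over the square of side [l] at (x, y), where
   zeta = A x + B y. *)
Definition cell_sum (n : nat) (x y l : R) : R[i] :=
  (l / 2 ^+ n)%:C * \sum_(p < 2 ^ n)
    (A * (G (x + l * p%:R / 2 ^+ n) y - G (x + l * p%:R / 2 ^+ n) (y + l)) +
     B * (G (x + l) (y + l * p%:R / 2 ^+ n) - G x (y + l * p%:R / 2 ^+ n))).

(** The left nodes of a side with 2^(n+1) nodes are exactly those of its two halves with 2^n nodes
    each, and the inner sides cancel. No discretisation error arises. *)
Lemma cell_sum_split n (x y l : R) :
  cell_sum n.+1 x y l =
  cell_sum n x y (l / 2) + cell_sum n (x + l / 2) y (l / 2) +
  cell_sum n x (y + l / 2) (l / 2) +
  cell_sum n (x + l / 2) (y + l / 2) (l / 2).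
Proof.
rewrite /cell_sum -!mulrDr.
have -> : l / 2 / 2 ^+ n = l / 2 ^+ n.+1.
  by rewrite exprS invfM mulrA.
congr (_ * _).
rewrite -!big_split/= expnS mul2n -addnn big_split_ord /= -big_split/=.
apply: eq_bigr => p _.
have n0 : (2 : R) ^+ n != 0 by rewrite expf_neq0.
have E1 z : z + l * p%:R / 2 ^+ n.+1 = z + l / 2 * p%:R / 2 ^+ n.
  by rewrite exprS; field.
have E2 z : z + l * (2 ^ n + p)%:R / 2 ^+ n.+1 =
    z + l / 2 + l / 2 * p%:R / 2 ^+ n.
  by rewrite natrD natrX exprS; field.
have E3 z : z + l / 2 + l / 2 = z + l by field.
rewrite !E1 !E2 !E3; ring.
Qed.

(** The sum of an affine function of zeta vanishes exactly: the constant cancels between opposite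
    sides, and the linear part contributes - A b B l + B b A l at each node. Only the remainder, of
    size e, is left. *)
Lemma cell_sum_affine n (x y l : R) (a b : R[i]) (e : R) : 0 <= l ->
  (forall x' y' : R, x <= x' <= x + l -> y <= y' <= y + l ->
    modulus (G x' y' - (a + b * (A * x'%:C + B * y'%:C))) <= e) ->
  modulus (cell_sum n x y l) <= l * (2 * (modulus A + modulus B) * e).
Proof.
move=> l0 He.
have n0 : (0 : R) < 2 ^+ n by rewrite exprn_gt0.
rewrite /cell_sum modulusM modulusR ger0_norm ?divr_ge0 ?(ltW n0)//.
have xe : x <= x <= x + l by rewrite lexx lerDl.
have xl : x <= x + l <= x + l by rewrite lexx lerDl l0.
have ye : y <= y <= y + l by rewrite lexx lerDl.
have yl : y <= y + l <= y + l by rewrite lexx lerDl l0.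
rewrite -mulrA ler_wpM2l// ler_pdivrMl//.
apply: le_trans (modulus_sum _ _ _) _.
rewrite (_ : 2 ^+ n * _ =
  \sum_(p < 2 ^ n) (2 * (modulus A + modulus B) * e)); last first.
  by rewrite sumr_const card_ord -[RHS]mulr_natl natrX.
apply: ler_sum => p _.
have pb z : z <= z + l * p%:R / 2 ^+ n <= z + l.
  rewrite lerDl divr_ge0 ?mulr_ge0 ?(ltW n0)//=.
  rewrite lerD2l -mulrA ler_piMr// ler_pdivrMr// mul1r -natrX ler_nat.
  by rewrite ltnW.
set u := x + _; set v := y + l * _ / _.
pose r x' y' := G x' y' - (a + b * (A * x'%:C + B * y'%:C)).
have rE x' y' : G x' y' = r x' y' + (a + b * (A * x'%:C + B * y'%:C)).
  by rewrite /r subrK.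
have -> : A * (G u y - G u (y + l)) + B * (G (x + l) v - G x v) =
    A * (r u y - r u (y + l)) + B * (r (x + l) v - r x v).
  rewrite !rE !rmorphD; ring.
apply: le_trans (modulusD _ _) _; rewrite !modulusM.
have r2 x1 y1 x2 y2 : modulus (r x1 y1) <= e -> modulus (r x2 y2) <= e ->
    modulus (r x1 y1 - r x2 y2) <= 2 * e.
  by move=> h1 h2; rewrite (le_trans (modulusB _ _))// mulr_natl mulr2n lerD.
have -> : 2 * (modulus A + modulus B) * e =
  modulus A * (2 * e) + modulus B * (2 * e) by ring.
by apply: lerD; rewrite ler_wpM2l ?modulus_ge0//; apply: r2; apply: He;
  rewrite ?pb.
Qed.

(** Complex differentiability with respect to zeta = A x + B y, without continuity of the
    derivative. *)
Hypothesis dG : forall x y : R, 0 <= x <= 1 -> 0 <= y <= 1 ->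
  exists c : R[i], forall e : R, 0 < e -> exists2 d : R, 0 < d &
    forall u v : R, `|u| < d -> `|v| < d ->
    modulus (G (x + u) (y + v) - G x y - c * (A * u%:C + B * v%:C))
      <= e * (`|u| + `|v|).

(** If the sum over the unit square is not eventually at most c, then repeated bisection yields
    nested squares whose sums are not eventually at most c times the area. At their common point the
    affine approximation makes the sum small relative to the area, a contradiction. *)
Lemma goursat (c : R) : 0 < c ->
  \forall n \near \oo, modulus (cell_sum n 0 0 1) <= c.
Proof.
move=> c0; apply: contrapT => bad0.
pose side m : R := 2 ^- m.
have side_gt0 m : 0 < side m by rewrite /side invr_gt0 exprn_gt0.
have sideS m : side m.+1 = side m / 2.
  by rewrite /side exprS invfM mulrC.
(* Badness negates an eventual bound: if all four quarters are eventually good, the whole square is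
   good beyond the largest of the four thresholds. *)
pose bad m (q : R * R) := ~ \forall n \near \oo,
  modulus (cell_sum n q.1 q.2 (side m)) <= c * side m ^+ 2.
have step m q : bad m q -> exists q' : R * R, [/\ bad m.+1 q',
    q.1 <= q'.1 <= q.1 + side m.+1 & q.2 <= q'.2 <= q.2 + side m.+1].
  move=> bq; apply: contrapT => nq; apply: bq.
  have good q' : q.1 <= q'.1 <= q.1 + side m.+1 ->
      q.2 <= q'.2 <= q.2 + side m.+1 -> \forall n \near \oo,
      modulus (cell_sum n q'.1 q'.2 (side m.+1)) <= c * side m.+1 ^+ 2.
    by move=> h1 h2; apply: contrapT => h; apply: nq; exists q'.
  have in1 z : z <= z <= z + side m.+1 by rewrite lexx lerDl ltW.
  have in2 z : z <= z + side m.+1 <= z + side m.+1.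
    by rewrite lexx lerDl ltW.
  have [] := good (q.1, q.2) (in1 _) (in1 _) => N1 _ g1.
  have [] := good (q.1 + side m.+1, q.2) (in2 _) (in1 _) => N2 _ g2.
  have [] := good (q.1, q.2 + side m.+1) (in1 _) (in2 _) => N3 _ g3.
  have [] := good (q.1 + side m.+1, q.2 + side m.+1) (in2 _) (in2 _) => N4 _ g4.
  (* [cell_sum_split] lowers n by one, hence the successor. *)
  exists (maxn (maxn N1 N2) (maxn N3 N4)).+1 => // -[//|n] /=.
  rewrite ltnS !geq_max => /andP[/andP[n1 n2] /andP[n3 n4]].
  rewrite cell_sum_split -sideS.
  have := g1 _ n1; have := g2 _ n2; have := g3 _ n3; have := g4 _ n4.
  rewrite /= => h4 h3 h2 h1.
  have -> : c * side m ^+ 2 = c * side m.+1 ^+ 2 + c * side m.+1 ^+ 2 +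
      c * side m.+1 ^+ 2 + c * side m.+1 ^+ 2 by rewrite sideS; field.
  by do 3 (apply: le_trans (modulusD _ _) _; apply: lerD => //).
have [f [f0 fS]] : exists f : nat -> R * R, f 0%N = (0, 0) /\
    forall m, [/\ bad m (f m), (f m).1 <= (f m.+1).1 <= (f m).1 + side m.+1 &
      (f m).2 <= (f m.+1).2 <= (f m).2 + side m.+1].
  have /choice [g gP] : forall mq : nat * (R * R), exists q' : R * R,
      bad mq.1 mq.2 -> [/\ bad mq.1.+1 q',
      mq.2.1 <= q'.1 <= mq.2.1 + side mq.1.+1 &
      mq.2.2 <= q'.2 <= mq.2.2 + side mq.1.+1].
    move=> [m q]; have [b|nb] := pselect (bad m q).
      by have [q' hq'] := step _ _ b; exists q'.
    by exists (0, 0) => /= /nb.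
  pose f := fix f m := if m is m'.+1 then g (m', f m') else (0, 0).
  have fb m : bad m (f m).
    elim: m => [|m IH]; last by have [] := gP (m, f m) IH.
    by rewrite /bad /= /side expr0 invr1 expr1n mulr1.
  exists f; split=> // m; split=> //.
    by have [] := gP (m, f m) (fb m).
  by have [] := gP (m, f m) (fb m).
have lim (h : nat -> R) : h 0%N = 0 ->
    (forall m, h m <= h m.+1 <= h m + side m.+1) ->
    exists X : R, 0 <= X <= 1 /\ forall m, h m <= X <= h m + side m.
  move=> h0 hS.
  have up m k : h m <= h (m + k)%N.
    elim: k => [|k IH]; first by rewrite addn0.
    by rewrite addnS (le_trans IH)//; have /andP[] := hS (m + k)%N.
  have dn m k : h (m + k)%N + side (m + k)%N <= h m + side m.
    elim: k => [|k IH]; first by rewrite addn0.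
    apply: le_trans IH; rewrite addnS.
    have /andP[_ ] := hS (m + k)%N; rewrite sideS; lra.
  have cross m k : h m <= h k + side k.
    have [/subnKC <-|/ltnW /subnKC <-] := leqP m k.
      by apply: le_trans (up m (k - m)%N) _; rewrite lerDl ltW.
    by apply: le_trans (dn k (m - k)%N); rewrite lerDl ltW.
  have hs : has_sup (range h).
    by split; [exists (h 0%N), 0%N|exists (h 0%N + side 0%N) => _ [m _ <-]].
  have hX m : h m <= sup (range h) <= h m + side m.
    apply/andP; split; first by apply: ub_le_sup; [case: hs|exists m].
    by apply: ge_sup; [case: hs|move=> _ [k _ <-]].
  exists (sup (range h)); split => //.
  by have := hX 0%N; rewrite h0 add0r /side expr0 invr1.
have [|m|X [X01 hX]] := lim (fun m => (f m).1).
- by rewrite f0.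
- by have [] := fS m.
have [|m|Y [Y01 hY]] := lim (fun m => (f m).2).
- by rewrite f0.
- by have [] := fS m.
have [b hb] := dG X01 Y01.
have K0 : 0 < 4 * (modulus A + modulus B) + 1.
  by rewrite ltr_wpDl// mulr_ge0// addr_ge0// modulus_ge0.
(* In the small square |u| + |v| <= 2 [side m], and [cell_sum_affine] contributes a factor 2 (|A| +
   |B|) [side m]: together 4 (|A| + |B|) times the area. The added 1 keeps the denominator
   positive. *)
have [|d d0 hd] := hb (c / (4 * (modulus A + modulus B) + 1)).
  by rewrite divr_gt0.
have [m sm] : exists m, side m < d.
  have /cvgrPdist_lt /(_ _ d0) [m _ hm] :
    (fun m => (2^-1 : R) ^+ m) @ \oo --> (0 : R).
    by apply: cvg_expr; rewrite ger0_norm ?invf_lt1// ltr1n.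
  exists m; have := hm m (leqnn m); rewrite /= sub0r normrN exprVn ger0_norm//.
have [bm _ _] := fS m; apply: bm; near=> n.
pose a := G X Y - b * (A * X%:C + B * Y%:C).
apply: le_trans (@cell_sum_affine n _ _ (side m) a b
    (c / (4 * (modulus A + modulus B) + 1) * (2 * side m)) (ltW (side_gt0 m)) _) _.
  move=> x' y' hx' hy'.
  have hu : `|x' - X| <= side m.
    have := hX m; rewrite ler_norml; lra.
  have hv : `|y' - Y| <= side m.
    have := hY m; rewrite ler_norml; lra.
  have := hd (x' - X) (y' - Y) (le_lt_trans hu sm) (le_lt_trans hv sm).
  rewrite !(addrC _ (_ - _)) !subrK => h.
  apply: (@le_trans _ _ (c / (4 * (modulus A + modulus B) + 1) *
    (`|x' - X| + `|y' - Y|))).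
    apply: le_trans h; rewrite le_eqVlt; apply/orP; left; apply/eqP.
    by congr modulus; rewrite /a !rmorphB; ring.
  rewrite ler_wpM2l ?divr_ge0 ?(ltW c0) ?(ltW K0)//.
  by rewrite mulr_natl mulr2n lerD.
have s0 := side_gt0 m.
set K := _ + 1 in K0 *.
have -> : side m * (2 * (modulus A + modulus B) * (c / K * (2 * side m))) =
  (4 * (modulus A + modulus B) / K) * (c * side m ^+ 2) by field; rewrite gt_eqF.
rewrite ler_piMl ?mulr_ge0 ?(ltW c0) ?(ltW s0)//.
by rewrite ler_pdivrMr// mul1r lerDl.
Unshelve. all: by end_near. Qed.

End Goursat.

(** * Mean value property *)

Section MeanValue.
Local Open Scope complex_scope.
Context {R : realType}.

(** Complex differentiability in epsilon-delta form with real tolerances, so that every estimate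
    takes place in [R]. *)
Definition cdiff (g : R[i] -> R[i]) (z : R[i]) : Prop :=
  exists c : R[i], forall e : R, 0 < e -> exists2 d : R, 0 < d &
    forall h, modulus h < d ->
    modulus (g (z + h) - g z - c * h) <= e * modulus h.

Lemma cdiff_continuous (g : R[i] -> R[i]) (z : R[i]) : cdiff g z ->
  forall e : R, 0 < e -> exists2 d : R, 0 < d &
  forall h, modulus h < d -> modulus (g (z + h) - g z) <= e.
Proof.
move=> [c hc] e e0; have [d d0 hd] := hc 1 ltr01.
have c0 : 0 < modulus c + 1 by rewrite ltr_wpDl// modulus_ge0.
exists (Num.min d (e / (modulus c + 1))) => [|h].
  by rewrite lt_min d0 divr_gt0.
rewrite lt_min ltr_pdivlMr// => /andP[/hd hd1 he].
rewrite -[g _ - _](subrK (c * h)); apply: le_trans (modulusD _ _) _.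
rewrite modulusM; apply: le_trans (ltW he).
rewrite (_ : _ * (_ + 1) = 1 * modulus h + modulus c * modulus h); last by ring.
by rewrite lerD.
Qed.

Definition cis (t : R) : R[i] := cos t +i* sin t.

Lemma modulus_cis t : modulus (cis t) = 1.
Proof. by rewrite /modulus /cis /= cos2Dsin2 sqrtr1. Qed.

Lemma cisD s t : cis (s + t) = cis s * cis t.
Proof.
by apply/eqP; rewrite eq_complex /= sinD cosD eqxx /= [X in X == _]addrC.
Qed.

Lemma cis0 : cis 0 = 1.
Proof. by rewrite /cis cos0 sin0. Qed.

Lemma is_derive0_bound (f : R -> R) (df : R) : is_derive (0 : R) 1 f df ->
  forall e : R, 0 < e -> exists2 d : R, 0 < d &
  forall h, `|h| < d -> `|f h - f 0 - df * h| <= e * `|h|.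
Proof.
move=> [df1 df2] e e0.
have : (fun h => h^-1 *: ((f \o shift 0) (h *: 1) - f 0)) @ (0 : R)^' --> df.
  by rewrite -df2; exact: df1.
move=> /cvgrPdist_lt /(_ _ e0) [d /= d0 hd]; exists d => // h hh.
have [->|h0] := eqVneq h 0.
  by rewrite mulr0 subrr subr0 normr0 mulr0.
have := hd h; rewrite /= sub0r normrN => /(_ hh h0).
rewrite addr0 scaler1 => {}hd.
rewrite [leLHS](_ : _ = `|df - h^-1 * (f h - f 0)| * `|h|).
  by rewrite ler_wpM2r// ltW.
by rewrite -normrM mulrBl [_^-1 * _]mulrC -mulrA mulVf// mulr1 distrC.
Qed.

(** The complex exponential has derivative 1 at 0; here exp(u + i v) is [expR u] times [cis v], and
    the derivatives of exp, cos and sin at 0 are combined. *)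
Lemma expi_bound (e : R) : 0 < e -> exists2 d : R, 0 < d &
  forall u v : R, `|u| < d -> `|v| < d ->
  modulus ((expR u)%:C * cis v - 1 - (u +i* v)) <= e * (`|u| + `|v|).
Proof.
move=> e0.
(* The errors add up to at most e1 |u| + 6 e1 |v|, whence the 8; the minimum with 1 keeps [expR u]
   below 2. *)
pose e1 := Num.min 1 e / 8.
have e10 : 0 < e1 by rewrite divr_gt0// lt_min ltr01.
have e11 : e1 <= 1 / 8 by rewrite ler_pM2r ?invr_gt0// ge_min lexx.
have e1e : e1 <= e / 8 by rewrite ler_pM2r ?invr_gt0// ge_min lexx orbT.
have [d1 d10 h1] := is_derive0_bound (is_derive_expR 0) e10.
have [d2 d20 h2] := is_derive0_bound (is_derive_cos 0) e10.
have [d3 d30 h3] := is_derive0_bound (is_derive_sin 0) e10.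
rewrite expR0 in h1; rewrite cos0 sin0 oppr0 in h2; rewrite cos0 sin0 in h3.
exists (Num.min (Num.min d1 d2) (Num.min d3 e1)).
  by rewrite !lt_min d10 d20 d30 e10.
move=> u v; rewrite !lt_min => /andP[/andP[/h1 {}h1 _] /andP[_ ue]].
move=> /andP[/andP[_ /h2 {}h2] /andP[/h3 {}h3 _]].
have u0 := normr_ge0 u; have v0 := normr_ge0 v.
have eu : `|expR u - 1| <= 2 * `|u|.
  rewrite -(subrK (1 * u) (expR u - 1)); apply: le_trans (ler_normD _ _) _.
  rewrite mul1r; rewrite mul1r in h1; nra.
have eu2 : expR u <= 2.
  move: eu; rewrite ler_norml => /andP[_]; lra.
have eu0 := expR_gt0 u.
apply: le_trans (modulus_le_ReIm _) _.
rewrite /= !mul0r subr0 addr0 subr0.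
have -> : expR u * cos v - 1 - u =
  (expR u - 1 - 1 * u) + expR u * (cos v - 1 - 0 * v) by ring.
have -> : expR u * sin v - v =
  expR u * (sin v - 0 - 1 * v) + (expR u - 1) * v by ring.
have := ler_normD (expR u - 1 - 1 * u) (expR u * (cos v - 1 - 0 * v)).
have := ler_normD (expR u * (sin v - 0 - 1 * v)) ((expR u - 1) * v).
rewrite !normrM (gtr0_norm eu0).
set X := `|_ - 1 - 1 * u| in h1 *; set Y := `|cos _ - _ - _| in h2 *.
set Z := `|_ - 0 - _| in h3 *.
have Y0 : 0 <= Y by rewrite normr_ge0.
have Z0 : 0 <= Z by rewrite normr_ge0.
have YY : expR u * Y <= 2 * (e1 * `|v|) by apply: ler_pM; rewrite // ltW.
have ZZ : expR u * Z <= 2 * (e1 * `|v|) by apply: ler_pM; rewrite // ltW.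
have WW : `|expR u - 1| * `|v| <= 2 * (e1 * `|v|).
  by rewrite mulrA ler_wpM2r// (le_trans eu)// ler_wpM2l// ltW.
have E1 : e1 * `|u| <= e / 8 * `|u| by rewrite ler_wpM2r.
have E2 : e1 * `|v| <= e / 8 * `|v| by rewrite ler_wpM2r.
have E3 : 0 <= e * `|u| by rewrite mulr_ge0// ltW.
have E4 : 0 <= e * `|v| by rewrite mulr_ge0// ltW.
lra.
Qed.

(** Chain rule for g composed with exp(s + zeta), zeta = - s x + 2 pi i y. This is the hypothesis
    [dG] of [goursat] for A = - s and B = 2 pi i. *)
Lemma cdiff_polar (g : R[i] -> R[i]) (s x y : R) :
  let p x y := (expR (s * (1 - x)))%:C * cis (pi *+ 2 * y) in
  cdiff g (p x y) ->
  exists c : R[i], forall e : R, 0 < e -> exists2 d : R, 0 < d &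
    forall u v : R, `|u| < d -> `|v| < d ->
    modulus (g (p (x + u) (y + v)) - g (p x y) -
      c * ((- s)%:C * u%:C + (0 +i* (pi *+ 2)) * v%:C)) <= e * (`|u| + `|v|).
Proof.
move=> p; set z := p x y => -[c hc]; exists (c * z) => e e0.
have z0 := modulus_ge0 z; have c0 := modulus_ge0 c.
have pi0 : 0 < pi *+ 2 :> R by rewrite pmulrn_rgt0// pi_gt0.
pose K := `|s| + pi *+ 2.
have K0 : 0 < K by rewrite ltr_wpDl.
pose L := modulus c * modulus z + 1.
have L0 : 0 < L by rewrite ltr_wpDl// mulr_ge0.
pose M := modulus z + 1.
have M0 : 0 < M by rewrite ltr_wpDl.
pose e1 := Num.min 1 (e / (2 * K * L)).
have e10 : 0 < e1 by rewrite lt_min ltr01/= !divr_gt0// !mulr_gt0.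
have e11 : e1 <= 1 by rewrite ge_min lexx.
have e1e : e1 * (2 * K * L) <= e.
  by rewrite -ler_pdivlMr ?mulr_gt0// ge_min lexx orbT.
have [d1 d10 h1] := expi_bound e10.
have [|d2 d20 h2] := hc (e / (4 * K * M)); first by rewrite divr_gt0// !mulr_gt0.
exists (Num.min (d1 / K) (d2 / (8 * K * M))).
  by rewrite lt_min !divr_gt0// !mulr_gt0.
move=> u v; rewrite !lt_min => /andP[u1 u2] /andP[v1 v2].
set u' := - s * u; set v' := pi *+ 2 * v.
have nu' : `|u'| <= K * `|u|.
  by rewrite /u' normrM normrN ler_wpM2r// lerDl ltW.
have nv' : `|v'| <= K * `|v|.
  by rewrite /v' normrM gtr0_norm// ler_wpM2r// lerDr.
have [u0 v0] : 0 <= `|u| /\ 0 <= `|v| by [].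
have uv' : `|u'| + `|v'| <= K * (`|u| + `|v|) by rewrite mulrDr lerD.
rewrite ltr_pdivlMr// mulrC in u1; rewrite ltr_pdivlMr// mulrC in v1.
have := h1 u' v' (le_lt_trans nu' u1) (le_lt_trans nv' v1).
set E := _ * cis v' => h1'.
have -> : p (x + u) (y + v) = z + z * (E - 1).
  rewrite mulrBr mulr1 addrCA subrr addr0 /z /p /E.
  rewrite (_ : s * (1 - (x + u)) = s * (1 - x) + u'); last by rewrite /u'; ring.
  rewrite (mulrDr (pi *+ 2)) expRD cisD rmorphM/=; ring.
have -> : (- s)%:C * u%:C + (0 +i* (pi *+ 2)) * v%:C = u' +i* v'.
  by apply/eqP; rewrite eq_complex /= /u' /v'; apply/andP; split; apply/eqP; ring.
have nw : modulus (u' +i* v') <= `|u'| + `|v'| by exact: modulus_le_ReIm.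
have nE : modulus (E - 1) <= 2 * (`|u'| + `|v'|).
  rewrite -(subrK (u' +i* v') (E - 1)); apply: le_trans (modulusD _ _) _.
  have : e1 * (`|u'| + `|v'|) <= 1 * (`|u'| + `|v'|) by rewrite ler_wpM2r// addr_ge0.
  lra.
have nzE : modulus (z * (E - 1)) <= M * (2 * (K * (`|u| + `|v|))).
  rewrite modulusM; apply: ler_pM; rewrite ?modulus_ge0//.
    by rewrite lerDl.
  by apply: le_trans nE _; rewrite ler_wpM2l.
have small : modulus (z * (E - 1)) < d2.
  apply: le_lt_trans nzE _.
  rewrite ltr_pdivlMr ?mulr_gt0// in u2; rewrite ltr_pdivlMr ?mulr_gt0// in v2.
  lra.
have h2' := h2 _ small.
rewrite (_ : _ - _ - _ = (g (z + z * (E - 1)) - g z - c * (z * (E - 1))) +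
    c * z * (E - 1 - (u' +i* v'))); last by ring.
apply: le_trans (modulusD _ _) _.
have A1 : e / (4 * K * M) * modulus (z * (E - 1)) <= e / 2 * (`|u| + `|v|).
  apply: le_trans (ler_wpM2l _ nzE) _; first by rewrite divr_ge0 ?mulr_ge0// ltW.
  rewrite le_eqVlt; apply/orP; left; apply/eqP; field.
  by rewrite !gt_eqF.
have A2 : modulus (c * z * (E - 1 - (u' +i* v'))) <= e / 2 * (`|u| + `|v|).
  rewrite (modulusM (c * z)) (modulusM c z).
  apply: (@le_trans _ _ (L * (e1 * (K * (`|u| + `|v|))))).
    apply: ler_pM; rewrite ?mulr_ge0 ?modulus_ge0//; first by rewrite lerDl.
    by apply: le_trans h1' _; rewrite ler_wpM2l// ltW.
  have : e1 * (2 * K * L) * (`|u| + `|v|) <= e * (`|u| + `|v|).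
    by rewrite ler_wpM2r// addr_ge0.
  lra.
lra.
Qed.

(** The roots of unity of order 2^j are the nodes of [cell_sum] on a side of the square mapped onto
    the unit circle. *)
Definition root_avg (g : R[i] -> R[i]) (j : nat) : R[i] :=
  (2 ^- j)%:C * \sum_(k < 2 ^ j) g (cis (pi *+ 2 * (k%:R / 2 ^+ j))).

(** The exponential wraps the unit square around the annulus r <= |z| <= 1. The sides y = 0 and y =
    1 have the same image and cancel, so Goursat's theorem compares the averages over the circles of
    radius 1 and r; for small r the latter is close to g(0) by continuity. *)
Lemma mean_value (g : R[i] -> R[i]) :
  (forall z, modulus z <= 1 -> cdiff g z) ->
  forall e : R, 0 < e -> \forall j \near \oo, modulus (root_avg g j - g 0) <= e.
Proof.
move=> dg e e0.
have e20 : 0 < e / 2 by rewrite divr_gt0.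
have [|d d0 hd] := @cdiff_continuous g 0 _ _ e20.
  by apply: dg; rewrite modulus0.
pose r := Num.min (d / 2) (1 / 2).
have r0 : 0 < r by rewrite lt_min !divr_gt0.
have rd : r < d.
  by rewrite (@le_lt_trans _ _ (d / 2))// ?ge_min ?lexx// ltr_pdivrMr//; lra.
have r1 : r <= 1 by rewrite (@le_trans _ _ (1 / 2))// ?ge_min ?lexx ?orbT//; lra.
pose s := ln r.
have es : expR s = r by rewrite lnK.
have s0 : s <= 0 by exact: ln_le0.
pose p (x y : R) := (expR (s * (1 - x)))%:C * cis (pi *+ 2 * y).
have pi0 : 0 < pi *+ 2 :> R by rewrite pmulrn_rgt0// pi_gt0.
have := @goursat R (- s)%:C (0 +i* (pi *+ 2)) (fun x y => g (p x y)) _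
  (pi *+ 2 * (e / 2)) (mulr_gt0 pi0 e20).
case=> [x y /andP[x0 x1] _|J _ hJ].
  apply: cdiff_polar; apply: dg; rewrite modulusM modulus_cis mulr1 modulusR.
  by rewrite gtr0_norm ?expR_gt0// -[leRHS]expR0 ler_expR mulr_le0_ge0 ?subr_ge0.
exists J => // j /hJ {hJ} /=.
have j0 : (0 : R) < 2 ^- j by rewrite invr_gt0 exprn_gt0.
set D := root_avg g j - root_avg (fun z => g (r%:C * z)) j.
(* What survives is 2 pi i times the difference of the averages on the sides x = 1 (radius 1) and x
   = 0 (radius r). *)
have -> : cell_sum (- s)%:C (0 +i* (pi *+ 2)) (fun x y => g (p x y)) j 0 0 1 =
    (0 +i* (pi *+ 2)) * D.
  rewrite /cell_sum /D /root_avg -mulrBr -sumrB !mulr_sumr.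
  apply: eq_bigr => k _; rewrite !add0r !mul1r.
  rewrite /p !(mulr0, subrr, subr0, mulr1, expR0, mul1r) cis0.
  rewrite (_ : cis (pi *+ 2) = 1); last by rewrite /cis cos2pi sin2pi.
  by rewrite subrr mulr0 add0r mulrCA es.
rewrite modulusM (_ : modulus _ = pi *+ 2); last first.
  by rewrite /modulus /= expr0n add0r sqrtr_sqr gtr0_norm.
rewrite ler_pM2l// => hD.
have -> : root_avg g j - g 0 = D + (root_avg (fun z => g (r%:C * z)) j - g 0).
  by rewrite /D; ring.
apply: le_trans (modulusD _ _) _.
suff : modulus (root_avg (fun z => g (r%:C * z)) j - g 0) <= e / 2 by lra.
have -> : g 0 = (2 ^- j)%:C * \sum_(k < 2 ^ j) g 0.
  rewrite sumr_const card_ord -[X in _ * X]mulr_natl mulrA natrX.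
  rewrite (fmorphV (real_complex R)) (rmorphXn (real_complex R)) rmorph_nat.
  by rewrite mulVf ?mul1r// expf_neq0// pnatr_eq0.
rewrite /root_avg -mulrBr -sumrB modulusM modulusR gtr0_norm//.
rewrite ler_pdivrMl ?exprn_gt0//; apply: le_trans (modulus_sum _ _ _) _.
rewrite (_ : 2 ^+ j * _ = \sum_(k < 2 ^ j) (e / 2)); last first.
  by rewrite sumr_const card_ord -[RHS]mulr_natl natrX.
apply: ler_sum => k _; rewrite -[X in g X - _]add0r; apply: hd.
by rewrite modulusM modulus_cis mulr1 modulusR gtr0_norm.
Qed.

End MeanValue.

(** * Schwarz-Pick inequality *)

Section SchwarzPick.
Local Open Scope complex_scope.
Context {R : realType}.

Lemma differentiable_cdiff (g : R[i] -> R[i]) (z : R[i]) :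
  differentiable g z -> cdiff g z.
Proof.
move=> /derivable1_diffP dg; exists ('D_1 g z) => e e0.
have e0c : 0 < e%:C :> R[i] by rewrite ltcR.
have /cvgrPdist_lt /(_ _ e0c) [d /= d0 hd] := dg.
move: d0; rewrite ltcE/= => /andP[/eqP dI dR].
exists (complex.Re d) => // h hh.
have [->|h0] := eqVneq h 0.
  by rewrite mulr0 addr0 subrr subr0 modulus0 mulr0.
have := hd h; rewrite /= sub0r normrN modulus_normE.
rewrite ltcE/= dI eqxx hh => /(_ isT h0).
rewrite modulus_normE ltcR => {}hd.
rewrite [leLHS](_ : _ = modulus ('D_1 g z - h^-1 * (g (z + h) - g z)) * modulus h).
  rewrite ler_wpM2r ?modulus_ge0// ltW//.
  have hA : h *: (1 : R[i]) = h by exact: mulr1.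
  by rewrite (addrC z h) -[X in g (X + z)]hA; exact: hd.
by rewrite -modulusM mulrBl [_^-1 * _]mulrC -mulrA mulVf// mulr1 modulusBC.
Qed.

(** A double zero divided by a simple one stays differentiable, the quotient taking the value 0 at
    a. This takes the place of the removable singularity theorem in the Schwarz argument. *)
Lemma cdiff_mul_div (p q : R[i] -> R[i]) (a : R[i]) : cdiff p a -> cdiff q a ->
  p a = 0 -> q a = 0 -> cdiff (fun l => p l * q l / (l - a)) a.
Proof.
move=> [c hc] [b hb] pa qa; exists (c * b) => e e0.
have c0 := modulus_ge0 c; have b0 := modulus_ge0 b.
pose K := modulus c + modulus b + 1.
have K0 : 0 < K by rewrite ltr_wpDl// addr_ge0.
pose e1 := Num.min 1 (e / K).
have e10 : 0 < e1 by rewrite lt_min ltr01 divr_gt0.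
have e11 : e1 <= 1 by rewrite ge_min lexx.
have e1e : e1 * K <= e by rewrite -ler_pdivlMr// ge_min lexx orbT.
have [d1 d10 h1] := hc _ e10; have [d2 d20 h2] := hb _ e10.
exists (Num.min d1 d2) => [|h]; first by rewrite lt_min d10.
rewrite lt_min => /andP[/h1 {}h1 /h2 {}h2].
rewrite pa subr0 in h1; rewrite qa subr0 in h2.
rewrite pa qa !mul0r subr0 (addrC a h) addrK.
rewrite (addrC a h) in h1 h2.
have [h0|h0] := eqVneq h 0.
  by rewrite h0 invr0 !mulr0 subr0 modulus0 mulr0.
set r := _ - _ in h1; set s := _ - _ in h2.
have -> : p (h + a) = c * h + r by rewrite /r; ring.
have -> : q (h + a) = b * h + s by rewrite /s; ring.
rewrite (_ : _ - _ = c * s + b * r + r * s / h); last by field.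
have hh : 0 < modulus h by rewrite modulus_gt0.
have rsh : modulus (r * s / h) <= e1 * modulus h.
  rewrite modulusM modulusV ler_pdivrMr// modulusM.
  apply: le_trans (ler_pM _ _ h1 h2) _; rewrite ?modulus_ge0//.
  by rewrite ler_wpM2l ?mulr_ge0 ?(ltW e10) ?(ltW hh)// ler_piMl// ltW.
apply: le_trans (modulusD _ _) _.
have := modulusD (c * s) (b * r); rewrite (modulusM c) (modulusM b) => csbr.
have A1 : modulus c * modulus s <= modulus c * (e1 * modulus h) by rewrite ler_wpM2l.
have A2 : modulus b * modulus r <= modulus b * (e1 * modulus h) by rewrite ler_wpM2l.
have A3 : e1 * K * modulus h <= e * modulus h by rewrite ler_wpM2r// ltW.
rewrite /K in A3; lra.
Qed.

Lemma modulus_max (g : R[i] -> R[i]) (M : R) :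
  (forall z, modulus z <= 1 -> cdiff g z) ->
  (forall z, modulus z = 1 -> modulus (g z) <= M) -> modulus (g 0) <= M.
Proof.
move=> dg gM; apply/ler_addgt0Pr => e e0.
have [J _ /(_ J (leqnn _)) /= hJ] := mean_value dg e0.
have -> : g 0 = root_avg g J - (root_avg g J - g 0) by ring.
apply: le_trans (modulusB _ _) _; apply: lerD => //.
rewrite /root_avg modulusM modulusR gtr0_norm ?invr_gt0 ?exprn_gt0//.
rewrite ler_pdivrMl ?exprn_gt0//; apply: le_trans (modulus_sum _ _ _) _.
rewrite (_ : 2 ^+ J * _ = \sum_(k < 2 ^ J) M); last first.
  by rewrite sumr_const card_ord -[RHS]mulr_natl natrX.
by apply: ler_sum => k _; apply/gM/modulus_cis.
Qed.

Lemma pick_identity (a l : R[i]) : modulus (1 - conjc a * l) ^+ 2 =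
  modulus (a - l) ^+ 2 + (1 - modulus a ^+ 2) * (1 - modulus l ^+ 2).
Proof. by rewrite !modulus_sqr; case: a => a b; case: l => c d /=; ring. Qed.

Lemma modulus_1subM (a l : R[i]) : 1 - modulus a * modulus l <= modulus (1 - conjc a * l).
Proof.
have := modulusD (1 - conjc a * l) (conjc a * l).
rewrite subrK modulus1 modulusM modulus_conj; lra.
Qed.

Lemma differentiable_sub (f g : R[i] -> R[i]) z :
  differentiable f z -> differentiable g z -> differentiable (fun x => f x - g x) z.
Proof. exact: differentiableB. Qed.

Lemma differentiable_mul (f g : R[i] -> R[i]) z :
  differentiable f z -> differentiable g z -> differentiable (fun x => f x * g x) z.
Proof. exact: differentiableM. Qed.

Lemma differentiable_inv (f : R[i] -> R[i]) z :
  differentiable f z -> f z != 0 -> differentiable (fun x => (f x)^-1) z.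
Proof. exact: differentiableV. Qed.

Lemma differentiable_const (c z : R[i]) : differentiable (fun=> c : R[i]) z.
Proof. exact: differentiable_cst. Qed.

Lemma differentiable_var (z : R[i]) : differentiable (fun x : R[i] => x) z.
Proof. by apply/derivable1_diffP; exact: derivable_id. Qed.

(** With p the Moebius map sending b = g(0) to 0, a Schwarz lemma for p(g) bounds |p(g(a))|^2 by a,
    and [pick_identity] converts this into the claim. The factor 2 bounds 1 + |b|. *)
Lemma schwarz_pick1 (g : R[i] -> R[i]) (a : R) :
  (forall l, modulus l < 1 -> differentiable g l) ->
  (forall l, modulus l < 1 -> modulus (g l) < 1) -> 0 <= a < 1 ->
  (1 - a) * (1 - modulus (g 0)) <= 2 * (1 - modulus (g a%:C) ^+ 2).
Proof.
move=> dg g1 /andP[a0 a1]; set b := g 0.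
have b1 : modulus b < 1 by apply: g1; rewrite modulus0.
have b0 := modulus_ge0 b.
have den w : modulus w < 1 -> 1 - conjc b * w != 0.
  move=> w1; rewrite -modulus_gt0 (lt_le_trans _ (modulus_1subM _ _))//.
  have := modulus_ge0 w; nra.
pose p w := (w - b) / (1 - conjc b * w).
have pE w : modulus w < 1 -> modulus (p w) ^+ 2 * modulus (1 - conjc b * w) ^+ 2 =
    modulus (b - w) ^+ 2.
  move=> w1; rewrite /p modulusM modulusV modulusBC exprMn exprVn -mulrA mulVf ?mulr1//.
  by rewrite expf_neq0// modulus_eq0 den.
have p1 w : modulus w < 1 -> modulus (p w) <= 1.
  move=> w1; rewrite -(@ler_pXn2r _ 2) ?nnegrE ?modulus_ge0// expr1n.
  have := pE _ w1; rewrite pick_identity => {}pE.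
  have := modulus_ge0 w; have := sqr_ge0 (modulus (b - w)).
  have : 0 < modulus (1 - conjc b * w) ^+ 2 by rewrite exprn_gt0// modulus_gt0 den.
  rewrite pick_identity; set D := _ + _ in pE *; set X := modulus (p w) ^+ 2 in pE *.
  move=> D0 s0 w0; rewrite -(ler_pM2r D0) pE mul1r lerDl mulr_ge0//.
    by rewrite subr_ge0 expr_le1// ltW.
  by rewrite subr_ge0 expr_le1// ltW.
(* Schwarz's lemma proper would give a^2. The weaker bound comes from working with a squared
   function, whose double zero allows [cdiff_mul_div]. *)
suff key : modulus (p (g a%:C)) ^+ 2 <= a.
  have ga1 : modulus (g a%:C) < 1 by apply: g1; rewrite modulusR ger0_norm.
  have := pE _ ga1; rewrite pick_identity.
  have := modulus_1subM b (g a%:C).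
  have := pick_identity b (g a%:C).
  set w := modulus (g a%:C) in ga1 *; have w0 : 0 <= w by exact: modulus_ge0.
  set D := modulus (1 - _); set X := modulus _ ^+ 2 in key *; set Y := modulus (b - _) ^+ 2.
  move=> E1 E2 E3.
  have D1 : (1 - modulus b) ^+ 2 <= D ^+ 2.
    rewrite ler_pXn2r ?nnegrE ?subr_ge0 ?(ltW b1) ?modulus_ge0//.
    by apply: le_trans E2; rewrite lerD2l lerN2 ler_piMr// ltW.
  have E4 : (1 - X) * D ^+ 2 = (1 - modulus b ^+ 2) * (1 - w ^+ 2).
    by rewrite mulrBl {2}E1 E3 mul1r E1; ring.
  have E5 : (1 - a) * (1 - modulus b) ^+ 2 <= (1 - modulus b ^+ 2) * (1 - w ^+ 2).
    by rewrite -E4; apply: ler_pM; rewrite ?sqr_ge0 ?subr_ge0 ?(ltW a1)// lerD2l lerN2.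
  have b1' : 0 < 1 - modulus b by rewrite subr_gt0.
  rewrite -(ler_pM2l b1').
  apply: le_trans (_ : (1 - modulus b ^+ 2) * (1 - w ^+ 2) <= _).
    by apply: le_trans E5; rewrite expr2; lra.
  have W0 : 0 <= 1 - w ^+ 2 by rewrite subr_ge0 expr_le1// ltW.
  rewrite (_ : 1 - modulus b ^+ 2 = (1 - modulus b) * (1 + modulus b)); last by ring.
  by rewrite -mulrA ler_pM2l// ler_wpM2r//; lra.
have [a_0|a_n0] := eqVneq a 0.
  by rewrite a_0 /p -/b subrr mul0r modulus0 expr0n.
have a_gt0 : 0 < a by rewrite lt_neqAle eq_sym a_n0.
set X := modulus _ ^+ 2.
(* Equals (1 - a^2) / (1 - a)^2: on the unit circle 1 - |m|^2 = (1 - a^2)(1 - s^2) / |D|^2 with |D|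
   >= 1 - a, hence is at most k (1 - s^2). *)
pose k := (1 + a) / (1 - a).
have k0 : 0 < k by rewrite divr_gt0 ?subr_gt0// ltr_wpDr.
suff h s : a < s -> s < 1 -> X * (1 - k * (1 - s ^+ 2)) <= a.
  rewrite leNgt; apply/negP => aX.
  have X0 : 0 < X by exact: le_lt_trans aX.
  have X1 : X <= 1.
    by rewrite /X expr_le1 ?modulus_ge0// p1// g1// modulusR ger0_norm.
  have k4 : 0 < 4 * k by exact: mulr_gt0.
  (* Taking s = 1 - d plays the limit s -> 1: the first term keeps s above a, the second makes k (1
     - s^2) at most (X - a) / 2, against X <= 1. *)
  pose d := Num.min ((1 - a) / 2) ((X - a) / (4 * k)).
  have d0 : 0 < d.
    rewrite lt_min; apply/andP; split; apply: divr_gt0; rewrite ?subr_gt0//.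
  have d1 : d <= (1 - a) / 2 by rewrite ge_min lexx.
  have d2 : d * (4 * k) <= X - a by rewrite -ler_pdivlMr// ge_min lexx orbT.
  have : a < 1 - d by lra.
  move=> /h; rewrite ltrBlDr ltrDl => /(_ d0).
  have : k * (1 - (1 - d) ^+ 2) <= k * (2 * d) by rewrite ler_pM2l//; nra.
  nra.
move=> as_ s1; have s0 : 0 < s by exact: lt_trans as_.
pose D l := 1 - a%:C * (s%:C * l) : R[i].
(* The mean value property evaluates at 0 and asks for differentiability on the closed disc. So a
   Moebius map moves a to 0, and s < 1 keeps the image of the closed disc inside the open one; its
   zero is a / s. *)
pose m l := (a%:C - s%:C * l) / D l.
have sl l : modulus l <= 1 -> modulus (s%:C * l) <= s.
  by move=> l1; rewrite modulusM modulusR gtr0_norm// ler_piMr// ltW.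
have ma : modulus a%:C = a by rewrite modulusR ger0_norm.
have D1 l : modulus l <= 1 -> 1 - a <= modulus (D l).
  move=> l1; have := modulus_1subM a%:C (s%:C * l); rewrite conjc_real ma; apply: le_trans.
  rewrite lerD2l lerN2 ler_piMr// (le_trans (sl _ l1))// ltW//.
have Dn0 l : modulus l <= 1 -> D l != 0.
  by move=> l1; rewrite -modulus_gt0 (lt_le_trans _ (D1 _ l1))// subr_gt0.
have mE l : modulus l <= 1 -> modulus (m l) ^+ 2 =
   1 - (1 - a ^+ 2) * (1 - modulus (s%:C * l) ^+ 2) / modulus (D l) ^+ 2.
  move=> l1; have := pick_identity a%:C (s%:C * l).
  rewrite conjc_real ma -/(D l) => E.
  have D0 : modulus (D l) != 0 by rewrite modulus_eq0 Dn0.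
  rewrite /m modulusM modulusV exprMn exprVn.
  have -> : modulus (a%:C - s%:C * l) ^+ 2 =
    modulus (D l) ^+ 2 - (1 - a ^+ 2) * (1 - modulus (s%:C * l) ^+ 2) by rewrite E; ring.
  by field.
have a2 : 0 < 1 - a ^+ 2 by rewrite subr_gt0 expr_lt1.
have sl2 l : modulus l <= 1 -> modulus (s%:C * l) ^+ 2 < 1.
  by move=> l1; rewrite expr_lt1 ?modulus_ge0// (le_lt_trans (sl _ l1)).
have m1 l : modulus l <= 1 -> modulus (m l) < 1.
  move=> l1; rewrite -(@ltr_pXn2r _ 2) ?nnegrE ?modulus_ge0// expr1n mE//.
  rewrite gtrDl oppr_lt0 divr_gt0 ?exprn_gt0 ?modulus_gt0 ?Dn0// mulr_gt0// subr_gt0.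
  exact: sl2.
pose P l := p (g (m l)).
have dsl l : differentiable (fun l : R[i] => s%:C * l) l.
  exact: (differentiable_mul (differentiable_const _ _) (differentiable_var _)).
have dD l : differentiable D l.
  apply: (differentiable_sub (differentiable_const _ _)).
  exact: (differentiable_mul (differentiable_const _ _) (dsl l)).
have dm l : modulus l <= 1 -> differentiable m l.
  move=> l1; apply: (@differentiable_mul (fun l => a%:C - s%:C * l) (fun l => (D l)^-1)).
    exact: (differentiable_sub (differentiable_const _ _) (dsl l)).
  exact: (differentiable_inv (dD l) (Dn0 l l1)).
have dP l : modulus l <= 1 -> differentiable P l.
  move=> l1; have dgm : differentiable (fun l => g (m l)) l.
    by apply: (@differentiable_comp _ _ _ _ m g); [exact: dm|exact/dg/m1].
  apply: (@differentiable_mul (fun l => g (m l) - b) (fun l => (1 - conjc b * g (m l))^-1)).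
    exact: (differentiable_sub dgm (differentiable_const _ _)).
  apply: (@differentiable_inv (fun l => 1 - conjc b * g (m l))).
    apply: (differentiable_sub (differentiable_const _ _)).
    exact: (differentiable_mul (differentiable_const _ _) dgm).
  exact/den/g1/m1.
pose t := (a / s)%:C : R[i].
have t1 : modulus t <= 1.
  by rewrite modulusR ger0_norm ?divr_ge0 ?(ltW s0)// ler_pdivrMr// mul1r ltW.
have Pt : P t = 0.
  have mt : m t = 0.
    by rewrite /m /t -rmorphM/= mulrCA mulfV ?gt_eqF// mulr1 subrr mul0r.
  by rewrite /P /p mt -/b subrr mul0r.
(* Away from its zero [t], [m] equals - s (l - t) / D, so Q is - s P^2 / m, written so that its
   differentiability at [t] is a case of [cdiff_mul_div]. *)
pose Q l := P l * (P l * D l) / (l - t).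
have dPD l : modulus l <= 1 -> differentiable (fun l => P l * D l) l.
  by move=> l1; apply: differentiable_mul; [exact: dP|exact: dD].
have dQ l : modulus l <= 1 -> cdiff Q l.
  move=> l1; have [->|lt] := eqVneq l t.
    apply: (@cdiff_mul_div P (fun l => P l * D l)); rewrite ?Pt ?mul0r//.
      exact/differentiable_cdiff/dP.
    exact/differentiable_cdiff/dPD.
  apply: differentiable_cdiff.
  apply: (@differentiable_mul (fun l => P l * (P l * D l)) (fun l => (l - t)^-1)).
    by apply: (@differentiable_mul P (fun l => P l * D l)); [exact: dP|exact: dPD].
  apply: (@differentiable_inv (fun l => l - t)); last by rewrite subr_eq0.
  exact: (differentiable_sub (differentiable_var _) (differentiable_const _ _)).
have [|km] := leP (1 - k * (1 - s ^+ 2)) 0.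
  move=> km; apply: le_trans (ltW a_gt0).
  by rewrite mulr_ge0_le0// sqr_ge0.
have PX : X = modulus (P 0) ^+ 2.
  by rewrite /X /P /m /D !mulr0 !subr0 divr1.
have Q0 : modulus (Q 0) = X * s / a.
  rewrite /Q /D !mulr0 subr0 mulr1 sub0r PX modulusM modulusV modulusN modulusM.
  rewrite modulusR ger0_norm ?divr_ge0 ?(ltW s0)// invf_div mulrA expr2//.
suff : modulus (Q 0) <= s / (1 - k * (1 - s ^+ 2)).
  rewrite Q0 ler_pdivlMr// mulrAC ler_pdivrMr// mulrAC [s * a]mulrC.
  by rewrite (ler_pM2r s0).
apply: modulus_max => // z z1; have z1' : modulus z <= 1 by rewrite z1.
have m2 : 1 - k * (1 - s ^+ 2) <= modulus (m z).
  apply: le_trans (_ : modulus (m z) ^+ 2 <= _); last first.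
    by rewrite expr2 ler_piMl ?modulus_ge0// ltW// m1.
  rewrite mE// modulusM z1 modulusR gtr0_norm// mulr1 lerD2l lerN2.
  rewrite mulrAC ler_wpM2r//; first by rewrite subr_ge0 expr_le1 ?ltW.
  have D1z := D1 _ z1'.
  have := ler_pXn2r (ltn0Sn 1) _ _ => /(_ _ (1 - a) (modulus (D z))).
  rewrite !nnegrE modulus_ge0 subr_ge0 (ltW a1) D1z => /(_ isT isT) D2.
  rewrite ler_pdivrMr ?exprn_gt0 ?modulus_gt0 ?Dn0//.
  apply: le_trans (_ : k * (1 - a) ^+ 2 <= _); last by rewrite ler_wpM2l ?(ltW k0)// D2.
  by rewrite /k le_eqVlt; apply/orP; left; apply/eqP; field; rewrite subr_eq0 eq_sym lt_eqF.
have m0 : 0 < modulus (m z) by exact: lt_le_trans m2.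
have Qz : Q z * m z = - s%:C * P z ^+ 2.
  have sc : s%:C != 0 :> R[i] by rewrite (inj_eq (@complexI R)) gt_eqF.
  have tE : t = a%:C / s%:C by rewrite /t rmorphM/= (fmorphV (real_complex R)).
  have : a%:C - s%:C * z != 0.
    by move: m0; rewrite modulus_gt0 /m mulf_eq0 negb_or => /andP[].
  move=> az; rewrite /Q /m tE; field; rewrite Dn0//= sc/=.
  by rewrite -oppr_eq0 opprB mulrC.
rewrite ler_pdivlMr//.
apply: le_trans (ler_wpM2l (modulus_ge0 _) m2) _.
rewrite -modulusM Qz modulusM modulusN modulusR gtr0_norm// ler_piMr ?(ltW s0)//.
by rewrite modulusX expr_le1 ?modulus_ge0// p1// g1// m1.
Qed.

Lemma sqnorm_ge0 N (z : 'rV[R[i]]_N) : 0 <= sqnorm z.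
Proof. by apply: sumr_ge0 => j _; rewrite sqr_ge0. Qed.

Lemma sqnormZ N (l : R[i]) (z : 'rV[R[i]]_N) :
  sqnorm (l *: z) = modulus l ^+ 2 * sqnorm z.
Proof.
by rewrite /sqnorm mulr_sumr; apply: eq_bigr => j _; rewrite mxE modulusM exprMn.
Qed.

Lemma sqnorm0 N : sqnorm (0 : 'rV[R[i]]_N) = 0.
Proof. by apply: big1 => j _; rewrite mxE modulus0 expr0n. Qed.

Lemma sqnorm_eq0 N (z : 'rV[R[i]]_N) : sqnorm z = 0 -> z = 0.
Proof.
move=> /eqP; rewrite psumr_eq0 => [/allP h|j _]; last by rewrite sqr_ge0.
apply/rowP => j; have := h j (mem_index_enum _).
by rewrite sqrf_eq0 modulus_eq0 mxE => /eqP.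
Qed.

Lemma differentiable_slice N (W : normedModType R[i]) (f : 'rV[R[i]]_N -> W)
    (z w : 'rV[R[i]]_N) (l : R[i]) :
  differentiable f (l *: w + z) -> differentiable (fun l : R[i] => f (l *: w + z)) l.
Proof. by move=> df; apply: differentiable_comp. Qed.

Lemma differentiable_comp_coord N (V : normedModType R[i]) (f : V -> 'rV[R[i]]_N)
    (z : V) (j : 'I_N) : differentiable f z -> differentiable (fun x => f x 0 j) z.
Proof.
move=> df; have := differentiable_coord (f z) 0 j.
exact: differentiable_comp.
Qed.

(** Reduction to one variable: with e = z / |z| and zeta = phi(z) / |phi(z)|, the function g(l) =
    <phi(l e), zeta> maps the disc into itself and takes the value |phi(z)| at |z|. *)
Lemma schwarz_pick N (phi : 'rV[R[i]]_N -> 'rV[R[i]]_N) (z : 'rV[R[i]]_N) :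
  holomorphic_self_map phi -> unit_ball z ->
  (1 - sqnorm z) * (1 - sqnorm (phi 0)) <= 8 * (1 - sqnorm (phi z)).
Proof.
move=> [dphi bphi] z1; rewrite /unit_ball/= in z1.
have b1 x : sqnorm x < 1 -> sqnorm (phi x) < 1 by move/bphi.
have z0 := sqnorm_ge0 z.
have p01 : sqnorm (phi 0) < 1 by apply: b1; rewrite sqnorm0.
have p00 := sqnorm_ge0 (phi 0).
have [z_0|zn0] := eqVneq (sqnorm z) 0.
  by rewrite (sqnorm_eq0 z_0) sqnorm0; lra.
have zgt0 : 0 < sqnorm z by rewrite lt_neqAle eq_sym zn0.
have [pz|pz] := eqVneq (sqnorm (phi z)) 0.
  rewrite pz; nra.
have pzgt0 : 0 < sqnorm (phi z) by rewrite lt_neqAle eq_sym pz sqnorm_ge0.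
pose a := Num.sqrt (sqnorm z); pose n := Num.sqrt (sqnorm (phi z)).
have a0 : 0 < a by rewrite sqrtr_gt0.
have n0 : 0 < n by rewrite sqrtr_gt0.
have aE : a ^+ 2 = sqnorm z by rewrite sqr_sqrtr// ltW.
have nE : n ^+ 2 = sqnorm (phi z) by rewrite sqr_sqrtr// ltW.
have a1 : a < 1 by rewrite -(@ltr_pXn2r _ 2) ?nnegrE ?(ltW a0)// expr1n aE.
pose e := (a^-1)%:C *: z.
pose zeta := (n^-1)%:C *: phi z.
have e1 : sqnorm e = 1.
  by rewrite sqnormZ modulusR gtr0_norm ?invr_gt0// exprVn aE mulVf.
have zeta1 : sqnorm zeta = 1.
  by rewrite sqnormZ modulusR gtr0_norm ?invr_gt0// exprVn nE mulVf.
have le1 l : modulus l < 1 -> sqnorm (l *: e) < 1.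
  by move=> l1; rewrite sqnormZ e1 mulr1 expr_lt1 ?modulus_ge0.
pose g (l : R[i]) := \sum_j phi (l *: e) 0 j * conjc (zeta 0 j).
(* Coordinatewise 2 x y <= x^2 + y^2, with |zeta| = 1. At l = 0 this gives 1 - |phi(0)|^2 <= 2 (1 -
   |g(0)|). *)
have gb l : modulus (g l) <= (1 + sqnorm (phi (l *: e))) / 2.
  apply: le_trans (modulus_sum _ _ _) _.
  rewrite ler_pdivlMr// -[X in _ <= X + _]zeta1 /sqnorm -big_split/= mulr_suml.
  apply: ler_sum => j _; rewrite modulusM modulus_conj.
  have := sqr_ge0 (modulus (zeta 0 j) - modulus (phi (l *: e) 0 j)).
  by rewrite sqrrB; lra.
have dg l : modulus l < 1 -> differentiable g l.
  move=> l1; have -> : g = \sum_j (fun l => phi (l *: e) 0 j * conjc (zeta 0 j)).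
    by apply/funext => x; rewrite fct_sumE.
  apply: differentiable_sum => j; apply: differentiableM => //.
  apply: differentiable_comp_coord.
  have := @differentiable_slice N _ phi 0 e l.
  rewrite addr0 => /(_ (dphi _ (le1 _ l1))).
  by under eq_fun do rewrite addr0.
have ga : g a%:C = n%:C.
  rewrite /g /e scalerA -rmorphM/= mulfV ?gt_eqF// scale1r.
  rewrite (eq_bigr (fun j => (n^-1 * modulus (phi z 0 j) ^+ 2)%:C)); last first.
    move=> j _; rewrite /zeta mxE; case: (phi z 0 j) => x y.
    apply/eqP; rewrite eq_complex modulus_sqr /=.
    by apply/andP; split; apply/eqP; ring.
  rewrite -rmorph_sum -mulr_sumr -/(sqnorm (phi z)) -nE expr2 mulrA mulVf ?mul1r//.
  by rewrite gt_eqF.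
have := @schwarz_pick1 g a dg _; rewrite (ltW a0) a1 ga.
have -> : modulus n%:C ^+ 2 = sqnorm (phi z) by rewrite modulusR gtr0_norm.
have g1 l : modulus l < 1 -> modulus (g l) < 1.
  move=> l1; apply: le_lt_trans (gb l) _.
  have := b1 _ (le1 _ l1); lra.
move=> /(_ g1 isT).
have := gb 0; rewrite scale0r => gb0 h.
have q1 : sqnorm (phi z) < 1 by exact: b1.
(* The constant 8 is the product of three factors 2: this one, the one for phi(0), and the one of
   [schwarz_pick1]. *)
have : 1 - sqnorm z <= 2 * (1 - a) by rewrite -aE; nra.
have : (1 - sqnorm (phi 0)) <= 2 * (1 - modulus (g 0)) by lra.
move=> h1 h2.
have h3 : (1 - sqnorm z) * (1 - sqnorm (phi 0)) <=
    2 * (1 - a) * (2 * (1 - modulus (g 0))) by apply: ler_pM => //; lra.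
lra.
Qed.

End SchwarzPick.

(** * Coordinates and radial weights *)

Section PointwiseContinuity.
Local Open Scope complex_scope.
Context {R : realType} {n : nat}.
Local Notation T := (measurableTypeR R).

Definition dyadic_floor (k : nat) (x : R) : R := (Num.floor (2 ^+ k * x))%:~R / 2 ^+ k.

Lemma dyadic_floor_bound k x : `|dyadic_floor k x - x| <= 2 ^- k.
Proof.
have k0 : (0 : R) < 2 ^+ k by rewrite exprn_gt0.
have /andP[h1 h2] := Num.Theory.floor_itv (2 ^+ k * x).
rewrite /dyadic_floor distrC ger0_norm.
  rewrite -(ler_pM2r k0) mulrBl mulfVK ?gt_eqF// mulVf ?gt_eqF//.
  by rewrite intrD in h2; rewrite (mulrC x); lra.
by rewrite subr_ge0 ler_pdivrMr// (mulrC x).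
Qed.

(* Rounding every coordinate to the grid of mesh [2 ^- k] has countably many
   values, which makes [h] composed with it measurable for arbitrary [h]. *)
Lemma measurable_pointwise_continuous (D : set (n.-tuple T)) (h : n.-tuple T -> R) :
  (forall t, D t -> forall e : R, 0 < e -> exists2 d : R, 0 < d &
    forall u : n.-tuple T, (forall i, `|tnth u i - tnth t i| < d) -> `|h u - h t| < e) ->
  measurable_fun D h.
Proof.
move=> hD.
pose rd k (t : n.-tuple T) : n.-tuple T := [tuple dyadic_floor k (tnth t i) | i < n].
apply: (@measurable_fun_cvg _ _ _ D (fun k t => h (rd k t))).
  move=> k; apply: measurable_funTS => _ Y mY; rewrite setTI.
  pose val (v : n.-tuple int) : n.-tuple T := [tuple (tnth v i)%:~R / 2 ^+ k | i < n].
  pose S (v : n.-tuple int) : set (n.-tuple T) :=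
    if `[< Y (h (val v)) >] then
      \bigcap_(i in [set: 'I_n]) ((@tnth n T ^~ i) @^-1`
         [set x | Num.floor (2 ^+ k * x) = tnth v i]) else set0.
  rewrite (_ : _ @^-1` _ = \bigcup_v S v); last first.
    apply/seteqP; split => t /=.
      move=> Yt; exists [tuple Num.floor (2 ^+ k * tnth t i) | i < n] => //.
      rewrite /S; case: asboolP => [_ i _ /=|]; first by rewrite tnth_mktuple.
      case; rewrite (_ : val _ = rd k t)//.
      by apply: eq_from_tnth => i; rewrite !tnth_mktuple.
    move=> [v _]; rewrite /S; case: asboolP => // Yv vt.
    rewrite (_ : rd k t = val v)//; apply: eq_from_tnth => i.
    by rewrite !tnth_mktuple /dyadic_floor (vt i Logic.I).
  apply: countable_bigcupT_measurable => [|v]; first exact: countableP.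
  rewrite /S; case: asboolP => // _.
  apply: fin_bigcap_measurable => // i _.
  rewrite -[X in measurable X]setTI; apply: measurable_tnth => //.
  rewrite (_ : [set x | _] = `[(tnth v i)%:~R / 2 ^+ k, ((tnth v i + 1)%:~R) / 2 ^+ k[%classic)//.
  have k0 : (0 : R) < 2 ^+ k by rewrite exprn_gt0.
  apply/seteqP; split => x /=; rewrite in_itv/= ler_pdivrMr// ltr_pdivlMr// mulrC.
    by move=> <-; exact: Num.Theory.floor_itv.
  by move/Num.Theory.floor_def.
(* The rounded point may lie outside [D]; the hypothesis controls h at all points close to t, in [D]
   or not. *)
move=> t Dt; apply/cvgrPdist_lt => e e0.
have [d d0 hd] := hD t Dt e e0.
have /cvgrPdist_lt /(_ _ d0) [m _ hm] :
    (fun m => (2^-1 : R) ^+ m) @ \oo --> (0 : R).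
  by apply: cvg_expr; rewrite ger0_norm ?invf_lt1// ltr1n.
exists m => // k /= mk; rewrite distrC; apply: hd => i.
rewrite tnth_mktuple; apply: le_lt_trans (dyadic_floor_bound _ _) _.
by have := hm k mk; rewrite /= sub0r normrN exprVn ger0_norm.
Qed.

End PointwiseContinuity.

(** * Balls, shells and radial weights in real coordinates *)

Section Coordinates.
Local Open Scope complex_scope.
Context {R : realType} {N : nat}.
Local Notation T := (measurableTypeR R).
Local Notation CN := 'rV[R[i]]_N.
Local Notation R2N := ((N + N).-tuple T).
Implicit Types t u : R2N.
Implicit Types z w : CN.

Definition coords z : R2N := [tuple match fintype.split k with
  | inl j => complex.Re (z 0 j) | inr j => complex.Im (z 0 j) end | k < N + N].

Lemma coordsK : cancel coords (@point_of_coords R N).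
Proof.
move=> z; apply/rowP => j; rewrite !mxE !tnth_mktuple.
rewrite -[lshift N j]/(unsplit (inl j)) -[rshift N j]/(unsplit (inr j)) !unsplitK.
by case: (z 0 j).
Qed.

Lemma point_of_coordsD t u :
  point_of_coords (tadd t u) = point_of_coords t + point_of_coords u.
Proof. by apply/rowP => j; rewrite !mxE !tnth_mktuple. Qed.

Lemma point_of_coordsZ (k : R) t : point_of_coords (tscale k t) = k%:C *: point_of_coords t.
Proof.
apply/rowP => j; rewrite !mxE !tnth_mktuple; apply/eqP.
by rewrite eq_complex /= !mul0r subr0 addr0 !eqxx.
Qed.

Lemma point_of_coords_rot (theta : R) t :
  point_of_coords (rot predT (cos theta) (sin theta) t) = cis theta *: point_of_coords t.
Proof.
apply/rowP => j; rewrite !mxE tnth_rotl tnth_rotr /=; apply/eqP.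
by rewrite eq_complex /= eqxx/= addrC.
Qed.

Lemma lpres_cis (theta : R) : lpres (@rot R N predT (cos theta) (sin theta)).
Proof. exact/lpres_rot/cos2Dsin2. Qed.

Definition sq t : R := sqnorm (point_of_coords t).

Lemma sqE t : sq t = \sum_(j < N) (tnth t (lshift N j) ^+ 2 + tnth t (rshift N j) ^+ 2).
Proof. by apply: eq_bigr => j _; rewrite mxE modulus_sqr. Qed.

Lemma sq_ge0 t : 0 <= sq t.
Proof. exact: sqnorm_ge0. Qed.

Lemma measurable_sq : measurable_fun setT (sq : R2N -> R).
Proof.
rewrite (_ : sq = fun t => \sum_(j < N) (tnth t (lshift N j) ^+ 2 + tnth t (rshift N j) ^+ 2)).
  apply: measurable_sum => j; apply: measurable_funD; apply: measurable_funX; exact: measurable_tnth.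
by apply/funext => t; exact: sqE.
Qed.

Lemma measurable_sq_preimage (Y : set R) : measurable Y -> measurable (sq @^-1` Y).
Proof. by move=> mY; rewrite -[X in measurable X]setTI; exact: measurable_sq. Qed.

Lemma sq_scale (k : R) t : sq (tscale k t) = k ^+ 2 * sq t.
Proof. by rewrite /sq point_of_coordsZ sqnormZ modulusR real_normK ?num_real. Qed.

Lemma sq_rot (theta : R) t : sq (rot predT (cos theta) (sin theta) t) = sq t.
Proof. by rewrite /sq point_of_coords_rot sqnormZ modulus_cis expr1n mul1r. Qed.

Definition sqball (r2 : R) : set R2N := [set t | sq t < r2].

Lemma measurable_sqball r2 : measurable (sqball r2).
Proof.
rewrite (_ : sqball _ = sq @^-1` `]-oo, r2[%classic); first exact: measurable_sq_preimage.
by apply/seteqP; split => t; rewrite /= in_itv.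
Qed.

Lemma sqball_sub_cube (r : R) : 0 < r -> sqball (r ^+ 2) `<=` @cube R (N + N) r.
Proof.
move=> r0 t /= tr i; rewrite -(@ltr_pXn2r _ 2) ?nnegrE ?(ltW r0)//.
apply: le_lt_trans tr; rewrite real_normK ?num_real// sqE -(splitK i).
have ge0 (j : 'I_N) : 0 <= tnth t (lshift N j) ^+ 2 + tnth t (rshift N j) ^+ 2.
  by rewrite addr_ge0// sqr_ge0.
case: (fintype.split i) => j /=; rewrite (bigD1 j)//=.
  by rewrite -addrA lerDl addr_ge0 ?sqr_ge0// sumr_ge0.
by rewrite addrAC lerDr addr_ge0 ?sqr_ge0// sumr_ge0.
Qed.

Lemma cube_sub_sqball (r : R) : 0 < r ->
  @cube R (N + N) (r / (2 * N%:R + 1)) `<=` sqball (r ^+ 2).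
Proof.
move=> r0 t h; rewrite /sqball/= sqE.
set q := r / _ in h; have N0 : (0 : R) <= N%:R by [].
have q0 : 0 < q by rewrite divr_gt0// ltr_wpDl// mulr_ge0.
have -> : r = q * (2 * N%:R + 1) by rewrite /q mulfVK// gt_eqF// ltr_wpDl// mulr_ge0.
have hq i : tnth t i ^+ 2 <= q ^+ 2.
  by rewrite -[tnth t i ^+ 2]real_normK ?num_real// ler_pXn2r ?nnegrE ?(ltW q0)// ltW// h.
apply: (@le_lt_trans _ _ (\sum_(j < N) (q ^+ 2 + q ^+ 2))).
  by apply: ler_sum => j _; rewrite lerD.
rewrite sumr_const card_ord -[ltLHS]mulr_natl [ltRHS]exprMn.
have q2 : 0 < q ^+ 2 by rewrite exprn_gt0.
rewrite (_ : N%:R * _ = q ^+ 2 * (2 * N%:R)); last by ring.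
by rewrite ltr_pM2l//; nra.
Qed.

Definition vball : R := fine (lebesgue_Rn R (N + N) (sqball 1)).

Lemma lebesgue_sqball1 : lebesgue_Rn R (N + N) (sqball 1) = vball%:E.
Proof.
rewrite fineK// ge0_fin_numE//.
apply: (@le_lt_trans _ _ (lebesgue_Rn R (N + N) (@cube R (N + N) 1))).
  apply: le_measure; rewrite ?inE; [exact: measurable_sqball|exact: measurable_cube|].
  by rewrite -[X in sqball X](expr1n _ 2); exact: sqball_sub_cube.
by rewrite lebesgue_cube// ltry.
Qed.

Lemma vball_gt0 : 0 < vball.
Proof.
rewrite -lte_fin -lebesgue_sqball1.
have h : (0 : R) < 1 / (2 * N%:R + 1) by rewrite divr_gt0// ltr_wpDl// mulr_ge0.
apply: (@lt_le_trans _ _ (lebesgue_Rn R (N + N) (@cube R (N + N) (1 / (2 * N%:R + 1))))).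
  by rewrite lebesgue_cube ?(ltW h)// lte_fin exprn_gt0// mulr_gt0.
apply: le_measure; rewrite ?inE; [exact: measurable_cube|exact: measurable_sqball|].
by rewrite -[X in sqball X](expr1n _ 2); exact: cube_sub_sqball.
Qed.

Lemma lebesgue_sqball (r : R) : 0 < r ->
  lebesgue_Rn R (N + N) (sqball (r ^+ 2)) = (r ^+ (N + N) * vball)%:E.
Proof.
move=> r0.
have -> : sqball (r ^+ 2) = tscale r^-1 @^-1` sqball 1.
  apply/seteqP; split => t; rewrite /sqball/= sq_scale exprVn mulrC ltr_pdivrMr ?exprn_gt0//.
    by rewrite mul1r.
  by rewrite mul1r.
rewrite lebesgue_Rn_scaling ?invr_gt0//; last exact: measurable_sqball.
by rewrite exprVn invrK [X in (_ * X)%E]lebesgue_sqball1.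
Qed.

Definition shell (tau : R) : set R2N := [set t | sq t < 1 /\ 1 - sq t <= tau].

Lemma measurable_shell tau : measurable (shell tau).
Proof.
rewrite (_ : shell _ = sq @^-1` `[1 - tau, 1[%classic); first exact: measurable_sq_preimage.
apply/seteqP; split => t; rewrite /shell/= in_itv/=.
  by move=> [-> h]; rewrite andbT; lra.
by move=> /andP[h ->]; split => //; lra.
Qed.

Lemma bernoulli_le (x : R) n : 0 <= x <= 1 -> 1 - x ^+ n <= n%:R * (1 - x).
Proof.
move=> /andP[x0 x1]; elim: n => [|n IH]; first by rewrite expr0 mul0r subrr.
have -> : 1 - x ^+ n.+1 = (1 - x ^+ n) + x ^+ n * (1 - x) by rewrite exprS; ring.
rewrite -natr1 mulrDl mul1r lerD// ler_piMl ?subr_ge0//.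
exact: exprn_ile1.
Qed.

(** For tau < 1, scaling gives the mass (1 - (1 - tau)^N) [vball], at most N tau [vball] by
    Bernoulli. The constant N + 1 also covers tau >= 1 in every dimension, N = 0 included. *)
Lemma lebesgue_shell_le (tau : R) : 0 <= tau ->
  (lebesgue_Rn R (N + N) (shell tau) <= ((N%:R + 1) * tau * vball)%:E)%E.
Proof.
move=> t0; have v0 := vball_gt0.
have [t1|t1] := leP 1 tau.
  apply: (@le_trans _ _ (lebesgue_Rn R (N + N) (sqball 1))).
    apply: le_measure; rewrite ?inE; [exact: measurable_shell|exact: measurable_sqball|].
    by move=> t [].
  rewrite [X in (X <= _)%E]lebesgue_sqball1 lee_fin ler_peMl ?(ltW v0)//.
  by rewrite -[leLHS]mulr1 ler_pM// lerDr.
pose k := Num.sqrt (1 - tau).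
have k0 : 0 < k by rewrite sqrtr_gt0 subr_gt0.
have k2 : k ^+ 2 = 1 - tau by rewrite sqr_sqrtr// subr_ge0 ltW.
have -> : shell tau = sqball 1 `\` sqball (k ^+ 2).
  rewrite k2; apply/seteqP; split => t; rewrite /shell /sqball/=.
    by move=> [h1 h2]; split => //; apply/negP; rewrite -leNgt; lra.
  by move=> [h1 /negP]; rewrite -leNgt => h2; split => //; lra.
rewrite measureD; [|exact: measurable_sqball|exact: measurable_sqball|]; last first.
  by rewrite [X in (X < _)%E]lebesgue_sqball1 ltry.
rewrite setIidr; last by move=> t; rewrite /sqball/= k2; lra.
rewrite [X in (X - _ <= _)%E]lebesgue_sqball1 [X in (_ - X <= _)%E]lebesgue_sqball//.
rewrite -EFinB lee_fin -{1}[vball]mul1r -mulrBl ler_wpM2r ?(ltW v0)//.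
rewrite addnn -mul2n exprM k2.
apply: le_trans (bernoulli_le _ _) _; first by rewrite subr_ge0 (ltW t1)/= gerBl.
by rewrite opprB addrCA subrr addr0 mulrDl mul1r lerDl.
Qed.

Definition weight (a : R) t : R := (1 - sq t) `^ a.

Lemma measurable_weight a (D : set R2N) : measurable_fun D (weight a).
Proof.
apply: measurable_funTS.
apply: (measurableT_comp (measurable_powR a)).
by apply: measurable_funB => //; exact: measurable_sq.
Qed.

Lemma weight_ge0 a t : 0 <= weight a t.
Proof. exact: powR_ge0. Qed.

Lemma geometric_nneseries_le (K q : R) : 0 <= K -> 0 <= q < 1 ->
  (\sum_(0 <= k <oo) (K * q ^+ k)%:E <= (K / (1 - q))%:E)%E.
Proof.
move=> K0 /andP[q0 q1]; apply: lime_le.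
  by apply: is_cvg_nneseries => k _ _; rewrite lee_fin mulr_ge0// exprn_ge0.
apply: nearW => n; rewrite sumEFin lee_fin -mulr_sumr ler_wpM2l//.
rewrite -[leRHS]mul1r ler_pdivlMr ?subr_gt0//.
have := subrX1 q n; rewrite big_mkord => h.
have -> : (\sum_(i < n) q ^+ i) * (1 - q) = 1 - q ^+ n.
  by rewrite -[RHS]opprB h; ring.
by rewrite gerBl exprn_ge0.
Qed.

Lemma powR_dyadic (a s x : R) : 0 < s -> s / 2 < x <= s -> x `^ a <= 2 `^ `|a| * s `^ a.
Proof.
move=> s0 /andP[sx xs]; have x0 : 0 < x by apply: lt_trans sx; rewrite divr_gt0.
have [a0|a0] := leP 0 a.
  apply: (@le_trans _ _ (s `^ a)); first by rewrite ge0_ler_powR ?nnegrE// ltW.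
  by rewrite ler_peMl ?powR_ge0// -[leLHS](powRr0 2) ler_powR// ler1n.
have [b b0 ->] : exists2 b, 0 <= b & a = - b.
  by exists (- a); rewrite ?opprK// oppr_ge0 ltW.
rewrite normrN ger0_norm// !powRN -div1r ler_pdivrMr ?powR_gt0//.
rewrite mulrAC ler_pdivlMr ?powR_gt0// mul1r -powRM ?(ltW x0)//.
by rewrite ge0_ler_powR ?nnegrE ?mulr_ge0 ?(ltW x0) ?(ltW s0)//; lra.
Qed.

(** Cut into dyadic shells where 1 - |z|^2 is comparable to tau 2^(-k): the weight is comparable to
    the power a of that quantity and the mass is at most a multiple of it. The sum is a geometric
    series of ratio 2^(-(1 + a)), which is less than 1 because a > -1. *)
Lemma weight_shell_integral (a : R) : -1 < a -> exists2 K : R, 0 <= K &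
  forall tau : R, 0 < tau ->
  (\int[lebesgue_Rn R (N + N)]_(t in shell tau) (weight a t)%:E <= (K * tau `^ (1 + a))%:E)%E.
Proof.
move=> a1; have v0 := vball_gt0.
pose q : R := 2 `^ (- (1 + a)).
have q0 : 0 < q by exact: powR_gt0.
have q1 : q < 1.
  rewrite /q powRN invf_lt1 ?powR_gt0//.
  rewrite -[ltLHS](powRr0 2) /powR pnatr_eq0/= ltr_expR ltr_pM2r ?ln_gt0 ?ltr1n//; lra.
pose K0 := 2 `^ `|a| * ((N%:R + 1) * vball).
have K00 : 0 <= K0 by rewrite mulr_ge0 ?powR_ge0// mulr_ge0 ?addr_ge0// ltW.
exists (K0 / (1 - q)) => [|tau t0].
  by rewrite divr_ge0// subr_ge0 ltW.
pose s k : R := tau * 2 ^- k.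
have s0 k : 0 < s k by rewrite mulr_gt0// invr_gt0 exprn_gt0.
have sS k : s k.+1 = s k / 2 by rewrite /s exprS invfM; ring.
have sle k l : (k <= l)%N -> s l <= s k.
  move=> /subnKC <-; elim: (l - k)%N => [|m IH]; first by rewrite addn0.
  rewrite addnS sS; apply: le_trans IH; have := s0 (k + m)%N; lra.
pose F k : set R2N := [set t | s k.+1 < 1 - sq t <= s k].
have mF k : measurable (F k).
  rewrite (_ : F k = sq @^-1` `[1 - s k, 1 - s k.+1[%classic); first exact: measurable_sq_preimage.
  by apply/seteqP; split => t; rewrite /F/= in_itv/= => /andP[h1 h2]; apply/andP; split; lra.
have shellE : shell tau = \bigcup_k F k.
  apply/seteqP; split => t.
    move=> [h1 h2].
    have [m sm] : exists m, s m < 1 - sq t.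
      have d0 : 0 < (1 - sq t) / tau by rewrite divr_gt0// subr_gt0.
      have /cvgrPdist_lt /(_ _ d0) [m _ hm] :
          (fun m => (2^-1 : R) ^+ m) @ \oo --> (0 : R).
        by apply: cvg_expr; rewrite ger0_norm ?invf_lt1// ltr1n.
      exists m; have := hm m (leqnn m).
      by rewrite /= sub0r normrN exprVn ger0_norm// ltr_pdivlMr// mulrC.
    elim: m sm => [|m IH] sm.
      by move: sm; rewrite /s expr0 invr1 mulr1 ltNge h2.
    have [sm'|sm'] := ltP (s m) (1 - sq t); first exact: IH.
    by exists m => //; rewrite /F/= sm sm'.
  move=> [k _ /andP[h1 h2]]; split; first by have := s0 k.+1; lra.
  by apply: le_trans h2 _; apply: le_trans (sle 0%N k _) _ => //; rewrite /s expr0 invr1 mulr1.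
rewrite shellE ge0_integral_bigcup//; last 3 first.
- by apply/measurable_EFinP; exact: measurable_weight.
- by move=> t _; rewrite lee_fin weight_ge0.
- apply/trivIsetP => /= i j _ _ ij; apply/seteqP; split => // t [/andP[i1 i2] /andP[j1 j2]].
  by move: ij; rewrite neq_ltn => /orP[/sle|/sle]; lra.
pose K1 := K0 * tau `^ (1 + a).
have K10 : 0 <= K1 by rewrite mulr_ge0 ?powR_ge0.
apply: (@le_trans _ _ (\sum_(0 <= k <oo) (K1 * q ^+ k)%:E)%E); last first.
  apply: le_trans (geometric_nneseries_le K10 _) _; first by rewrite (ltW q0).
  by rewrite lee_fin /K1 mulrAC.
apply: lee_nneseries => [k _ _|k _].
  by apply: integral_ge0 => t _; rewrite lee_fin weight_ge0.
apply: (@le_trans _ _ (\int[lebesgue_Rn R (N + N)]_(t in F k) (2 `^ `|a| * s k `^ a)%:E)%E).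
  apply: ge0_le_integral => //.
  - by move=> t _; rewrite lee_fin weight_ge0.
  - by apply/measurable_EFinP; exact: measurable_weight.
  - by move=> t; rewrite /F/= sS lee_fin; exact: powR_dyadic.
rewrite integral_cst//.
have Fs : F k `<=` shell (s k).
  by move=> t /andP[h1 h2]; split => //; have := s0 k.+1; lra.
have cF : (lebesgue_Rn R (N + N) (F k) <= ((N%:R + 1) * s k * vball)%:E)%E.
  apply: le_trans (lebesgue_shell_le (ltW (s0 k))).
  by apply: le_measure; rewrite ?inE; [exact: mF|exact: measurable_shell|].
apply: le_trans (lee_wpmul2l _ cF) _; first by rewrite lee_fin mulr_ge0 ?powR_ge0.
rewrite -EFinM lee_fin /K1 /K0 le_eqVlt; apply/orP; left; apply/eqP.
have -> : q ^+ k = (2 ^- k) `^ (1 + a).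
  rewrite /q -powR_mulrn ?powR_ge0// -powRrM -(powR_invn k)// -powRrM; congr (_ `^ _); ring.
have E : s k `^ (1 + a) = s k * s k `^ a.
  rewrite powRD; last by rewrite (gt_eqF (s0 k)) implybT.
  by rewrite powRr1// ltW.
transitivity (2 `^ `|a| * ((N%:R + 1) * vball) * (s k * s k `^ a)); first by ring.
by rewrite -E {1}/s powRM ?(ltW t0)//; ring.
Qed.

End Coordinates.

(** * Sub-mean value inequality *)

Section Orlicz.
Local Open Scope complex_scope.
Context {R : realType} (psi : R -> R) (psiO : orlicz_function psi).

Lemma orlicz_convex x y t : 0 <= x -> 0 <= y -> 0 <= t <= 1 ->
  psi (t * x + (1 - t) * y) <= t * psi x + (1 - t) * psi y.
Proof.
move=> x0 y0 /andP[t0 t1].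
have [->|xy] := eqVneq x y; first by rewrite -!mulrDl subrKC !mul1r.
have [->|tn0] := eqVneq t 0; first by rewrite !mul0r !add0r subr0 !mul1r.
have [->|tn1] := eqVneq t 1; first by rewrite subrr !mul0r !addr0 !mul1r.
apply/ltW/(orlicz_strictly_convex psiO) => //.
by rewrite lt_neqAle eq_sym tn0 t0 lt_neqAle tn1 t1.
Qed.

Lemma orlicz_contract x t : 0 <= x -> 0 <= t <= 1 -> psi (t * x) <= t * psi x.
Proof.
move=> x0 t01; have := orlicz_convex x0 (lexx 0) t01.
by rewrite (orlicz0 psiO) !mulr0 !addr0.
Qed.

Lemma orlicz_nondecreasing x y : 0 <= x -> x <= y -> psi x <= psi y.
Proof.
move=> x0 xy; have y0 := le_trans x0 xy.
have [y_0|yn0] := eqVneq y 0.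
  by rewrite (_ : x = y)//; apply/eqP; rewrite eq_le xy y_0 x0.
have ygt0 : 0 < y by rewrite lt_neqAle eq_sym yn0.
rewrite -[x](mulfVK yn0).
have xy1 : 0 <= x / y <= 1 by rewrite divr_ge0// ler_pdivrMr// mul1r.
apply: le_trans (orlicz_contract y0 xy1) _.
by rewrite ler_piMl ?(orlicz_ge0 psiO)//; case/andP: xy1.
Qed.

(** The slope is the supremum of the slopes of chords ending at a; the chord from 0 shows that it is
    nonnegative. Jensen's inequality is applied in this form. *)
Lemma orlicz_supporting_line a : 0 <= a -> exists2 k, 0 <= k &
  forall x, 0 <= x -> psi a + k * (x - a) <= psi x.
Proof.
move=> a0; have [->|an0] := eqVneq a 0.
  by exists 0 => // x x0; rewrite (orlicz0 psiO) mul0r addr0 (orlicz_ge0 psiO).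
have agt0 : 0 < a by rewrite lt_neqAle eq_sym an0.
have slopes x y : 0 <= x -> x < a -> a < y ->
    (psi a - psi x) / (a - x) <= (psi y - psi a) / (y - a).
  move=> x0 xa ay; have yx : 0 < y - x by rewrite subr_gt0 (lt_trans xa).
  rewrite ler_pdivrMr ?subr_gt0// mulrAC ler_pdivlMr ?subr_gt0//.
  have t01 : 0 <= (y - a) / (y - x) <= 1.
    apply/andP; split; first by apply: divr_ge0; rewrite ?subr_ge0 ltW// -subr_gt0.
    by rewrite ler_pdivrMr// mul1r lerD2l lerN2 ltW.
  have := orlicz_convex x0 (ltW (le_lt_trans a0 ay)) t01.
  have -> : (y - a) / (y - x) * x + (1 - (y - a) / (y - x)) * y = a.
    by field; rewrite gt_eqF.
  have -> : (y - a) / (y - x) * psi x + (1 - (y - a) / (y - x)) * psi y =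
     ((y - a) * psi x + (a - x) * psi y) / (y - x) by field; rewrite gt_eqF.
  by rewrite ler_pdivlMr//; lra.
pose S : set R := [set (psi a - psi x) / (a - x) | x in [set x | 0 <= x < a]].
have ubS y : a < y -> ubound S ((psi y - psi a) / (y - a)).
  by move=> ay _ [x /andP[x0 xa] <-]; exact: slopes.
have aa1 : a < a + 1 by rewrite ltrDl.
have supS : has_sup S.
  split; first by exists ((psi a - psi 0) / (a - 0)), 0; rewrite //= lexx.
  by exists ((psi (a + 1) - psi a) / (a + 1 - a)); exact: ubS.
have supge x : 0 <= x -> x < a -> (psi a - psi x) / (a - x) <= sup S.
  by move=> x0 xa; apply: ub_le_sup; [case: supS|exists x; rewrite //= x0].
exists (sup S).
  apply: le_trans (supge 0 (lexx 0) agt0).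
  by rewrite (orlicz0 psiO) !subr0 divr_ge0// (orlicz_ge0 psiO).
move=> x x0; have [xa|ax|->] := ltgtP x a; last by rewrite subrr mulr0 addr0.
  by have := supge x x0 xa; rewrite ler_pdivrMr ?subr_gt0//; lra.
have : sup S <= (psi x - psi a) / (x - a) by apply: ge_sup; [case: supS|exact: ubS].
by rewrite ler_pdivlMr ?subr_gt0//; lra.
Qed.

Lemma measurable_orlicz d (T : measurableType d) (D : set T) (h : T -> R) (C : R) :
  0 < C -> (forall t, 0 <= h t) -> measurable_fun D h ->
  measurable_fun D (fun t => psi (h t / C)).
Proof.
move=> C0 h0 mh.
(* Monotonicity of psi is known on nonnegative reals; freezing it at psi(0) to the left makes a
   monotone, hence measurable, function. *)
pose psi' x := psi (Num.max 0 x).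
have mpsi : measurable_fun setT psi'.
  apply: nondecreasing_measurable => // x y xy; apply: orlicz_nondecreasing.
    by rewrite le_max lexx.
  by rewrite ge_max !le_max lexx/= xy orbT.
rewrite (_ : (fun _ => _) = psi' \o (fun t => h t * C^-1)).
  by apply: measurableT_comp => //; exact: measurable_funM.
by apply/funext => t; rewrite /psi'/= max_r// divr_ge0// ltW.
Qed.

End Orlicz.

(** * Averaging over rotations and sub-mean values *)

Section Averaging.
Local Open Scope complex_scope.
Context {R : realType} {N : nat}.
Local Notation T := (measurableTypeR R).
Local Notation CN := 'rV[R[i]]_N.
Local Notation R2N := ((N + N).-tuple T).
Local Notation lam := (lebesgue_Rn R (N + N)).
Local Notation rotc theta := (@rot R N predT (cos theta) (sin theta)).

Lemma limn_einf_ge (u : nat -> \bar R) (a : \bar R) :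
  (\forall n \near \oo, (a <= u n)%E) -> (a <= limn_einf u)%E.
Proof.
move=> [m _ hm]; rewrite limn_einf_lim; apply: lime_ge; first exact: is_cvg_einfs.
exists m => // k /= mk; apply: le_ereal_inf_tmp => _ [p /= kp] <-.
by apply: hm; exact: leq_trans kp.
Qed.

Lemma ereal_mean_cst n (I : \bar R) : (0 < n)%N ->
  ((n%:R^-1)%:E * \sum_(k < n) I = I)%E.
Proof.
move=> n0; have -> : (\sum_(k < n) I = n%:R%:E * I)%E.
  elim: n {n0} => [|n IH]; first by rewrite big_ord0 mul0e.
  by rewrite big_ord_recr/= IH -natr1 EFinD ge0_muleDl// mul1e.
by rewrite muleA -EFinM mulVf ?mul1e// pnatr_eq0 -lt0n.
Qed.

(** By rotation invariance, each finite average of rotates of [F], weighted by [w], has the same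
    integral as [F] times [w]. Pointwise the lower limit of these averages is at least m w, and
    Fatou's lemma concludes. *)
Lemma rotation_mean (A : set R2N) (w F : R2N -> R) (m : R) :
  measurable A -> (forall theta t, A (rotc theta t) <-> A t) ->
  measurable_fun A w -> measurable_fun A F ->
  (forall t, 0 <= w t) -> (forall t, A t -> 0 <= F t) -> 0 <= m ->
  (forall theta t, w (rotc theta t) = w t) ->
  (forall t, A t -> forall e : R, 0 < e -> \forall j \near \oo, m - e <=
    2 ^- j * \sum_(k < 2 ^ j) F (rotc (pi *+ 2 * (k%:R / 2 ^+ j)) t)) ->
  (\int[lam]_(t in A) (m * w t)%:E <= \int[lam]_(t in A) (F t * w t)%:E)%E.
Proof.
move=> mA rA mw mF w0 F0 m0 rw hF.
have mFr theta : measurable_fun A (F \o rotc theta).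
  apply: (measurable_comp mA) => //; first by move=> _ [t At <-]; apply/rA.
  by apply: measurable_funTS; have [] := @lpres_cis R N theta.
pose I := (\int[lam]_(t in A) (F t * w t)%:E)%E.
pose f j (t : R2N) := (((2 ^ j)%:R^-1)%:E * \sum_(k < 2 ^ j)
  (F (rotc (pi *+ 2 * (k%:R / 2 ^+ j)) t) * w t)%:E)%E.
have mf1 theta : measurable_fun A (fun t => (F (rotc theta t) * w t)%:E).
  by apply/measurable_EFinP; apply: measurable_funM => //; exact: mFr.
have f10 theta t : A t -> (0 <= (F (rotc theta t) * w t)%:E)%E.
  by move=> At; rewrite lee_fin mulr_ge0// F0//; apply/rA.
have mf2 j : measurable_fun A (fun t => (\sum_(k < 2 ^ j)
  (F (rotc (pi *+ 2 * (k%:R / 2 ^+ j)) t) * w t)%:E)%E).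
  by apply: emeasurable_sum => k; exact: mf1.
have f20 j t : A t -> (0 <= \sum_(k < 2 ^ j)
  (F (rotc (pi *+ 2 * (k%:R / 2 ^+ j)) t) * w t)%:E)%E.
  by move=> At; apply: sume_ge0 => k _; exact: f10.
have fI j : (\int[lam]_(t in A) f j t = I)%E.
  rewrite ge0_integralZl//; last by move=> t; exact: f20.
  rewrite ge0_integral_sum//; last by move=> k t; exact: f10.
  rewrite -[RHS](@ereal_mean_cst (2 ^ j)) ?expn_gt0//; congr (_ * _)%E.
  apply: eq_bigr => k _; set theta := pi *+ 2 * _.
  have AE : rotc theta @^-1` A = A by apply/seteqP; split => t h; apply/(rA theta).
  rewrite /I -(lpres_integral (@lpres_cis R N theta))//.
  - by rewrite AE; apply: eq_integral => t _; rewrite rw.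
  - by apply/measurable_EFinP; exact: measurable_funM.
  - by move=> t At; rewrite lee_fin mulr_ge0// F0.
have f0 j t : A t -> (0 <= f j t)%E.
  by move=> At; rewrite mule_ge0 ?f20// lee_fin invr_ge0.
have mf j : measurable_fun A (f j).
  by apply: measurable_funeM; exact: mf2.
apply: (@le_trans _ _ (\int[lam]_(t in A) limn_einf (f ^~ t))%E).
  apply: ge0_le_integral => //.
  - by move=> t _; rewrite lee_fin mulr_ge0.
  - by apply/measurable_EFinP; exact: measurable_funM.
  - rewrite (_ : (fun t => _) = (fun t => - limn_esup (fun j => - f j t))%E).
      apply: measurableT_comp => //; apply: measurable_fun_limn_esup => j.
      exact: measurableT_comp.
    apply/funext => t; rewrite -limn_einfN; congr limn_einf.
    by apply/funext => j /=; rewrite oppeK.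
  move=> t At; apply/lee_addgt0Pr => e e0.
  (* The tolerance is later multiplied by w(t), and e w / (w + 1) <= e. *)
  have e' : 0 < e / (w t + 1) by rewrite divr_gt0// ltr_wpDl.
  rewrite -leeBlDr// -EFinB; apply: limn_einf_ge.
  have [J _ hJ] := hF t At _ e'.
  exists J => // j /hJ {}hJ; rewrite /f sumEFin -EFinM lee_fin.
  rewrite -mulr_suml mulrA natrX.
  apply: le_trans (ler_wpM2r (w0 t) hJ).
  rewrite mulrBl lerD2l lerN2 mulrAC ler_pdivrMr ?ltr_wpDl//.
  by rewrite ler_pM2l// lerDl.
apply: le_trans (fatou lam mA mf f0) _.
rewrite (_ : (fun n => _) = cst I); last by apply/funext => j; exact: fI.
by have [-> _] := @cvg_limn_einf_sup R (cst I) I (cvg_cst I).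
Qed.

Lemma differentiable_near (f : CN -> R[i]) (z : CN) : differentiable f z ->
  forall e : R, 0 < e -> exists2 d : R, 0 < d &
    forall z' : CN, (forall j, modulus (z' 0 j - z 0 j) < d) -> modulus (f z' - f z) < e.
Proof.
move=> /differentiable_continuous cf e e0.
have e0c : 0 < e%:C :> R[i] by rewrite ltcR.
have /cvgrPdist_lt /(_ _ e0c) := cf; move=> /nbhs_ballP [d /= d0 hd].
have := d0; rewrite ltcE/= => /andP[/eqP dI dR].
exists (complex.Re d) => // z' hz'.
have /hd : ball z d z'.
  split => // i j; rewrite ord1 /ball/= modulus_normE ltcE/= dI eqxx/= modulusBC.
  exact: hz'.
by rewrite /= modulus_normE ltcR modulusBC.
Qed.

(** The 1-Lipschitz [h] stands for the modulus, the real part or the imaginary part. *)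
Lemma measurable_holomorphic (D : set R2N) (f : CN -> R[i]) (p : CN) (h : R[i] -> R) :
  (forall x y, `|h x - h y| <= modulus (x - y)) ->
  (forall t, D t -> differentiable f (p + point_of_coords t)) ->
  measurable_fun D (fun t => h (f (p + point_of_coords t))).
Proof.
move=> hh df; apply: measurable_pointwise_continuous => t Dt e e0.
have [d d0 hd] := differentiable_near (df t Dt) e0.
exists (d / 2) => [|u hu]; first by rewrite divr_gt0.
apply: le_lt_trans (hh _ _) (hd _ _) => j.
rewrite !mxE opprD addrACA subrr add0r.
apply: le_lt_trans (modulus_le_ReIm _) _ => /=.
have := hu (lshift N j); have := hu (rshift N j); lra.
Qed.

Lemma modulus_lipschitz (x y : R[i]) : `|modulus x - modulus y| <= modulus (x - y).
Proof.
rewrite ler_norml; have := modulusD (x - y) y; have := modulusD (y - x) x.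
by rewrite !subrK (modulusBC y x); lra.
Qed.

(** The mean value property on each complex line through p, whose circles are orbits of the
    rotations, fed into [rotation_mean] with weight 1. *)
Lemma submean_modulus (f : CN -> R[i]) (p : CN) (r2 : R) :
  (forall w, sqnorm w < r2 -> differentiable f (p + w)) ->
  (\int[lam]_(t in sqball r2) (modulus (f p))%:E <=
   \int[lam]_(t in sqball r2) (modulus (f (p + point_of_coords t)))%:E)%E.
Proof.
move=> df.
have := @rotation_mean (sqball r2) (fun=> 1)
  (fun t => modulus (f (p + point_of_coords t))) (modulus (f p)).
rewrite (eq_integral (fun=> (modulus (f p))%:E)); last by move=> t _; rewrite mulr1.
have -> : (\int[lam]_(t in sqball r2) (modulus (f (p + point_of_coords t)))%:E =
    \int[lam]_(t in sqball r2) (modulus (f (p + point_of_coords t)) * 1)%:E)%E.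
  by apply: eq_integral => t _; rewrite mulr1.
apply => //; rewrite ?modulus_ge0//.
- exact: measurable_sqball.
- by move=> theta t; rewrite /sqball/= sq_rot.
- by apply: measurable_holomorphic; [exact: modulus_lipschitz|move=> t; exact: df].
- by move=> t _; exact: modulus_ge0.
- move=> t tr e e0; pose g (l : R[i]) := f (l *: point_of_coords t + p).
  have dg l : modulus l <= 1 -> cdiff g l.
    move=> l1; apply: differentiable_cdiff; apply: differentiable_slice.
    rewrite addrC; apply: df; rewrite sqnormZ; apply: le_lt_trans tr.
    by rewrite ler_piMl ?sqnorm_ge0// expr_le1// modulus_ge0.
  have [J _ hJ] := mean_value dg e0; exists J => // j /hJ {}hJ.
  have -> : f p = g 0 by rewrite /g scale0r add0r.
  have h : modulus (g 0) - e <= modulus (root_avg g j).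
    by move: hJ; rewrite modulusBC => hJ; have := modulusD (g 0 - root_avg g j) (root_avg g j); rewrite subrK /=; move: hJ => /=; lra.
  apply: (le_trans h); rewrite /root_avg modulusM modulusR gtr0_norm ?invr_gt0 ?exprn_gt0//.
  rewrite ler_pM2l ?invr_gt0 ?exprn_gt0//; apply: le_trans (modulus_sum _ _ _) _.
  by apply: ler_sum => k _; rewrite point_of_coords_rot /g addrC.
Qed.

(** Jensen's inequality: integrate the supporting line of psi at |f(p)| / C over the ball and apply
    [submean_modulus] to its linear part, whose slope is nonnegative. A translation then centres the
    ball at p. *)
Lemma submean_orlicz (psi : R -> R) (f : CN -> R[i]) (p : CN) (r C : R) :
  orlicz_function psi -> 0 < C -> 0 < r ->
  (forall w, sqnorm w < r ^+ 2 -> differentiable f (p + w)) ->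
  ((psi (modulus (f p) / C) * (r ^+ (N + N) * @vball R N))%:E <=
   \int[lam]_(t in [set t | (sqnorm (point_of_coords t - p) < r ^+ 2)%R])
     (psi (modulus (f (point_of_coords t)) / C))%:E)%E.
Proof.
move=> psiO C0 r0 df.
pose a t := modulus (f (p + point_of_coords t)) / C : R.
pose B : set R2N := sqball (r ^+ 2).
have a0 t : 0 <= a t by rewrite divr_ge0 ?modulus_ge0// ltW.
have mB : measurable B by exact: measurable_sqball.
have mfm : measurable_fun B (fun t => modulus (f (p + point_of_coords t))).
  by apply: measurable_holomorphic; [exact: modulus_lipschitz|move=> t; exact: df].
have ma : measurable_fun B a by exact: measurable_funM.
have mpa : measurable_fun B (fun t => psi (a t)).
  by apply: measurable_orlicz => // t; exact: modulus_ge0.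
pose V := r ^+ (N + N) * @vball R N : R.
have VE : lam B = V%:E by exact: lebesgue_sqball.
have V0 : 0 <= V by rewrite mulr_ge0 ?exprn_ge0 ?(ltW r0)// ltW// vball_gt0.
pose x0 := modulus (f p) / C.
have x00 : 0 <= x0 by rewrite divr_ge0 ?modulus_ge0// ltW.
have [k k0 hk] := orlicz_supporting_line psiO x00.
have main : ((psi x0 * V)%:E <= \int[lam]_(t in B) (psi (a t))%:E)%E.
  (* Adding k x0 V to both sides turns the supporting line inequality into psi(x0) + k a <= psi(a) +
     k x0, whose terms are all nonnegative. *)
  rewrite -(@leeD2rE _ (k * x0 * V)%:E)// -EFinD.
  have -> : (\int[lam]_(t in B) (psi (a t))%:E + (k * x0 * V)%:E =
      \int[lam]_(t in B) (psi (a t) + k * x0)%:E)%E.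
    under [RHS]eq_integral do rewrite EFinD.
    rewrite ge0_integralD//.
    - by rewrite (integral_cst _ mB) [X in (_ * X)%E]VE.
    - by move=> t _; rewrite lee_fin (orlicz_ge0 psiO).
    - exact/measurable_EFinP.
    - by move=> t _; rewrite lee_fin mulr_ge0.
  apply: (@le_trans _ _ (\int[lam]_(t in B) (psi x0 + k * a t)%:E)%E); last first.
    apply: ge0_le_integral => //.
    - move=> t _; rewrite lee_fin; apply: addr_ge0; first exact: (orlicz_ge0 psiO).
      exact: mulr_ge0.
    - by apply/measurable_EFinP; apply: measurable_funD => //; exact: measurable_funM.
    - by apply/measurable_EFinP; exact: measurable_funD.
    - by move=> t _; rewrite lee_fin; have := hk (a t) (a0 t); lra.
  under eq_integral do rewrite EFinD.
  rewrite ge0_integralD//; last 3 first.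
  - by move=> t _; rewrite lee_fin (orlicz_ge0 psiO).
  - by move=> t _; rewrite lee_fin mulr_ge0.
  - by apply/measurable_EFinP; exact: measurable_funM.
  rewrite (integral_cst _ mB) [X in (_ * X + _)%E]VE EFinD leeD2lE//.
  under eq_integral do rewrite /a mulrCA mulrC EFinM.
  rewrite ge0_integralZl//; last 3 first.
  - exact/measurable_EFinP.
  - by move=> t _; rewrite lee_fin modulus_ge0.
  - by rewrite lee_fin divr_ge0// ltW.
  have := submean_modulus df; rewrite (integral_cst _ mB) [X in (_ * X <= _)%E]VE => sm.
  apply: le_trans (lee_wpmul2l _ sm); last by rewrite lee_fin divr_ge0// ltW.
  by rewrite -!EFinM lee_fin /x0 le_eqVlt; apply/orP; left; apply/eqP; ring.
apply: le_trans main _.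
pose D : set R2N := [set t | (sqnorm (point_of_coords t - p) < r ^+ 2)%R].
have pE t : point_of_coords (tadd (coords p) t) = p + point_of_coords t.
  by rewrite point_of_coordsD coordsK.
have BD : B = tadd (coords p) @^-1` D.
  by apply/seteqP; split => t; rewrite /B /D /sqball/= pE addrAC subrr add0r.
have tr := lpres_translation (coords p).
have tr' := lpres_translation (coords (- p)).
have pE' t : point_of_coords (tadd (coords (- p)) t) = point_of_coords t - p.
  by rewrite point_of_coordsD coordsK addrC.
have DB : D = tadd (coords (- p)) @^-1` B.
  by apply/seteqP; split => t; rewrite /B /D /sqball/= /sq pE'.
have mD : measurable D.
  by rewrite DB -[X in measurable X]setTI; apply: (tr'.1).
rewrite -/D BD le_eqVlt; apply/orP; left; apply/eqP.
rewrite -(lpres_integral tr mD).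
- by apply: eq_integral => t _; rewrite /a pE.
- apply/measurable_EFinP; apply: measurable_orlicz => // [t|]; first exact: modulus_ge0.
  have := @measurable_holomorphic D f 0 modulus modulus_lipschitz.
  under eq_fun do rewrite add0r; apply => t Dt.
  by rewrite add0r -(subrK p (point_of_coords t)) addrC; apply: df.
- by move=> t _; rewrite lee_fin (orlicz_ge0 psiO)// divr_ge0 ?modulus_ge0// ltW.
Qed.

End Averaging.

(** * Modulars and the Delta2 case *)

Section Modular.
Local Open Scope complex_scope.
Context {R : realType} {N : nat} (alpha : R) (psi : R -> R) (psiO : orlicz_function psi).
Local Notation T := (measurableTypeR R).
Local Notation CN := 'rV[R[i]]_N.
Local Notation R2N := ((N + N).-tuple T).
Local Notation lam := (lebesgue_Rn R (N + N)).
Local Notation D := (@sqball R N 1).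

(** The integral against v_alpha without its constants, which are collected in [normalization]. *)
Definition weighted (h : CN -> R) : \bar R :=
  (\int[lam]_(t in D) (weight alpha t * h (point_of_coords t))%:E)%E.

Lemma weighted_ge0 (h : CN -> R) : (forall z, 0 <= h z) -> (0 <= weighted h)%E.
Proof.
by move=> h0; apply: integral_ge0 => t _; rewrite lee_fin mulr_ge0// weight_ge0.
Qed.

Lemma le_weighted (h g : CN -> R) : (forall z, 0 <= h z) ->
  measurable_fun D (h \o @point_of_coords R N) ->
  measurable_fun D (g \o @point_of_coords R N) ->
  (forall z, unit_ball z -> h z <= g z) -> (weighted h <= weighted g)%E.
Proof.
move=> h0 mh mg hg; apply: ge0_le_integral.
- exact: measurable_sqball.
- by move=> t _; rewrite lee_fin mulr_ge0// weight_ge0.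
- by apply/measurable_EFinP; apply: measurable_funM => //; exact: measurable_weight.
- by apply/measurable_EFinP; apply: measurable_funM => //; exact: measurable_weight.
- by move=> t Dt; rewrite lee_fin ler_wpM2l ?weight_ge0// hg.
Qed.

Lemma weightedZ (c : R) (h : CN -> R) : 0 <= c -> (forall z, 0 <= h z) ->
  measurable_fun D (h \o @point_of_coords R N) ->
  weighted (fun z => c * h z) = (c%:E * weighted h)%E.
Proof.
move=> c0 h0 mh; rewrite /weighted.
under eq_integral do rewrite mulrCA EFinM.
rewrite ge0_integralZl//.
- exact: measurable_sqball.
- by apply/measurable_EFinP; apply: measurable_funM => //; exact: measurable_weight.
- by move=> t _; rewrite lee_fin mulr_ge0// weight_ge0.
Qed.

Lemma c_alpha_ge0 : 0 <= c_alpha N alpha.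
Proof.
rewrite /c_alpha invr_ge0 fine_ge0// mule_ge0 ?lee_fin ?invr_ge0 ?fine_ge0//.
by apply: integral_ge0 => t _; rewrite lee_fin powR_ge0.
Qed.

Definition normalization : R :=
  (fine (lam (@coord_ball R N)))^-1 * c_alpha N alpha.

Lemma normalization_ge0 : 0 <= normalization.
Proof. by apply: mulr_ge0 c_alpha_ge0; rewrite invr_ge0 fine_ge0. Qed.

Lemma int_v_alphaE (h : CN -> R) : (forall z, 0 <= h z) ->
  measurable_fun D (h \o @point_of_coords R N) ->
  int_v_alpha alpha (fun z => (h z)%:E) = (normalization%:E * weighted h)%E.
Proof.
move=> h0 mh; rewrite /int_v_alpha /int_v /normalization EFinM -muleA; congr (_ * _)%E.
have c0 := c_alpha_ge0.
rewrite /weighted -ge0_integralZl//.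
- by apply: eq_integral => t _; rewrite -!EFinM mulrA.
- exact: measurable_sqball.
- by apply/measurable_EFinP; apply: measurable_funM => //; exact: measurable_weight.
- by move=> t _; rewrite lee_fin mulr_ge0// weight_ge0.
Qed.

Lemma measurable_psi_holomorphic (f : CN -> R[i]) (C : R) : 0 < C ->
  holomorphic_on_ball f ->
  measurable_fun D ((fun z => (psi (modulus (f z) / C))%R) \o @point_of_coords R N).
Proof.
move=> C0 hf; apply: measurable_orlicz => // [t|]; first exact: modulus_ge0.
have := @measurable_holomorphic R N D f 0 modulus (@modulus_lipschitz R).
by under eq_fun do rewrite add0r; apply => t Dt; rewrite add0r; exact: hf.
Qed.

Lemma psi_modulus_ge0 (f : CN -> R[i]) (C : R) z : 0 < C -> 0 <= psi (modulus (f z) / C).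
Proof. by move=> C0; rewrite (orlicz_ge0 psiO)// divr_ge0 ?modulus_ge0// ltW. Qed.

Lemma orlicz_modularE (f : CN -> R[i]) (C : R) : 0 < C -> holomorphic_on_ball f ->
  orlicz_modular alpha psi C f =
  (normalization%:E * weighted (fun z => (psi (modulus (f z) / C))%R))%E.
Proof.
move=> C0 hf; apply: int_v_alphaE => [z|]; first exact: psi_modulus_ge0.
exact: measurable_psi_holomorphic.
Qed.

Lemma orlicz_modular_ge0 (f : CN -> R[i]) (C : R) : 0 < C -> holomorphic_on_ball f ->
  (0 <= orlicz_modular alpha psi C f)%E.
Proof.
move=> C0 hf; rewrite orlicz_modularE// mule_ge0 ?lee_fin ?normalization_ge0//.
by apply: weighted_ge0 => z; exact: psi_modulus_ge0.
Qed.

(** Convexity and psi(0) = 0 give psi(x / B) <= psi(x) / B. A modular bounded by B at C is therefore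
    at most 1 at B C. *)
Lemma orlicz_modular_contract (f : CN -> R[i]) (C B : R) : 0 < C -> 1 <= B ->
  holomorphic_on_ball f ->
  (orlicz_modular alpha psi (B * C) f <= (B^-1)%:E * orlicz_modular alpha psi C f)%E.
Proof.
move=> C0 B1 hf; have B0 : 0 < B by exact: lt_le_trans B1.
have BC0 : 0 < B * C by exact: mulr_gt0.
rewrite !orlicz_modularE// muleCA lee_wpmul2l ?lee_fin ?normalization_ge0//.
rewrite -weightedZ ?invr_ge0 ?(ltW B0)//; last 2 first.
- by move=> z; exact: psi_modulus_ge0.
- exact: measurable_psi_holomorphic.
apply: le_weighted => [z|||z _].
- exact: psi_modulus_ge0.
- exact: measurable_psi_holomorphic.
- by apply: measurable_funM => //; exact: measurable_psi_holomorphic.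
rewrite invfM mulrCA; apply: orlicz_contract => //.
  by rewrite divr_ge0 ?modulus_ge0// ltW.
by rewrite invr_ge0 (ltW B0) invf_le1.
Qed.

(** Multiplication by [M] maps the constants admissible for f to constants admissible for A f, so
    the infima compare. The admissible set of a function of the space is nonempty: a finite modular
    x at C drops to at most 1 at (x + 1) C. *)
Lemma bounded_of_modular (A : (CN -> R[i]) -> (CN -> R[i])) (M : R) : 0 < M ->
  (forall f, holomorphic_on_ball f -> holomorphic_on_ball (A f)) ->
  (forall f C, holomorphic_on_ball f -> 0 < C ->
    (orlicz_modular alpha psi C f <= 1)%E ->
    (orlicz_modular alpha psi (M * C) (A f) <= 1)%E) ->
  bounded_on_bergman_orlicz alpha psi A.
Proof.
move=> M0 hA AM.
pose S (f : CN -> R[i]) : set R := [set C : R | 0 < C /\ (orlicz_modular alpha psi C f <= 1)%E].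
have S0 f : bergman_orlicz alpha psi f -> S f !=set0.
  move=> [hf [C [C0 fin]]].
  have m0 := orlicz_modular_ge0 C0 hf.
  move: fin m0; case E : (orlicz_modular alpha psi C f) => [x| |] // _; rewrite lee_fin => x0.
  have B1 : 1 <= x + 1 by rewrite lerDr.
  exists ((x + 1) * C); split; first by rewrite mulr_gt0// (lt_le_trans _ B1).
  apply: le_trans (orlicz_modular_contract C0 B1 hf) _.
  rewrite E -EFinM lee_fin mulrC ler_pdivrMr ?(lt_le_trans _ B1)//.
  by rewrite mul1r lerDl.
have SA f C : holomorphic_on_ball f -> S f C -> S (A f) (M * C).
  by move=> hf [C0 fC]; split; [exact: mulr_gt0|exact: AM].
split=> [f bf|].
  have [C SC] := S0 _ bf; have hf := bf.1.
  split; first exact: hA.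
  have [MC0 h] := SA _ _ hf SC.
  by exists (M * C); split => //; apply: le_lt_trans h _; rewrite ltry.
exists M => f bf; have hf := bf.1.
rewrite /luxemburg_norm -/(S f) -/(S (A f)) mulrC -ler_pdivrMr//.
apply: lb_le_inf; first exact: S0.
move=> C SC; rewrite ler_pdivrMr// mulrC.
apply: ge_inf; last exact: SA.
by exists 0 => x [x0 _]; exact: ltW.
Qed.

End Modular.

(** * Growth of functions with bounded modular *)

Section PointwiseBound.
Local Open Scope complex_scope.
Context {R : realType} {N : nat}.
Local Notation CN := 'rV[R[i]]_N.
Local Notation R2N := ((N + N).-tuple (measurableTypeR R)).
Local Notation lam := (lebesgue_Rn R (N + N)).
Local Notation D := (@sqball R N 1).

(** Young's inequality with weights d / 4 and 4 / d on each coordinate, d = 1 - |p|^2. With |h| <= d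
    / 5 it leaves 1 - |p + h|^2 >= 0.59 d. *)
Lemma sqnorm_near (p h : CN) : 0 < 1 - sqnorm p ->
  sqnorm h <= ((1 - sqnorm p) / 5) ^+ 2 -> (1 - sqnorm p) / 2 <= 1 - sqnorm (p + h).
Proof.
move=> d0 hh; set d := 1 - sqnorm p in d0 hh *.
have d1 : d <= 1 by rewrite gerBl sqnorm_ge0.
have : sqnorm (p + h) <= (1 + d / 4) * sqnorm p + (1 + 4 / d) * sqnorm h.
  rewrite /sqnorm !mulr_sumr -big_split/=; apply: ler_sum => j _; rewrite mxE.
  set x := modulus (p 0 j); set y := modulus (h 0 j).
  apply: (@le_trans _ _ ((x + y) ^+ 2)).
    by rewrite ler_pXn2r ?nnegrE ?addr_ge0 ?modulus_ge0// modulusD.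
  have -> : (1 + d / 4) * x ^+ 2 + (1 + 4 / d) * y ^+ 2 =
    (x + y) ^+ 2 + (d * x / 2 - 2 * y) ^+ 2 / d by field; rewrite gt_eqF.
  by rewrite lerDl divr_ge0 ?sqr_ge0// ltW.
move=> le1.
have : (1 + 4 / d) * sqnorm h <= (1 + 4 / d) * (d / 5) ^+ 2.
  by rewrite ler_wpM2l// addr_ge0// divr_ge0// ltW.
have -> : (1 + 4 / d) * (d / 5) ^+ 2 = d ^+ 2 / 25 + 4 * d / 25 by field; rewrite gt_eqF.
have sp : sqnorm p = 1 - d by rewrite /d; ring.
by move: le1; rewrite sp; nra.
Qed.

(** As 1 - |z|^2 <= 1, raising the exponent a to |a| only decreases the weight; this treats both
    signs of a at once. *)
Lemma weight_lower (a d : R) (t : R2N) : 0 < d -> d <= 1 - sq t -> d `^ `|a| <= weight a t.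
Proof.
move=> d0 dt; have st := sq_ge0 t.
have q0 : 0 < 1 - sq t by exact: lt_le_trans dt.
have q1 : 1 - sq t <= 1 by rewrite gerBl.
apply: (@le_trans _ _ ((1 - sq t) `^ `|a|)).
  by rewrite ge0_ler_powR ?nnegrE ?(ltW d0) ?(ltW q0).
by apply: ger_powR; [rewrite q0|exact: ler_norm].
Qed.

(** The sub-mean value inequality on the ball of radius d / 10 about p, d = 1 - |p|^2: its volume
    gives the exponent 2 N and the lower bound (d / 2)^|alpha| of the weight gives |alpha|.
    Sharpness is immaterial, since the iterated Delta^2-condition absorbs any power. *)
Lemma pointwise_bound (alpha : R) : exists2 K : R, 0 < K &
  forall (psi : R -> R) (f : CN -> R[i]) (C : R) (p : CN), orlicz_function psi ->
    0 < C -> holomorphic_on_ball f -> unit_ball p ->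
    ((psi (modulus (f p) / C))%:E <=
     (K * (1 - sqnorm p) `^ (- ((N + N)%:R + `|alpha|)))%:E *
       weighted alpha (fun z => (psi (modulus (f z) / C))%R))%E.
Proof.
have v0 : 0 < @vball R N by exact: vball_gt0.
(* Radius d / 10 in real dimension 2 N, weight at least (d / 2)^|alpha|, and the volume of the unit
   ball. *)
exists (10 ^+ (N + N) * 2 `^ `|alpha| / @vball R N).
  by rewrite divr_gt0// mulr_gt0 ?exprn_gt0// powR_gt0.
move=> psi f C p psiO C0 hf p1; rewrite /unit_ball/= in p1.
set d := 1 - sqnorm p; have d0 : 0 < d by rewrite subr_gt0.
pose r := d / 10; have r0 : 0 < r by rewrite divr_gt0.
have near w : sqnorm w < r ^+ 2 -> d / 2 <= 1 - sqnorm (p + w).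
  move=> wr; apply: sqnorm_near => //; apply: le_trans (ltW wr) _.
  by rewrite ler_pXn2r ?nnegrE ?(ltW r0) ?divr_ge0 ?(ltW d0)// /r; rewrite -/d; lra.
have nearb w : sqnorm w < r ^+ 2 -> unit_ball (p + w).
  by move=> /near; rewrite /unit_ball/=; lra.
have := submean_orlicz psiO C0 r0 (fun w wr => hf _ (nearb w wr)).
set B := [set t : R2N | _]; set u := psi _; move=> sm.
have mB : measurable B.
  pose tr' := lpres_translation (coords (- p)).
  have -> : B = tadd (coords (- p)) @^-1` sqball (r ^+ 2).
    apply/seteqP; split => t; rewrite /B /sqball/= /sq point_of_coordsD coordsK.
      by rewrite addrC.
    by rewrite addrC.
  by rewrite -[X in measurable X]setTI; apply: (tr'.1) => //; exact: measurable_sqball.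
have BD : B `<=` D by move=> t /nearb; rewrite addrC subrK.
have md : measurable_fun D (fun t => psi (modulus (f (point_of_coords t)) / C)).
  exact: (measurable_psi_holomorphic psiO C0 hf).
have c0 : 0 < (d / 2) `^ `|alpha| by rewrite powR_gt0// divr_gt0.
have u0 t : 0 <= psi (modulus (f (point_of_coords t)) / C).
  by rewrite (orlicz_ge0 psiO)// divr_ge0 ?modulus_ge0// ltW.
set W := weighted _ _.
have h : (((d / 2) `^ `|alpha|)%:E * (u * (r ^+ (N + N) * @vball R N))%:E <= W)%E.
  apply: le_trans (lee_wpmul2l _ sm) _; first by rewrite lee_fin ltW.
  rewrite -ge0_integralZl//; last 3 first.
  - by apply/measurable_EFinP; apply: measurable_funS md => //; exact: measurable_sqball.
  - by move=> t _; rewrite lee_fin u0.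
  - by rewrite lee_fin ltW.
  apply: (@le_trans _ _ (\int[lam]_(t in B)
      (weight alpha t * psi (modulus (f (point_of_coords t)) / C))%:E)%E).
    apply: ge0_le_integral => //.
    - by move=> t _; rewrite -EFinM lee_fin mulr_ge0// ltW.
    - apply: measurable_funeM; apply/measurable_EFinP.
      by apply: measurable_funS md => //; exact: measurable_sqball.
    - apply/measurable_EFinP; apply: measurable_funM; first exact: measurable_weight.
      by apply: measurable_funS md => //; exact: measurable_sqball.
    - move=> t Bt; rewrite -EFinM lee_fin ler_wpM2r// weight_lower ?divr_gt0//.
      by have := near _ Bt; rewrite (addrC p) subrK.
  apply: ge0_subset_integral => //.
  - exact: measurable_sqball.
  - by apply/measurable_EFinP; apply: measurable_funM => //; exact: measurable_weight.
  - by move=> t _; rewrite lee_fin mulr_ge0// weight_ge0.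
rewrite -EFinM in h; set c := _ * (u * _) in h.
have dn0 : d != 0 by rewrite gt_eqF.
have vn0 : @vball R N != 0 by rewrite gt_eqF.
set K := _ * d `^ _.
have K0 : 0 <= K.
  by rewrite mulr_ge0 ?powR_ge0// divr_ge0 ?mulr_ge0 ?exprn_ge0 ?powR_ge0// ltW.
apply: le_trans (lee_wpmul2l _ h); last by rewrite lee_fin.
rewrite -EFinM lee_fin le_eqVlt; apply/orP; left; apply/eqP.
rewrite /K /c powRN powRD; last by rewrite dn0 implybT.
rewrite powR_mulrn ?(ltW d0)// powRM ?(ltW d0)// -[2^-1]powR_inv1// -powRrM.
rewrite mulN1r powRN /r exprMn exprVn.
have : 2 `^ `|alpha| != 0 :> R by rewrite gt_eqF// powR_gt0.
have : d `^ `|alpha| != 0 by rewrite gt_eqF// powR_gt0.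
have : d ^+ (N + N) != 0 by rewrite expf_neq0.
have : (10 : R) ^+ (N + N) != 0 by rewrite expf_neq0.
set x1 := 10 ^+ _; set x2 := d ^+ _; set x3 := d `^ _; set x4 := 2 `^ _.
move=> n1 n2 n3 n4; field.
by rewrite n1 n2 n3 n4 vn0.
Qed.

End PointwiseBound.

(** * The iterated Delta^2-condition and boundedness on the ball *)

Section Delta2.
Local Open Scope complex_scope.
Context {R : realType}.

(** The constant is raised to at least 1 so that multiplication by it does not leave the range x >=
    x0 and the condition can be applied again. *)
Lemma Delta2_iter (psi : R -> R) : orlicz_function psi -> Delta2_condition psi ->
  exists x0 C : R, [/\ 0 < x0, 1 <= C &
    forall l x, x0 <= x -> psi x ^+ (2 ^ l) <= psi (C ^+ l * x)].
Proof.
move=> psiO [x0 [C [x00 C0 h]]]; exists x0, (Num.max 1 C); split => //.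
  by rewrite le_max lexx.
have C1 : 1 <= Num.max 1 C by rewrite le_max lexx.
elim=> [|l IH] x x0x; first by rewrite expr0 expn0 expr1 mul1r.
have xp : 0 <= x by rewrite (le_trans (ltW x00)).
have p0 : 0 <= psi x by exact: (orlicz_ge0 psiO).
have -> : Num.max 1 C ^+ l.+1 * x = Num.max 1 C ^+ l * (Num.max 1 C * x).
  by rewrite exprSr mulrA.
rewrite expnS exprM.
apply: (@le_trans _ _ (psi (Num.max 1 C * x) ^+ (2 ^ l))).
  rewrite ler_pXn2r ?nnegrE ?sqr_ge0 ?expn_gt0//; last first.
    by rewrite (orlicz_ge0 psiO)// mulr_ge0// (le_trans ler01).
  apply: le_trans (h _ x0x) _; apply: orlicz_nondecreasing => //.
    by rewrite mulr_ge0// ltW.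
  by rewrite ler_wpM2r// le_max lexx orbT.
apply: IH.
by rewrite (le_trans x0x)// ler_peMl.
Qed.

Lemma holomorphic_comp N (phi : 'rV[R[i]]_N -> 'rV[R[i]]_N) (f : 'rV[R[i]]_N -> R[i]) :
  holomorphic_self_map phi -> holomorphic_on_ball f -> holomorphic_on_ball (f \o phi).
Proof.
move=> [dphi bphi] hf z z1; apply: differentiable_comp; first exact: dphi.
exact/hf/bphi.
Qed.

Lemma weight_ball_integral N (a : R) : -1 < a -> exists2 K : R, 0 <= K &
  (\int[lebesgue_Rn R (N + N)]_(t in @sqball R N 1) (weight a t)%:E <= K%:E)%E.
Proof.
move=> a1; have [K K0 hK] := @weight_shell_integral R N a a1.
exists K => //; have := hK 1 ltr01; rewrite powR1 mulr1.
suff -> : @shell R N 1 = sqball 1 by [].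
by apply/seteqP; split => t; rewrite /shell /sqball/=; [case|move=> h; split => //; rewrite gerBl sq_ge0].
Qed.

Lemma bounded_composition_Delta2 N (alpha : R) (psi : R -> R)
    (phi : 'rV[R[i]]_N -> 'rV[R[i]]_N) :
  -1 < alpha -> orlicz_function psi -> Delta2_condition psi ->
  holomorphic_self_map phi ->
  bounded_on_bergman_orlicz alpha psi (composition_operator phi).
Proof.
move=> a1 psiO D2 hphi.
have [x0 [C0 [x00 C01 hC0]]] := Delta2_iter psiO D2.
have [K K0 hK] := @pointwise_bound R N alpha.
set E := (N + N)%:R + `|alpha| in hK; have E0 : 0 <= E by rewrite addr_ge0.
set kn := @normalization R N alpha.
have kn0 : 0 <= kn by exact: normalization_ge0.
pose c0 := (1 - sqnorm (phi 0)) / 8.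
have p01 : sqnorm (phi 0) < 1 by apply: hphi.2; rewrite /unit_ball/= sqnorm0.
have c00 : 0 < c0 by rewrite divr_gt0// subr_gt0.
have sp z : unit_ball z -> c0 * (1 - sqnorm z) <= 1 - sqnorm (phi z).
  by move=> z1; have := schwarz_pick hphi z1; rewrite /c0; lra.
(* Then alpha - E / 2^l > -1, so the dominating function is integrable. The number l depends on N
   and alpha only. *)
have [l El] : exists l, E / 2 ^+ l < (1 + alpha) / 2.
  have h : 0 < (1 + alpha) / 2 / (E + 1).
    by apply: divr_gt0; [lra|rewrite ltr_wpDl].
  have /cvgrPdist_lt /(_ _ h) [m _ hm] :
      (fun m => (2^-1 : R) ^+ m) @ \oo --> (0 : R).
    by apply: cvg_expr; rewrite ger0_norm ?invf_lt1// ltr1n.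
  exists m; have := hm m (leqnn m).
  rewrite /= sub0r normrN exprVn ger0_norm// ltr_pdivlMr ?ltr_wpDl//.
  apply: le_lt_trans; rewrite mulrC ler_wpM2l//; lra.
pose ep := E / 2 ^+ l.
have ep0 : 0 <= ep by rewrite divr_ge0// exprn_ge0.
have C0l : 1 <= C0 ^+ l by exact: exprn_ege1.
have C0l0 : 0 < C0 ^+ l by exact: lt_le_trans C0l.
have [I1 I10 hI1] := @weight_ball_integral N alpha a1.
have a2 : -1 < alpha - ep by rewrite /ep; lra.
have [I2 I20 hI2] := @weight_ball_integral N (alpha - ep) a2.
(* Modular at most 1 means [weighted] at most 1 / [kn], and [c0] comes from replacing phi(z) by z.
   The maximum with 1 ensures K2 <= K2^(2^l) when the root is taken. *)
pose K2 := Num.max 1 (K * c0 `^ (- E) / kn).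
have K21 : 1 <= K2 by rewrite le_max lexx.
pose A := kn * (psi x0 * I1 + K2 * I2).
have px0 : 0 <= psi x0 by rewrite (orlicz_ge0 psiO)// ltW.
have A0 : 0 <= A.
  by rewrite mulr_ge0// addr_ge0 ?mulr_ge0// (le_trans ler01).
pose B := Num.max 1 A.
have B1 : 1 <= B by rewrite le_max lexx.
have B0 : 0 < B by exact: lt_le_trans B1.
apply: (@bounded_of_modular R N alpha psi psiO _ (B * C0 ^+ l)).
- exact: mulr_gt0.
- by move=> f; exact: holomorphic_comp.
move=> f C hf C_gt0 fC; have hfp := holomorphic_comp hphi hf.
have CC : 0 < C0 ^+ l * C by exact: mulr_gt0.
rewrite -mulrA; apply: le_trans (orlicz_modular_contract _ psiO CC B1 hfp) _.
suff main : (orlicz_modular alpha psi (C0 ^+ l * C) (f \o phi) <= A%:E)%E.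
  apply: le_trans (lee_wpmul2l _ main) _; first by rewrite lee_fin invr_ge0 ltW.
  by rewrite -EFinM lee_fin mulrC ler_pdivrMr// mul1r le_max lexx orbT.
rewrite orlicz_modularE// -/kn /A [leRHS]EFinM.
have [kn_0|knn0] := eqVneq kn 0; first by rewrite kn_0 !mul0e.
have kngt0 : 0 < kn by rewrite lt_neqAle eq_sym knn0.
rewrite lee_wpmul2l ?lee_fin//.
have bnd z : unit_ball z -> psi (modulus (f (phi z)) / (C0 ^+ l * C)) <=
    psi x0 + K2 * (1 - sqnorm z) `^ (- ep).
  move=> z1; have d0 : 0 < 1 - sqnorm z by rewrite subr_gt0.
  have X20 : 0 <= K2 * (1 - sqnorm z) `^ (- ep).
    by rewrite mulr_ge0 ?powR_ge0// (le_trans ler01).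
  have y0 : 0 <= modulus (f (phi z)) / C by rewrite divr_ge0 ?modulus_ge0// ltW.
  have -> : modulus (f (phi z)) / (C0 ^+ l * C) = modulus (f (phi z)) / C / C0 ^+ l.
    by rewrite invfM mulrA mulrAC.
  set x' := _ / C0 ^+ l; have x'0 : 0 <= x' by rewrite divr_ge0// ltW.
  (* Below [x0] monotonicity gives psi(x0); above it the Delta^2-condition applies. The sum of the
     two bounds covers both cases. *)
  have [xx0|xx0] := leP x0 x'; last first.
    rewrite -[leLHS]addr0 lerD//; apply: orlicz_nondecreasing => //; exact: ltW.
  rewrite -[leLHS]add0r lerD//.
  have := hC0 l _ xx0; rewrite mulrC mulfVK ?gt_eqF// => h1.
  have h2 : psi (modulus (f (phi z)) / C) <= K2 * (1 - sqnorm z) `^ (- E).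
    have := hK psi f C (phi z) psiO C_gt0 hf (hphi.2 z z1).
    move: fC; rewrite orlicz_modularE// -/kn.
    have W0 : (0 <= weighted alpha (fun z => (psi (modulus (f z) / C))%R))%E.
      by apply: weighted_ge0 => w; exact: (psi_modulus_ge0 psiO).
    move: W0; case: weighted => [W| |] //; last first.
      by move=> _; rewrite gt0_muley ?lte_fin.
    rewrite !lee_fin => W0 kW h3; apply: le_trans h3 _.
    have W1 : W <= kn^-1 by rewrite -[leRHS]mul1r ler_pdivlMr// mulrC.
    have d1 : (1 - sqnorm (phi z)) `^ (- E) <= c0 `^ (- E) * (1 - sqnorm z) `^ (- E).
      have cd0 : 0 < c0 * (1 - sqnorm z) by exact: mulr_gt0.
      have dp0 : 0 < 1 - sqnorm (phi z) by exact: lt_le_trans cd0 (sp z z1).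
      rewrite -powRM ?(ltW c00) ?(ltW d0)// !powRN lef_pV2 ?posrE ?powR_gt0//.
      by rewrite ge0_ler_powR ?nnegrE ?(ltW cd0) ?(ltW dp0) ?sp.
    apply: (@le_trans _ _ (K * (c0 `^ (- E) * (1 - sqnorm z) `^ (- E)) * kn^-1)).
      by apply: ler_pM => //; rewrite ?mulr_ge0 ?powR_ge0 ?(ltW K0)// ler_wpM2l// ltW.
    rewrite (_ : _ * _ * _ = K * c0 `^ (- E) / kn * (1 - sqnorm z) `^ (- E)); last by ring.
    by rewrite ler_wpM2r ?powR_ge0// le_max lexx orbT.
  (* The root of order 2^l is taken by contradiction, comparing powers of order 2^l. *)
  rewrite leNgt; apply/negP => lt.
  have : (K2 * (1 - sqnorm z) `^ (- ep)) ^+ (2 ^ l) < psi x' ^+ (2 ^ l).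
    by rewrite ltr_pXn2r ?nnegrE ?expn_gt0// (orlicz_ge0 psiO).
  apply/negP; rewrite -leNgt; apply: (le_trans h1); apply: (le_trans h2).
  rewrite exprMn -[X in _ <= _ * X]powR_mulrn ?powR_ge0// -powRrM.
  have -> : - ep * (2 ^ l)%:R = - E.
    by rewrite /ep natrX mulNr mulfVK// expf_neq0.
  rewrite ler_wpM2r ?powR_ge0// -[leLHS]expr1; apply: ler_weXn2l => //.
  by rewrite expn_gt0.
have mD := @measurable_sqball R N 1.
apply: (@le_trans _ _ (\int[lebesgue_Rn R (N + N)]_(t in @sqball R N 1)
   ((psi x0)%:E * (weight alpha t)%:E + K2%:E * (weight (alpha - ep) t)%:E))%E).
  apply: ge0_le_integral => //.
  - by move=> t _; rewrite lee_fin mulr_ge0 ?weight_ge0// (psi_modulus_ge0 psiO).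
  - apply/measurable_EFinP; apply: measurable_funM; first exact: measurable_weight.
    exact: (measurable_psi_holomorphic psiO CC hfp).
  - apply: emeasurable_funD; apply: measurable_funeM; apply/measurable_EFinP;
      exact: measurable_weight.
  - move=> t Dt; rewrite -!EFinM -EFinD lee_fin.
    apply: (le_trans (ler_wpM2l (weight_ge0 _ _) (bnd _ Dt))).
    have d0 : 0 < 1 - sq t by rewrite subr_gt0.
    rewrite mulrDr mulrC lerD2l mulrCA ler_wpM2l ?(le_trans ler01)//.
    by rewrite /weight powRD// (gt_eqF d0) implybT.
have K20 : 0 <= K2 by exact: le_trans K21.
have mw a : measurable_fun (@sqball R N 1) (fun t => (weight a t)%:E).
  by apply/measurable_EFinP; exact: measurable_weight.
have w0 a (t : (N + N).-tuple (measurableTypeR R)) : @sqball R N 1 t -> (0 <= (weight a t)%:E)%E.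
  by move=> _; rewrite lee_fin weight_ge0.
rewrite ge0_integralD//; last 4 first.
- by move=> t Dt; rewrite mule_ge0 ?lee_fin ?weight_ge0.
- exact: measurable_funeM.
- by move=> t Dt; rewrite mule_ge0 ?lee_fin ?weight_ge0.
- exact: measurable_funeM.
rewrite !ge0_integralZl//; try exact: w0.
by rewrite EFinD !EFinM leeD// lee_wpmul2l// lee_fin.
Qed.

End Delta2.

(** * The disc case *)

Section Disc.
Local Open Scope complex_scope.
Context {R : realType}.
Local Notation T := (measurableTypeR R).
Local Notation C1 := 'rV[R[i]]_1.
Local Notation R2 := ((1 + 1).-tuple T).
Local Notation lam := (lebesgue_Rn R (1 + 1)).
Local Notation D := (@sqball R 1 1).

Lemma sqnorm1 (z : C1) : sqnorm z = modulus (z 0 0) ^+ 2.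
Proof. by rewrite /sqnorm big_ord1. Qed.

Lemma Re_cayley (x : R[i]) : x != 1 ->
  complex.Re ((1 + x) / (1 - x)) = (1 - modulus x ^+ 2) / modulus (1 - x) ^+ 2.
Proof.
rewrite !modulus_sqr; case: x => p q; rewrite eq_complex/= => h.
have n0 : (1 - p) ^+ 2 + (0 - q) ^+ 2 != 0.
  apply/negP => /eqP n0; move/negP: h; apply.
  have p0 : (1 - p) ^+ 2 = 0.
    by apply/eqP; rewrite eq_le sqr_ge0 andbT; have := sqr_ge0 (0 - q); lra.
  have q0 : (0 - q) ^+ 2 = 0.
    by apply/eqP; rewrite eq_le sqr_ge0 andbT; have := sqr_ge0 (1 - p); lra.
  move/eqP: p0; rewrite sqrf_eq0 subr_eq0 eq_sym => ->.
  by move/eqP: q0; rewrite sqrf_eq0 sub0r oppr_eq0 => ->.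
by move: n0; set n := _ + _ => n0; field.
Qed.

Lemma Re_lipschitz (x y : R[i]) : `|complex.Re x - complex.Re y| <= modulus (x - y).
Proof. by apply: le_trans (le_Re_modulus _); case: x y => [a b] [c d]. Qed.

Lemma Im_lipschitz (x y : R[i]) : `|complex.Im x - complex.Im y| <= modulus (x - y).
Proof. by apply: le_trans (le_Im_modulus _); case: x y => [a b] [c d]. Qed.

Lemma ReD (x y : R[i]) : complex.Re (x + y) = complex.Re x + complex.Re y.
Proof. by case: x y => [a b] [c d]. Qed.

Lemma Re_sum I (r : seq I) (P : pred I) (F : I -> R[i]) :
  complex.Re (\sum_(i <- r | P i) F i) = \sum_(i <- r | P i) complex.Re (F i).
Proof. exact: (big_morph _ ReD). Qed.

Lemma Re_scale (a : R) (x : R[i]) : complex.Re (a%:C * x) = a * complex.Re x.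
Proof. by case: x => p q /=; rewrite mul0r subr0. Qed.

(** [rotation_mean] bounds integrals of nonnegative functions from below, so it is applied to B - Re
    H. Subtracting B times the mass of the shell, which is finite, reverses the inequality; B is
    absent from the conclusion. *)
Lemma shell_mean_harmonic (alpha tau : R) (H : C1 -> R[i]) (B : R) :
  -1 < alpha -> 0 < tau -> holomorphic_on_ball H ->
  (forall z, unit_ball z -> 0 <= complex.Re (H z) <= B) ->
  (\int[lam]_(t in shell tau) (complex.Re (H (point_of_coords t)) * weight alpha t)%:E <=
   (complex.Re (H 0))%:E * \int[lam]_(t in shell tau) (weight alpha t)%:E)%E.
Proof.
move=> a1 t0 hH HB.
have [K K0 /(_ _ t0) hK] := @weight_shell_integral R 1 alpha a1.
have mA := @measurable_shell R 1 tau.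
have b0 : unit_ball (0 : C1) by rewrite /unit_ball/= sqnorm0.
have Ab (t : R2) : shell tau t -> unit_ball (point_of_coords t) by case.
have mRe : measurable_fun (shell tau) (fun t : R2 => complex.Re (H (point_of_coords t))).
  have := @measurable_holomorphic R 1 (shell tau) H 0 (@complex.Re R) Re_lipschitz.
  by under eq_fun do rewrite add0r; apply => t /Ab; rewrite add0r; exact: hH.
have mw : measurable_fun (shell tau) (weight alpha : R2 -> R) by exact: measurable_weight.
have mF : measurable_fun (shell tau) (fun t : R2 => B - complex.Re (H (point_of_coords t))).
  exact: measurable_funB.
have B0 : 0 <= B by have /andP[h1 h2] := HB _ b0; exact: le_trans h2.
have := @rotation_mean R 1 (shell tau) (weight alpha)
  (fun t => B - complex.Re (H (point_of_coords t))) (B - complex.Re (H 0)) mA.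
have h1 : forall theta (t : R2), shell tau (rot predT (cos theta) (sin theta) t) <-> shell tau t.
  by move=> theta t; rewrite /shell/= sq_rot.
have h2 : forall t : R2, shell tau t -> 0 <= B - complex.Re (H (point_of_coords t)).
  by move=> t /Ab /HB /andP[_]; rewrite subr_ge0.
have h3 : 0 <= B - complex.Re (H 0) by have /andP[_] := HB _ b0; rewrite subr_ge0.
have h4 : forall theta (t : R2), weight alpha (rot predT (cos theta) (sin theta) t) = weight alpha t.
  by move=> theta t; rewrite /weight sq_rot.
have h5 : forall t : R2, shell tau t -> forall e : R, 0 < e -> \forall j \near \oo,
    B - complex.Re (H 0) - e <= 2 ^- j * \sum_(k < 2 ^ j) (B - complex.Re (H (point_of_coords
      (rot predT (cos (pi *+ 2 * (k%:R / 2 ^+ j))) (sin (pi *+ 2 * (k%:R / 2 ^+ j))) t)))).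
  move=> t At e e0; pose g (l : R[i]) := H (l *: point_of_coords t).
  have dg l : modulus l <= 1 -> cdiff g l.
    move=> l1; apply: differentiable_cdiff.
    have := @differentiable_slice R 1 _ H 0 (point_of_coords t) l.
    under eq_fun do rewrite addr0; apply; rewrite addr0; apply: hH.
    rewrite /unit_ball/= sqnormZ; apply: le_lt_trans (Ab _ At).
    by rewrite ler_piMl ?sqnorm_ge0// expr_le1// modulus_ge0.
  have [J _ hJ] := mean_value dg e0; exists J => // j /hJ /= {}hJ.
  have -> : H 0 = g 0 by rewrite /g scale0r.
  rewrite sumrB sumr_const card_ord mulrBr.
  have -> : 2 ^- j * (B *+ (2 ^ j)) = B.
    by rewrite -[B *+ _]mulr_natl mulrA natrX mulVf ?mul1r// expf_neq0.
  have -> : 2 ^- j * \sum_(k < 2 ^ j) complex.Re (H (point_of_coords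
      (rot predT (cos (pi *+ 2 * (k%:R / 2 ^+ j))) (sin (pi *+ 2 * (k%:R / 2 ^+ j))) t))) =
      complex.Re (root_avg g j).
    rewrite /root_avg Re_scale Re_sum; congr (_ * _).
    by apply: eq_bigr => k _; rewrite point_of_coords_rot.
  have := le_trans (Re_lipschitz _ _) hJ; rewrite ler_norml; lra.
move=> /(_ h1 mw mF (weight_ge0 alpha) h2 h3 h4 h5).
set i := (\int[lam]_(t in shell tau) (weight alpha t)%:E)%E in hK *.
have mwE : measurable_fun (shell tau) (fun t : R2 => (weight alpha t)%:E) by exact/measurable_EFinP.
have iE a : 0 <= a -> (\int[lam]_(t in shell tau) (a * weight alpha t)%:E)%E = (a%:E * i)%E.
  move=> a0; under eq_integral do rewrite EFinM.
  by rewrite ge0_integralZl// => t _; rewrite lee_fin weight_ge0.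
rewrite iE//.
set X := (\int[lam]_(t in _) ((B - _) * _)%:E)%E; set Y := (\int[lam]_(t in _) (_ * _)%:E)%E => mX.
have XY : (X + Y = B%:E * i)%E.
  rewrite -iE// /X /Y -ge0_integralD//.
  - by apply: eq_integral => t _; rewrite -EFinD; congr EFin; ring.
  - by move=> t At; rewrite lee_fin mulr_ge0 ?weight_ge0// h2.
  - by apply/measurable_EFinP; exact: measurable_funM.
  - by move=> t /Ab /HB /andP[H0 _]; rewrite lee_fin mulr_ge0 ?weight_ge0.
  - by apply/measurable_EFinP; exact: measurable_funM.
have i0 : (0 <= i)%E by apply: integral_ge0 => t _; rewrite lee_fin weight_ge0.
have [r r0 ir] : exists2 r, 0 <= r & i = r%:E.
  have fi : i \is a fin_num by rewrite ge0_fin_numE// (le_lt_trans hK)// ltry.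
  by exists (fine i); rewrite ?fine_ge0// fineK.
have : ((B - complex.Re (H 0))%:E * i + Y <= B%:E * i)%E by rewrite -XY leeD2r.
rewrite ir -!EFinM; case: Y {XY} => [y| |] /=.
- by rewrite !lee_fin; lra.
- by rewrite addey// !leye_eq.
- by move=> _; exact: leNye.
Qed.

(** On E the Poisson-type function Re H exceeds 1 / (4 d), d = 1 - |w|^2, so a Chebyshev estimate
    bounds the mass of E by 4 d times the integral of Re H over the shell. That integral is at most
    Re H(0) times a multiple of d^(1 + alpha). *)
Lemma cap_bound (alpha : R) (phi : C1 -> C1) : -1 < alpha -> holomorphic_self_map phi ->
  exists2 K : R, 0 <= K & forall (w : R2) (E : set R2), sq w < 1 -> measurable E ->
  (forall s, E s -> [/\ sq s < 1,
     sqnorm (point_of_coords w - phi (point_of_coords s)) <= ((1 - sq w) / 5) ^+ 2 &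
     1 - sqnorm (phi (point_of_coords s)) <= 2 * (1 - sq w)]) ->
  (\int[lam]_(s in E) (weight alpha s)%:E <= (K * ((1 - sq w) ^+ 2 * weight alpha w))%:E)%E.
Proof.
move=> a1 hphi.
have [Ka Ka0 hKa] := @weight_shell_integral R 1 alpha a1.
have b0 : unit_ball (0 : C1) by rewrite /unit_ball/= sqnorm0.
pose phi0 := phi 0 0 0; pose b := modulus phi0.
have sphi0 : sqnorm (phi 0) = b ^+ 2 by rewrite sqnorm1.
have p01 : sqnorm (phi 0) < 1 by exact: hphi.2.
have b00 : 0 <= b by exact: modulus_ge0.
have b1 : b < 1 by rewrite -(@ltr_pXn2r _ 2) ?nnegrE// expr1n -sphi0.
(* The 8 of [schwarz_pick] times the 2 in the last condition on E. *)
pose c1 := 16 / (1 - sqnorm (phi 0)).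
have c10 : 0 < c1 by rewrite divr_gt0// subr_gt0.
(* Bounds Re H(0) for all w at once: the numerator is at most 1 and |1 - conj(w) phi(0)| >= 1 -
   |phi(0)|. *)
pose B0 := (1 - b) ^- 2.
have B00 : 0 <= B0 by rewrite invr_ge0 sqr_ge0.
exists (4 * B0 * Ka * c1 `^ (1 + alpha)).
  by rewrite !mulr_ge0// powR_ge0.
move=> w E w1 mE hE; set d := 1 - sq w in hE *.
have d0 : 0 < d by rewrite subr_gt0.
have d1 : d <= 1 by rewrite gerBl sq_ge0.
pose om := (point_of_coords w : C1) 0 0; pose a := modulus om.
have sqw : sq w = a ^+ 2 by rewrite /sq sqnorm1.
have a0 : 0 <= a by exact: modulus_ge0.
have a1' : a < 1 by rewrite -(@ltr_pXn2r _ 2) ?nnegrE// expr1n -sqw.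
pose tau := c1 * d; have tau0 : 0 < tau by rewrite mulr_gt0.
pose cay (x : R[i]) := (1 + conjc om * x) / (1 - conjc om * x).
have mox x : modulus x < 1 -> modulus (conjc om * x) < 1.
  move=> x1; rewrite modulusM modulus_conj -/a.
  by have := modulus_ge0 x; nra.
have ox1 x : modulus x < 1 -> conjc om * x != 1.
  by move=> /mox h; apply/eqP => e; move: h; rewrite e modulus1 ltxx.
have oxn x : modulus x < 1 -> 1 - conjc om * x != 0.
  by move=> /ox1; rewrite subr_eq0 eq_sym.
have cayE x : modulus x < 1 -> complex.Re (cay x) =
    (1 - modulus (conjc om * x) ^+ 2) / modulus (1 - conjc om * x) ^+ 2.
  by move=> x1; rewrite Re_cayley// ox1.
have dcay x : modulus x < 1 -> differentiable cay x.
  move=> x1.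
  have dx : differentiable (fun x : R[i] => conjc om * x) x.
    exact: (differentiable_mul (differentiable_const _ _) (differentiable_var _)).
  apply: (@differentiable_mul R (fun x => 1 + conjc om * x) (fun x => (1 - conjc om * x)^-1)).
    apply: differentiableD => //; exact: differentiable_const.
  apply: (@differentiable_inv R (fun x => 1 - conjc om * x)); last exact: oxn.
  exact: (differentiable_sub (differentiable_const _ _) dx).
pose H (z : C1) := cay (phi z 0 0).
have phi1 z : unit_ball z -> modulus (phi z 0 0) < 1.
  move=> /hphi.2; rewrite /unit_ball/= sqnorm1 => h.
  by rewrite -(@ltr_pXn2r _ 2) ?nnegrE ?modulus_ge0// expr1n.
have hH : holomorphic_on_ball H.
  move=> z z1; apply: (@differentiable_comp _ _ _ _ (fun z => phi z 0 0) cay).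
    by apply: differentiable_comp_coord; exact: hphi.1.
  exact/dcay/phi1.
have lower x : modulus x < 1 -> 1 - a <= modulus (1 - conjc om * x).
  move=> x1; apply: le_trans (modulus_1subM _ _); rewrite lerD2l lerN2 -/a.
  by rewrite ler_piMr// ltW.
(* The upper bound degenerates as |w| -> 1, which is harmless because [shell_mean_harmonic] only
   asks that some bound exist. *)
have HB z : unit_ball z -> 0 <= complex.Re (H z) <= 2 / (1 - a).
  move=> /phi1 x1; rewrite /H; set x := phi z 0 0 in x1 *; apply/andP; split.
    rewrite cayE// divr_ge0 ?sqr_ge0// subr_ge0 expr_le1 ?modulus_ge0// ltW//.
    exact: mox.
  apply: le_trans (ler_norm _) _; apply: le_trans (le_Re_modulus _) _.
  rewrite /cay modulusM modulusV.
  apply: ler_pM; rewrite ?invr_ge0 ?modulus_ge0//.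
    by apply: le_trans (modulusD _ _) _; rewrite modulus1; have := mox _ x1; lra.
  by rewrite lef_pV2 ?posrE ?lower// ?(lt_le_trans _ (lower _ x1))// subr_gt0.
have Y := shell_mean_harmonic a1 tau0 hH HB.
have H0 : complex.Re (H 0) <= B0.
  rewrite /H cayE -/phi0; last exact: phi1.
  have h : 1 - b <= modulus (1 - conjc om * phi0).
    apply: le_trans (modulus_1subM _ _); rewrite lerD2l lerN2 -/a -/b.
    by rewrite ler_piMl// ltW.
  rewrite -[B0]mul1r; apply: ler_pM; rewrite ?invr_ge0 ?sqr_ge0//.
  - rewrite subr_ge0 expr_le1 ?modulus_ge0// ltW// mox//; exact: phi1.
  - by rewrite gerBl sqr_ge0.
  - rewrite lef_pV2 ?posrE ?exprn_gt0 ?subr_gt0//.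
      by rewrite ler_pXn2r ?nnegrE ?subr_ge0 ?(ltW b1) ?modulus_ge0.
    by rewrite (lt_le_trans _ h)// subr_gt0.
(* From 1 - conj(w) x = d + conj(w)(w - x) with |w - x| <= d / 5, the denominator is at most (2
   d)^2, and the numerator is at least d. *)
have ReH s : E s -> 1 <= 4 * d * complex.Re (H (point_of_coords s)).
  move=> /hE [s1 h _]; have x1 := phi1 _ s1.
  rewrite /H cayE//; set x := phi _ 0 0 in x1 *.
  have hx : modulus (om - x) <= d / 5.
    rewrite -(@ler_pXn2r _ 2) ?nnegrE ?modulus_ge0 ?divr_ge0 ?(ltW d0)//.
    have -> : om - x = (point_of_coords w - phi (point_of_coords s)) 0 0.
      by rewrite [RHS]mxE [X in _ = _ + X]mxE.
    by rewrite -sqnorm1.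
  have up : modulus (1 - conjc om * x) <= 2 * d.
    have -> : 1 - conjc om * x = d%:C + conjc om * (om - x).
      have oo : conjc om * om = (a ^+ 2)%:C.
        rewrite /a modulus_sqr; case: (om) => p q; apply/eqP.
        by rewrite eq_complex /=; apply/andP; split; apply/eqP; ring.
      by rewrite mulrBr oo /d sqw rmorphB rmorph1; ring.
    apply: le_trans (modulusD _ _) _; rewrite modulusR gtr0_norm// modulusM modulus_conj -/a.
    have := modulus_ge0 (om - x); nra.
  have lo : 0 < modulus (1 - conjc om * x) by rewrite modulus_gt0 oxn.
  have num : d <= 1 - modulus (conjc om * x) ^+ 2.
    rewrite modulusM modulus_conj -/a exprMn /d sqw lerD2l lerN2.
    by rewrite ler_piMr ?sqr_ge0// expr_le1 ?modulus_ge0// ltW.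
  rewrite mulrA ler_pdivlMr ?exprn_gt0// mul1r.
  have : modulus (1 - conjc om * x) ^+ 2 <= (2 * d) ^+ 2.
    by rewrite ler_pXn2r ?nnegrE ?modulus_ge0 ?mulr_ge0 ?(ltW d0).
  move=> h2; apply: le_trans h2 _; nra.
have EA : E `<=` shell tau.
  move=> s Es; have [s1 _ h] := hE _ Es; split => //.
  have := schwarz_pick hphi s1; rewrite -/(sq s) => sp.
  rewrite /tau /c1 mulrAC ler_pdivlMr ?subr_gt0//; lra.
have mA := @measurable_shell R 1 tau.
have mRe : measurable_fun (shell tau) (fun t : R2 => complex.Re (H (point_of_coords t))).
  have := @measurable_holomorphic R 1 (shell tau) H 0 (@complex.Re R) Re_lipschitz.
  by under eq_fun do rewrite add0r; apply => t [t1 _]; rewrite add0r; exact: hH.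
have mRw : measurable_fun (shell tau)
    (fun t : R2 => (complex.Re (H (point_of_coords t)) * weight alpha t)%:E).
  by apply/measurable_EFinP; apply: measurable_funM => //; exact: measurable_weight.
have Rw0 (t : R2) : shell tau t ->
    (0 <= (complex.Re (H (point_of_coords t)) * weight alpha t)%:E)%E.
  by move=> [/HB /andP[h _] _]; rewrite lee_fin mulr_ge0 ?weight_ge0.
apply: (@le_trans _ _ (\int[lam]_(t in E) ((4 * d)%:E *
   (complex.Re (H (point_of_coords t)) * weight alpha t)%:E))%E).
  apply: ge0_le_integral => //.
  - by move=> t _; rewrite lee_fin weight_ge0.
  - by apply/measurable_EFinP; exact: measurable_weight.
  - by apply: measurable_funeM; exact: measurable_funS mRw.
  - by move=> t Et; rewrite -EFinM lee_fin mulrA ler_peMl ?weight_ge0// ReH.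
apply: (@le_trans _ _ (\int[lam]_(t in shell tau) ((4 * d)%:E *
   (complex.Re (H (point_of_coords t)) * weight alpha t)%:E))%E).
  apply: ge0_subset_integral => //; first exact: measurable_funeM.
  by move=> t At; rewrite mule_ge0 ?Rw0// lee_fin mulr_ge0// ltW.
rewrite ge0_integralZl//; last by rewrite lee_fin mulr_ge0// ltW.
apply: le_trans (lee_wpmul2l _ Y) _; first by rewrite lee_fin mulr_ge0// ltW.
apply: (@le_trans _ _ ((4 * d)%:E * (B0%:E * (Ka * tau `^ (1 + alpha))%:E))%E).
  apply: lee_wpmul2l; first by rewrite lee_fin mulr_ge0// ltW.
  apply: lee_pmul => //.
  - by rewrite lee_fin; have /andP[] := HB _ b0.
  - by apply: integral_ge0 => t _; rewrite lee_fin weight_ge0.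
  - exact: hKa.
rewrite -!EFinM lee_fin /tau powRM ?(ltW c10) ?(ltW d0)//.
rewrite [d `^ _]powRD; last by rewrite (gt_eqF d0) implybT.
rewrite powRr1 ?(ltW d0)// le_eqVlt; apply/orP; left; apply/eqP.
by rewrite /weight -/d; ring.
Qed.

End Disc.

(** * Exchange of integrals and boundedness on the disc *)

Section DiscComposition.
Local Open Scope complex_scope.
Context {R : realType}.
Local Notation T := (measurableTypeR R).
Local Notation C1 := 'rV[R[i]]_1.
Local Notation R2 := ((1 + 1).-tuple T).
Local Notation lam := (lebesgue_Rn R (1 + 1)).
Local Notation D := (@sqball R 1 1).

Lemma restrict_indic (E : set R2) (h : R2 -> R) : h \_ E = fun t => \1_E t * h t.
Proof. by rewrite patch_indic; apply/funext => t; rewrite /= mulrC. Qed.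

Lemma measurable_indicM (E : set R2) (h : R2 -> R) : measurable E -> measurable_fun E h ->
  measurable_fun setT (fun t => \1_E t * h t).
Proof. by move=> mE mh; rewrite -restrict_indic; exact/(measurable_restrictT _ mE). Qed.

Lemma integral_indicM (E : set R2) (h : R2 -> R) :
  (\int[lam]_(t in E) (h t)%:E = \int[lam]_t (\1_E t * h t)%:E)%E.
Proof.
rewrite integral_mkcond epatch_indic; apply: eq_integral => t _.
by rewrite /= -EFinM mulrC.
Qed.

(** Schur-type comparison: a kernel that dominates [a] when integrated in t and is dominated by [b]
    when integrated in s. *)
Lemma tonelli_le (F : R2 * R2 -> \bar R) (a b : R2 -> R) (E : set R2) :
  measurable E -> measurable_fun setT F -> (forall p, 0 <= F p)%E ->
  measurable_fun E a -> (forall s, 0 <= a s) -> measurable_fun E b ->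
  (forall s, E s -> (a s)%:E <= \int[lam]_t F (s, t))%E ->
  (forall t, \int[lam]_s F (s, t) <= (\1_E t * b t)%:E)%E ->
  (\int[lam]_(s in E) (a s)%:E <= \int[lam]_(t in E) (b t)%:E)%E.
Proof.
move=> mE mF F0 ma a0 mb aF Fb; pose sf := @lebesgue_Rn_sf R (1 + 1).
have mF1 : measurable_fun setT (fun s => \int[lam]_t F (s, t))%E.
  have := @measurable_fun_fubini_tonelli_F _ _ _ _ _ sf F mF F0; exact.
have mF2 : measurable_fun setT (fun t => \int[lam]_s F (s, t))%E.
  have := @measurable_fun_fubini_tonelli_G _ _ _ _ _ sf F mF F0; exact.
have FT : (\int[lam]_s \int[lam]_t F (s, t) = \int[lam]_t \int[lam]_s F (s, t))%E.
  exact: (@fubini_tonelli _ _ _ _ _ sf sf F mF F0).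
have IF0 s : (0 <= \int[lam]_t F (s, t))%E by exact: integral_ge0.
rewrite (integral_indicM E a) (integral_indicM E b).
apply: (@le_trans _ _ (\int[lam]_s \int[lam]_t F (s, t))%E).
  apply: ge0_le_integral => //.
  - by move=> s _; rewrite lee_fin mulr_ge0.
  - by apply/measurable_EFinP; exact: measurable_indicM.
  - move=> s _; have [Es|nE] := pselect (E s).
      by rewrite indicE mem_set// mul1r; exact: aF.
    by rewrite indicE memNset// mul0r.
rewrite FT; apply: ge0_le_integral => //.
- by move=> t _; exact: integral_ge0.
- by apply/measurable_EFinP; exact: measurable_indicM.
Qed.

(** Pairs (s, t) with t in the disc about phi(s) over which the sub-mean value inequality is
    taken. *)
Definition pick_region (phi : C1 -> C1) : set (R2 * R2) :=
  [set p | [/\ sq p.1 < 1, sq p.2 < 1 &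
    sqnorm (point_of_coords p.2 - phi (point_of_coords p.1)) <
      ((1 - sqnorm (phi (point_of_coords p.1))) / 10) ^+ 2]].

Lemma measurable_pick_region (phi : C1 -> C1) : holomorphic_on_ball phi ->
  measurable (pick_region phi).
Proof.
move=> hphi.
have mD : measurable D by exact: measurable_sqball.
(* phi is controlled on the disc only; extending its real and imaginary parts by 0 turns the region
   into an inequality between functions measurable on the whole product. *)
pose c (h : R[i] -> R) : R2 -> R := (fun s => h (phi (point_of_coords s) 0 0)) \_ D.
have mc h : (forall x y, `|h x - h y| <= modulus (x - y)) -> measurable_fun setT (c h).
  move=> lip; apply/(measurable_restrictT _ mD).
  rewrite (_ : (fun s => _) = fun s : R2 => h (phi (0 + point_of_coords s) 0 0)); last first.
    by apply/funext => s; rewrite add0r.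
  apply: (@measurable_holomorphic R 1 D (fun z => phi z 0 0) 0 h lip) => t Dt; rewrite add0r.
  by apply: differentiable_comp_coord; exact: hphi.
have mRe := mc _ (@Re_lipschitz R); have mIm := mc _ (@Im_lipschitz R).
pose dist (p : R2 * R2) := (tnth p.2 (lshift 1 0) - c (@complex.Re R) p.1) ^+ 2 +
  (tnth p.2 (rshift 1 0) - c (@complex.Im R) p.1) ^+ 2.
pose rad (p : R2 * R2) :=
  ((1 - (c (@complex.Re R) p.1 ^+ 2 + c (@complex.Im R) p.1 ^+ 2)) / 10) ^+ 2.
have m1 (g : R2 -> R) : measurable_fun setT g -> measurable_fun setT (fun p : R2 * R2 => g p.1).
  by move=> mg; exact: measurableT_comp mg measurable_fst.
have m2 (g : R2 -> R) : measurable_fun setT g -> measurable_fun setT (fun p : R2 * R2 => g p.2).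
  by move=> mg; exact: measurableT_comp mg measurable_snd.
have mdist : measurable_fun setT dist.
  apply: measurable_funD; apply: measurable_funX; apply: measurable_funB.
  - exact: (m2 (fun t => tnth t _) (measurable_tnth _)).
  - exact: m1 mRe.
  - exact: (m2 (fun t => tnth t _) (measurable_tnth _)).
  - exact: m1 mIm.
have mrad : measurable_fun setT rad.
  apply: measurable_funX; apply: measurable_funM => //; apply: measurable_funB => //.
  by apply: measurable_funD; apply: measurable_funX; exact: m1.
have -> : pick_region phi = (D `*` D) `&` (fun p => dist p < rad p) @^-1` [set true].
  have E (p : R2 * R2) : D p.1 ->
      sqnorm (point_of_coords p.2 - phi (point_of_coords p.1)) = dist p /\
      ((1 - sqnorm (phi (point_of_coords p.1))) / 10) ^+ 2 = rad p.
    move=> D1; rewrite /rad /dist /c !patchE mem_set//.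
    split; rewrite sqnorm1 modulus_sqr//.
    rewrite [X in complex.Re X]mxE.
    rewrite [X in complex.Re (X + _)]mxE [X in complex.Re (_ + X)]mxE.
    rewrite [X in complex.Im X]mxE [X in complex.Im (X + _)]mxE [X in complex.Im (_ + X)]mxE.
    by case: (phi _ _ _).
  apply/seteqP; split => p.
    by move=> [D1 D2 h]; split => //=; have [<- <-] := E _ D1.
  by move=> [[D1 D2] /= h]; split => //; have [-> ->] := E _ D1.
apply: measurableI; first exact: measurableX.
rewrite -[X in measurable X]setTI; exact: measurable_fun_ltr.
Qed.

(** [sqnorm_near] is used from phi(s) and then from t. The radius 1/10 of the distance at phi(s)
    becomes at most 1/5 of the distance at t, which allows its use in the second direction and is
    what [cap_bound] expects. *)
Lemma pick_region_comparable (phi : C1 -> C1) (s t : R2) : holomorphic_self_map phi ->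
  sq s < 1 -> sqnorm (point_of_coords t - phi (point_of_coords s)) <
      ((1 - sqnorm (phi (point_of_coords s))) / 10) ^+ 2 ->
  [/\ 1 - sqnorm (phi (point_of_coords s)) <= 2 * (1 - sq t),
      1 - sq t <= 2 * (1 - sqnorm (phi (point_of_coords s))) &
      sqnorm (point_of_coords t - phi (point_of_coords s)) <= ((1 - sq t) / 5) ^+ 2].
Proof.
move=> hphi s1; set p := phi _; set d := 1 - sqnorm p => h.
have d0 : 0 < d by rewrite subr_gt0; exact: hphi.2.
have h1 : d / 2 <= 1 - sq t.
  have := @sqnorm_near R 1 p (point_of_coords t - p) d0.
  rewrite (addrC p) subrK; apply; apply: le_trans (ltW h) _.
  rewrite -/d ler_pXn2r ?nnegrE ?divr_ge0 ?(ltW d0)//; lra.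
have t0 : 0 < 1 - sq t by lra.
have h2 : sqnorm (point_of_coords t - p) <= ((1 - sq t) / 5) ^+ 2.
  apply: le_trans (ltW h) _.
  by rewrite ler_pXn2r ?nnegrE ?divr_ge0 ?(ltW d0) ?(ltW t0)//; lra.
have h3 : (1 - sq t) / 2 <= d.
  have := @sqnorm_near R 1 (point_of_coords t) (p - point_of_coords t) t0.
  rewrite (addrC (point_of_coords t)) subrK; apply.
  by rewrite -opprB -scaleN1r sqnormZ modulusN modulus1 expr1n mul1r.
split => //; lra.
Qed.

Lemma disc_modular_bound (alpha : R) (phi : C1 -> C1) :
  -1 < alpha -> holomorphic_self_map phi ->
  exists2 A : R, 1 <= A & forall (psi : R -> R) (f : C1 -> R[i]) (C : R),
    orlicz_function psi -> 0 < C -> holomorphic_on_ball f ->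
    (weighted alpha (fun z => (psi (modulus (f (phi z)) / C))%R) <=
     A%:E * weighted alpha (fun z => (psi (modulus (f z) / C))%R))%E.
Proof.
move=> a1 hphi; have [K K0 hK] := cap_bound a1 hphi.
have [v vE v0] : exists2 v : R, v = @vball R 1 & 0 < v by exists (@vball R 1); [|exact: vball_gt0].
(* A disc of radius d / 10 has area v d^2 / 100, and replacing d by 1 - |t|^2 <= 2 d costs a factor
   4. *)
have [m mv m0] : exists2 m : R, m = 400 / v & 0 <= m.
  by exists (400 / v); [reflexivity|apply: divr_ge0; [exact: ler0n|exact: ltW]].
have [A A1 mKA] : exists2 A : R, 1 <= A & m * K <= A.
  by exists (Num.max 1 (m * K)); rewrite le_max lexx ?orbT.
exists A => // psi f C psiO C0 hf.
have mD : measurable D by exact: measurable_sqball.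
have mG := measurable_pick_region hphi.1; set G := pick_region phi in mG.
pose q (t : R2) := psi (modulus (f (point_of_coords t)) / C).
have q0 t : 0 <= q t by exact: (psi_modulus_ge0 psiO).
have mq : measurable_fun D q by exact: (measurable_psi_holomorphic psiO C0 hf).
(* The average over the disc about phi(s) is normalised at t instead of phi(s). The kernel then
   depends on s through the weight and the indicator only, and integration in s leaves the mass of a
   slice. *)
pose k (t : R2) := m * weight (- 2) t * q t.
have k0 t : 0 <= k t by exact: mulr_ge0 (mulr_ge0 m0 (weight_ge0 _ _)) (q0 t).
pose g (t : R2) := \1_D t * k t.
have g0 t : 0 <= g t by exact: mulr_ge0.
have gD t : D t -> g t = k t by move=> Dt; rewrite /g indicE mem_set// mul1r.
have mg : measurable_fun setT g.
  apply: measurable_indicM => //; apply: measurable_funM => //.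
  by apply: measurable_funM => //; exact: measurable_weight.
pose F (p : R2 * R2) : \bar R := (weight alpha p.1 * \1_G p * g p.2)%:E.
have F0 p : (0 <= F p)%E.
  by rewrite lee_fin; apply: mulr_ge0; [exact: mulr_ge0 (weight_ge0 _ _) _|exact: g0].
have mF : measurable_fun setT F.
  apply/measurable_EFinP; apply: measurable_funM; last exact: measurableT_comp mg measurable_snd.
  apply: measurable_funM; last exact: measurable_indic.
  by apply: measurableT_comp measurable_fst; exact: measurable_weight.
have ballE s : D s -> forall t,
    sqnorm (point_of_coords t - phi (point_of_coords s)) <
      ((1 - sqnorm (phi (point_of_coords s))) / 10) ^+ 2 <-> G (s, t).
  move=> s1 t; split => [h|[]//]; split => //=.
  have [h1 _ _] := pick_region_comparable hphi s1 h.
  have : 0 < 1 - sqnorm (phi (point_of_coords s)) by rewrite subr_gt0; exact: hphi.2.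
  lra.
have step1 s : D s ->
    ((weight alpha s * psi (modulus (f (phi (point_of_coords s))) / C))%:E <=
      \int[lam]_t F (s, t))%E.
  move=> s1; set p := phi _; set d := 1 - sqnorm p.
  have d0 : 0 < d by rewrite subr_gt0; exact: hphi.2.
  pose r := d / 10; have r0 : 0 < r by rewrite divr_gt0.
  have df w : sqnorm w < r ^+ 2 -> differentiable f (p + w).
    move=> wr; apply: hf; rewrite /unit_ball/=.
    have : d / 2 <= 1 - sqnorm (p + w).
      apply: sqnorm_near => //; apply: le_trans (ltW wr) _.
      by rewrite -/d ler_pXn2r ?nnegrE ?(ltW r0) ?divr_ge0 ?(ltW d0)// /r; lra.
    lra.
  have := submean_orlicz psiO C0 r0 df; rewrite -vE.
  set B := [set t : R2 | _]; set u := psi _ => sm.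
  have BG t : B t <-> G (s, t) by exact: ballE.
  have mB : measurable B.
    have -> : B = pair s @^-1` G by apply/seteqP; split => t /BG.
    by rewrite -[X in measurable X]setTI; exact: measurable_pair1.
  have BD : B `<=` D by move=> t /BG [].
  pose c := weight alpha s * (100 / (v * d ^+ 2)).
  have c0 : 0 <= c by rewrite mulr_ge0 ?weight_ge0// divr_ge0// mulr_ge0 ?sqr_ge0// ltW.
  have -> : (weight alpha s * u)%:E = (c%:E * (u * (r ^+ (1 + 1) * v))%:E)%E.
    rewrite -EFinM /c /r; congr EFin; field.
    by rewrite !gt_eqF.
  apply: le_trans (lee_wpmul2l _ sm) _; first by rewrite lee_fin.
  have mqB : measurable_fun B (fun t => (q t)%:E).
    by apply/measurable_EFinP; exact: measurable_funS mq.
  rewrite -ge0_integralZl//; last by move=> t _; rewrite lee_fin q0.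
  have -> : (\int[lam]_t F (s, t) = \int[lam]_(t in B) (weight alpha s * g t)%:E)%E.
    rewrite [RHS]integral_indicM; apply: eq_integral => t _.
    have -> : \1_B t = \1_G (s, t) :> R.
      rewrite !indicE; congr (_%:R); apply: congr1.
      by apply/idP/idP => /set_mem /BG /mem_set.
    by rewrite /F /=; congr EFin; ring.
  apply: ge0_le_integral => //.
  - by move=> t _; rewrite -EFinM lee_fin mulr_ge0//; exact: q0.
  - exact: measurable_funeM.
  - apply/measurable_EFinP; apply: measurable_funM => //.
    exact: measurable_funTS.
  - move=> t Bt; have [_ h _] := pick_region_comparable hphi s1 Bt.
    have t0 : 0 < 1 - sq t by rewrite subr_gt0; exact: BD.
    have cg : 100 / (v * d ^+ 2) <= m * weight (- 2) t.
      have -> : 100 / (v * d ^+ 2) = m * (4 * d ^+ 2)^-1.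
        by rewrite mv; field; rewrite !gt_eqF.
      rewrite /weight powRN powR_mulrn ?(ltW t0)//; apply: (ler_wpM2l m0).
      rewrite lef_pV2 ?posrE ?mulr_gt0 ?exprn_gt0//.
      have : (1 - sq t) ^+ 2 <= (2 * d) ^+ 2.
        by rewrite ler_pXn2r ?nnegrE ?mulr_ge0 ?(ltW d0) ?(ltW t0).
      by rewrite exprMn -natrX.
    rewrite -EFinM lee_fin (gD _ (BD _ Bt)) [leRHS]mulrA.
    apply: ler_wpM2r; first exact: q0.
    by rewrite /c ler_wpM2l ?weight_ge0.
have A0 : 0 <= A by exact: le_trans A1.
have step3 t : (\int[lam]_s F (s, t) <= (\1_D t * (weight alpha t * (A * q t)))%:E)%E.
  pose E : set R2 := [set s | G (s, t)].
  have mE : measurable E.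
    have -> : E = pair^~ t @^-1` G by [].
    by rewrite -[X in measurable X]setTI; exact: measurable_pair2.
  have -> : (\int[lam]_s F (s, t) = \int[lam]_(s in E) (g t * weight alpha s)%:E)%E.
    rewrite [RHS]integral_indicM; apply: eq_integral => s _.
    have -> : \1_E s = \1_G (s, t) :> R by rewrite !indicE.
    by rewrite /F /=; congr EFin; ring.
  under eq_integral do rewrite EFinM.
  rewrite ge0_integralZl//; last 3 first.
  - by apply/measurable_EFinP; exact: measurable_weight.
  - by move=> s _; rewrite lee_fin weight_ge0.
  - by rewrite lee_fin.
  have [Dt|nD] := pselect (D t); last first.
    by rewrite /g indicE memNset// !mul0r mul0e.
  have t0 : 0 < 1 - sq t by rewrite subr_gt0.
  rewrite (gD _ Dt) indicE mem_set// mul1r.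
  have kt0 : (0 <= (k t)%:E)%E by rewrite lee_fin.
  (* The factor (1 - |t|^2)^2 of [cap_bound] cancels the weight of exponent - 2 in [k]. *)
  apply: le_trans (lee_wpmul2l kt0 (hK t E Dt mE _)) _.
    by move=> s [s1 _ h]; have [h1 _ h3] := pick_region_comparable hphi s1 h.
  rewrite -EFinM lee_fin.
  have -> : k t * (K * ((1 - sq t) ^+ 2 * weight alpha t)) =
      m * K * (weight alpha t * q t).
    rewrite /k [weight (- 2) t]/weight powRN powR_mulrn ?(ltW t0)//.
    by field; rewrite !gt_eqF.
  rewrite [leRHS]mulrCA; apply: ler_wpM2r; last exact: mKA.
  exact: mulr_ge0 (weight_ge0 _ _) (q0 t).
have mqp := measurable_psi_holomorphic psiO C0 (holomorphic_comp hphi hf).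
rewrite -(weightedZ _ A0 (fun z => psi_modulus_ge0 psiO f z C0) mq).
apply: (tonelli_le mD mF F0 _ _ _ step1).
- by apply: measurable_funM mqp; exact: measurable_weight.
- by move=> s; apply: mulr_ge0; [exact: weight_ge0|exact: (psi_modulus_ge0 psiO)].
- by apply: measurable_funM; [exact: measurable_weight|exact: measurable_funM mq].
- exact: step3.
Qed.

Lemma bounded_composition_disc (alpha : R) (psi : R -> R) (phi : C1 -> C1) :
  -1 < alpha -> orlicz_function psi -> holomorphic_self_map phi ->
  bounded_on_bergman_orlicz alpha psi (composition_operator phi).
Proof.
move=> a1 psiO hphi; have [A A1 hA] := disc_modular_bound a1 hphi.
have A0 : 0 < A by exact: lt_le_trans A1.
apply: (@bounded_of_modular R 1 alpha psi psiO _ A A0).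
  by move=> f; exact: holomorphic_comp.
move=> f C hf C0 fC; have hfp := holomorphic_comp hphi hf.
apply: le_trans (orlicz_modular_contract _ psiO C0 A1 hfp) _.
apply: le_trans fC; rewrite !orlicz_modularE//.
set k := normalization _.
have k0 : 0 <= k by exact: normalization_ge0.
rewrite muleCA lee_wpmul2l ?lee_fin//.
apply: le_trans (lee_wpmul2l _ (hA psi f C psiO C0 hf)) _.
  by rewrite lee_fin invr_ge0 ltW.
by rewrite muleA -EFinM mulVf ?gt_eqF// mul1e.
Qed.

End DiscComposition.

Unset Implicit Arguments.
Set Strict Implicit.
Set Printing Implicit Defensive.

Theorem theorem3p7 (R : realType) (alpha : R) (psi : R -> R)
    (alpha_gtN1 : -1 < alpha) (psi_orlicz : orlicz_function psi) :
  (forall phi : 'rV[R[i]]_1 -> 'rV[R[i]]_1, holomorphic_self_map phi ->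
     bounded_on_bergman_orlicz alpha psi (composition_operator phi)) /\
  (forall N : nat, (1 < N)%N -> Delta2_condition psi ->
     forall phi : 'rV[R[i]]_N -> 'rV[R[i]]_N, holomorphic_self_map phi ->
       bounded_on_bergman_orlicz alpha psi (composition_operator phi)).
Proof.
split=> [phi hphi|N _ D2 phi hphi]; first exact: bounded_composition_disc.
exact: bounded_composition_Delta2.
Qed.
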